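(* (i) Let $(m_n)_{n\in\mathbb N}\subset\{z\in\mathbb C\setminus\{0\}: |\Re(z)|<1\}$ and $(\kappa_n)_{n\in\mathbb N}\subset\mathbb C\setminus\{0\}$ be two sequences, set $$\varsigma_n:=\kappa_n\frac{\Gamma(-m_n)}{\Gamma(m_n)},\qquad a_n:=\Re\Big(\frac1{m_n}\ln(\varsigma_n)\Big),\qquad b_n:=\Im\Big(\frac1{m_n}\ln(\varsigma_n)\Big),$$ and assume that $(a_n)$ converges to $a_\infty\in\mathbb R$. If $(b_n)$ is a strictly increasing sequence converging to $\pi$, then for $n$ large enough there exists $\lambda_n\in\sigma_{\mathrm p}(H_{m_n,\kappa_n})$ with $\lambda_n\in\mathbb C_+$, and $\lambda_n\to4e^{-a_\infty}$ as $n\to\infty$. If $(b_n)$ is a strictly decreasing sequence converging to $-\pi$, then for $n$ large enough there exists $\lambda_n\in\sigma_{\mathrm p}(H_{m_n,\kappa_n})$ with $\lambda_n\in\mathbb C_-$, and $\lambda_n\to4e^{-a_\infty}$ as $n\to\infty$. The value $4e^{-a_\infty}$ is not an eigenvalue of any operator $H_{m,\kappa}$. (ii) Let $(a_n)_{n\in\mathbb N}\subset\mathbb R$ be a sequence converging to $a_\infty\in\mathbb R$. If $(b_n)_{n\in\mathbb N}\subset(0,\frac\pi2)$ is an increasing sequence converging to $\frac\pi2$, then for any $n\in\mathbb N$ and $\nu_n:=a_n+ib_n$ one has $\sigma_{\mathrm p}(H_0^{\nu_n})=\{\lambda_n\}\subset\mathbb C_-$, and $\lambda_n\to4e^{2(a_\infty-\gamma)}$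 as $n\to\infty$. If $(b_n)_{n\in\mathbb N}\subset(-\frac\pi2,0)$ is a decreasing sequence converging to $-\frac\pi2$, then for any $n\in\mathbb N$ and $\nu_n:=a_n+ib_n$ one has $\sigma_{\mathrm p}(H_0^{\nu_n})=\{\lambda_n\}\subset\mathbb C_+$, and $\lambda_n\to4e^{2(a_\infty-\gamma)}$ as $n\to\infty$. The value $4e^{2(a_\infty-\gamma)}$ is not an eigenvalue of any operator $H_0^\nu$.
   Context: For $m\in\mathbb C$ let $L_{m^2}:=-\partial_r^2+(m^2-\frac14)\frac1{r^2}$ act on distributions on $\mathbb R_+=(0,\infty)$. The maximal operator $L_{m^2}^{\max}$ in $L^2(\mathbb R_+)$ has domain $\mathcal D(L_{m^2}^{\max})=\{f\in L^2(\mathbb R_+): L_{m^2}f\in L^2(\mathbb R_+)\}$, and $L_{m^2}^{\min}$ is the closure of the restriction of $L_{m^2}$ to $C_c^\infty(\mathbb R_+)$. ''$g\in\mathcal D(L_{m^2}^{\min})$ around $0$'' means that there is $\zeta\in C_c^\infty([0,\infty))$ with $\zeta=1$ near $0$ and $g\zeta\in\mathcal D(L_{m^2}^{\min})$. For $m\in\mathbb C\setminus\{0\}$ with $|\Re(m)|<1$ and $\kappa\in\mathbb C$, $H_{m,\kappa}$ is the restriction of $L_{m^2}^{\max}$ to the set of $f\in\mathcal D(L_{m^2}^{\max})$ such that for some $c\in\mathbb C$, $f(r)-c(\kappa r^{1/2-m}+r^{1/2+m})\in\mathcal D(L_{m^2}^{\min})$ around $0$. For $\nu\in\mathbb C$,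 $H_0^\nu$ is the restriction of $L_0^{\max}$ to the set of $f\in\mathcal D(L_0^{\max})$ such that for some $c\in\mathbb C$, $f(r)-c(r^{1/2}\ln r+\nu r^{1/2})\in\mathcal D(L_0^{\min})$ around $0$. $\Gamma$ is the Gamma function, $\gamma$ is Euler's constant, $\ln$ is the principal logarithm (imaginary part in $(-\pi,\pi]$), $\sigma_{\mathrm p}$ is the set of eigenvalues, and $\mathbb C_\pm:=\{z\in\mathbb C:\pm\Im(z)>0\}$. *)

(* Defs.v *)
From HB Require Import structures.
From mathcomp Require Import all_boot all_order all_algebra.
From mathcomp Require Import all_classical all_reals all_analysis.
From mathcomp Require Import complex.

Set Implicit Arguments.
Unset Strict Implicit.
Unset Printing Implicit Defensive.

Import Order.TTheory GRing.Theory Num.Theory.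
Import numFieldNormedType.Exports.
Import complex.

Local Open Scope classical_set_scope.
Local Open Scope ring_scope.
Local Open Scope complex_scope.

Definition cexp {R : realType} (z : R[i]) : R[i] :=
  (expR (Re z))%:C * (cos (Im z) +i* sin (Im z)).

Definition carg {R : realType} (z : R[i]) : R :=
  let t := acos (Re z / ComplexField.Normc.normc z) in
  if 0 <= Im z then t else - t.

(* Principal logarithm: [acos] has values in [0, pi], so the imaginary part
   lies in ]-pi, pi].  Only meaningful for z != 0. *)
Definition clog {R : realType} (z : R[i]) : R[i] :=
  ln (ComplexField.Normc.normc z) +i* carg z.

(* r ^ z, only meaningful for r > 0. *)
Definition cpowR {R : realType} (r : R) (z : R[i]) : R[i] :=
  cexp (z * (ln r)%:C).

Definition Rpos {R : realType} : set R := `]0, +oo[.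

(* The integral over (0, oo) of a complex-valued function. *)
Definition cint {R : realType} (f : R -> R[i]) : R[i] :=
  (\int[lebesgue_measure]_(r in Rpos) Re (f r)) +i*
  (\int[lebesgue_measure]_(r in Rpos) Im (f r)).

Definition Gamma_int {R : realType} (z : R[i]) : R[i] :=
  cint (fun t => cpowR t (z - 1) * (expR (- t))%:C).

(* Euler's integral for Re z > 0, extended by
   Gamma z = Gamma (z + n) / (z (z + 1) ... (z + n - 1))
   with n the least integer such that Re z + n > 0.
   (Junk value 0 at the poles 0, -1, -2, etc.) *)
Definition Gamma {R : realType} (z : R[i]) : R[i] :=
  if 0 < Re z then Gamma_int z
  else let n := (Num.truncn (- Re z)).+1 in
    Gamma_int (z + n%:R) / \prod_(k < n) (z + k%:R).

Definition euler_gamma {R : realType} : R :=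
  limn (fun n : nat => \sum_(1 <= k < n.+1) (k%:R : R)^-1 - ln (n%:R : R)).

Definition smooth {R : realType} (f : R -> R[i]) : Prop :=
  forall (n : nat) (x : R),
    derivable (derive1n n (fun r => Re (f r))) x 1 /\
    derivable (derive1n n (fun r => Im (f r))) x 1.

Definition cderive {R : realType} (f : R -> R[i]) : R -> R[i] :=
  fun x => derive1 (fun r => Re (f r)) x +i* derive1 (fun r => Im (f r)) x.

(* C_c^oo(U), for U open; its elements are extended by 0 to the whole line. *)
Definition Cc_infty {R : realType} (U : set R) : set (R -> R[i]) :=
  [set f | [/\ smooth f, compact (closure [set x | f x != 0]) &
               closure [set x | f x != 0] `<=` U]].

(* Elements of L^2(0, oo) are represented by measurable functions defined on
   the whole line, whose values outside (0, oo) are irrelevant. *)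
Definition sqnormL2 {R : realType} (f : R -> R[i]) : \bar R :=
  (\int[lebesgue_measure]_(r in Rpos) ((ComplexField.Normc.normc (f r)) ^+ 2)%:E)%E.

Definition L2 {R : realType} : set (R -> R[i]) :=
  [set f | [/\ measurable_fun Rpos (fun r => Re (f r)),
               measurable_fun Rpos (fun r => Im (f r)) &
               (sqnormL2 f < +oo)%E]].

Definition zeroL2 {R : realType} (f : R -> R[i]) : Prop :=
  {ae lebesgue_measure, forall r : R, Rpos r -> f r = 0}.

(* Distributions on (0, oo) as functionals on the test functions, i.e. on
   Cc_infty Rpos; their values elsewhere are irrelevant.  Only the regular
   distributions and their images under the operations below are used, so
   linearity and continuity need not be recorded. *)
Definition distribution (R : realType) := (R -> R[i]) -> R[i].

Definition eq_distr {R : realType} (T S : distribution R) : Prop :=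
  forall phi, Cc_infty Rpos phi -> T phi = S phi.

Definition distr_of_fun {R : realType} (f : R -> R[i]) : distribution R :=
  fun phi => cint (fun r => f r * phi r).

Definition distr_derive {R : realType} (T : distribution R) : distribution R :=
  fun phi => - T (cderive phi).

Definition distr_mul {R : realType} (a : R -> R[i]) (T : distribution R) :
    distribution R :=
  fun phi => T (fun r => a r * phi r).

(* L_alpha = - d^2/dr^2 + (alpha - 1/4) / r^2; the text has alpha = m^2. *)
Definition Lop {R : realType} (alpha : R[i]) (T : distribution R) :
    distribution R :=
  fun phi => - distr_derive (distr_derive T) phi +
             distr_mul (fun r => (alpha - 4^-1) * ((r ^+ 2)^-1)%:C) T phi.

(* Unbounded operators on L^2(0, oo), given by their graphs. *)
Definition operator (R : realType) := (R -> R[i]) -> (R -> R[i]) -> Prop.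

Definition dom {R : realType} (A : operator R) : set (R -> R[i]) :=
  [set f | exists g, A f g].

Definition op_restr {R : realType} (A : operator R) (D : set (R -> R[i])) :
    operator R :=
  fun f g => A f g /\ D f.

Definition op_closure {R : realType} (A : operator R) : operator R :=
  fun f g => [/\ L2 f, L2 g & forall e : R, 0 < e ->
    exists phi psi, [/\ A phi psi,
      (sqnormL2 (fun r => (f r - phi r)%R) < e%:E)%E &
      (sqnormL2 (fun r => (g r - psi r)%R) < e%:E)%E]].

Definition sigma_p {R : realType} (A : operator R) : set R[i] :=
  [set lambda | exists2 f, A f (fun r => lambda * f r) & ~ zeroL2 f].

Definition Lmax {R : realType} (alpha : R[i]) : operator R :=
  fun f g =>
    [/\ L2 f, L2 g & eq_distr (Lop alpha (distr_of_fun f)) (distr_of_fun g)].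

Definition Lmin {R : realType} (alpha : R[i]) : operator R :=
  op_closure (op_restr (Lmax alpha) (Cc_infty Rpos)).

(* C_c^oo([0, oo)) consists of the restrictions to [0, oo) of the elements of
   C_c^oo(R). *)
Definition around0 {R : realType} (D : set (R -> R[i])) (g : R -> R[i]) : Prop :=
  exists zeta : R -> R[i],
    [/\ Cc_infty setT zeta,
        (exists2 d : R, 0 < d & forall r, 0 <= r < d -> zeta r = 1) &
        D (fun r => g r * zeta r)].

Definition H_mk {R : realType} (m kappa : R[i]) : operator R :=
  op_restr (Lmax (m ^+ 2)) [set f | exists c : R[i],
    around0 (dom (Lmin (m ^+ 2)))
      (fun r => f r -
        c * (kappa * cpowR r (2^-1 - m) + cpowR r (2^-1 + m)))].

Definition H_0 {R : realType} (nu : R[i]) : operator R :=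
  op_restr (Lmax 0) [set f | exists c : R[i],
    around0 (dom (Lmin 0))
      (fun r => f r -
        c * (cpowR r 2^-1 * (ln r)%:C + nu * cpowR r 2^-1))].

Definition varsigma {R : realType} (m kappa : R[i]) : R[i] :=
  kappa * (Gamma (- m) / Gamma m).

(* Main.v *)
Require Import Defs.
From HB Require Import structures.
From mathcomp Require Import all_boot all_order all_algebra.
From mathcomp Require Import all_classical all_reals all_analysis.
From mathcomp Require Import complex.
From mathcomp Require Import measurable_realfun.
From mathcomp Require Import ring lra.

(** Write [p = exp s] with [|Im s| < pi / 2] and
    [G_m(r) = int_0^oo exp (- p (t + r^2 / t)) t^(m - 1) dt].  The function
    [u(r) = r^(1/2 - m) G_m(r)], called [bes] below, is a modified Bessel function:
    it decays at infinity because [Re p > 0], it is square integrable at [0] because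
    [|Re m| < 1], and it satisfies [L_(m^2) u = lambda u] with
    [lambda = - 4 exp (2 s)].  So [u] is an eigenfunction for the boundary condition
    that it happens to satisfy, and everything rests on its behaviour at [0].

    An integration by parts and the inversion [t |-> r^2 / t] give the exact identity
    [m G_m(r) = p (G_(1+m)(r) - r^(2 m) G_(1-m)(r))] ([G_split]), in which
    [G_(1+m)] and [G_(1-m)] are continuous down to [r = 0].  It shows both powers
    [r^(1/2 - m)] and [r^(1/2 + m)] in [u] with their coefficients, up to a remainder
    of size [r^(3/2 + eta)], which belongs to the minimal domain near [0]
    ([Lmin_intro]).  Turning the ray of integration gives
    [G_m(0) = exp (- m s) Gamma(m)] ([G0_rotation]), and the ratio of the coefficients
    becomes the condition [varsigma = exp (- 2 m s)] ([bes_boundary],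
    [H_mk_eigenvalue]).  It holds for [s = - (a + i b) / 2], admissible as soon as
    [|b| < pi], and then [lambda = - 4 exp (- a - i b)] has imaginary part
    [4 exp (- a) sin b] and tends to [4 exp (- a_oo)] as [b] tends to [pi] or [- pi].
    For [m = 0] the same integration by parts produces
    [G_0 = 2 p (H - ln r G_1)], where [H] is the integral of the kernel of [G_1] times
    [ln t] ([G_split0]).  As [p H(0) = - gamma - s] by the rotation and by
    [Gamma'(1) = - gamma] ([H0_rotation], [H10]), the boundary condition is
    [nu = s + gamma] ([bes0_boundary]).

    The remaining claims say that certain solutions [f] of [L f = lambda f] vanish.
    Regularity of [f] is never needed: [f] is only paired with smooth functions, and
    Green's formula moves the operator onto them.  For [lambda = w^2 > 0], let [phi]
    be the solution of [phi'' + w^2 phi = psi] that vanishes near [0], where [psi] is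
    a test function.  It is bounded, so that square integrability of [f] allows the
    cutoff at infinity to be removed ([green_infinity]), and [f] pairs in the same way
    with [psi] and with [(alpha - 1/4) r^(-2) phi].  For the weight
    [r^(-2) exp (- N / r)] this passage is a contraction when [N] is large, and
    iterating it shows that [f] annihilates every test function
    ([no_positive_eigenvalue]); [no_zero_eigenvalue] is a simpler variant.

    For the equality of spectra in the second part, [f = c w + g] near [0] with [w] the
    given boundary behaviour and [g] in the minimal domain.  Green's formula then
    leaves at [0] only the boundary term between [c w] and the function paired with [f]
    ([green_boundary]).  Pairing with [u] gives [c] times a Wronskian, that is
    [c (nu - s - gamma) = 0] ([unique_boundary]).  If [c = 0], pairing with solutions
    of [L_0 phi = psi] that vanish near infinity is again a contraction, now for the
    weight [exp (- N r)], and [f = 0] ([unique_minimal]). *)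

Set Implicit Arguments.
Unset Strict Implicit.
Unset Printing Implicit Defensive.

Import Order.TTheory GRing.Theory Num.Theory.
Import numFieldNormedType.Exports.
Import complex.

Local Open Scope classical_set_scope.
Local Open Scope ring_scope.
Local Open Scope complex_scope.

Local Notation normc := ComplexField.Normc.normc.
Local Notation mu := lebesgue_measure.

(** * Complex-valued functions of a real variable *)

Section ComplexToolkit.
Context {R : realType}.
Implicit Types (z w : R[i]) (f g : R -> R[i]) (x : R).

Lemma ReM z w : Re (z * w) = Re z * Re w - Im z * Im w.
Proof. by case: z w => [a b] [c d]. Qed.
Lemma ImM z w : Im (z * w) = Re z * Im w + Im z * Re w.
Proof. by case: z w => [a b] [c d]. Qed.
Lemma ReD z w : Re (z + w) = Re z + Re w. Proof. by case: z w => [a b] [c d]. Qed.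
Lemma ImD z w : Im (z + w) = Im z + Im w. Proof. by case: z w => [a b] [c d]. Qed.
Lemma ReN z : Re (- z) = - Re z. Proof. by case: z. Qed.
Lemma ImN z : Im (- z) = - Im z. Proof. by case: z. Qed.
Lemma complexP z w : Re z = Re w -> Im z = Im w -> z = w.
Proof. by case: z w => [a b] [c d] /= -> ->. Qed.

Lemma normc_ge0 z : 0 <= normc z.
Proof. by case: z => a b; rewrite /= sqrtr_ge0. Qed.
Lemma normc_Re z : `|Re z| <= normc z.
Proof.
by case: z => a b /=; rewrite -sqrtr_sqr ler_wsqrtr// lerDl sqr_ge0.
Qed.
Lemma normc_Im z : `|Im z| <= normc z.
Proof.
by case: z => a b /=; rewrite -sqrtr_sqr ler_wsqrtr// lerDr sqr_ge0.
Qed.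
Lemma normc_le z : normc z <= `|Re z| + `|Im z|.
Proof.
case: z => a b /=; rewrite -(ler_pXn2r (n:=2)) ?nnegrE ?addr_ge0 ?sqrtr_ge0//.
rewrite sqr_sqrtr ?addr_ge0 ?sqr_ge0// sqrrD !real_normK ?num_real//.
by rewrite addrAC lerDl mulrn_wge0// mulr_ge0.
Qed.
Lemma sqr_normc_ReIm z : normc z ^+ 2 = Re z ^+ 2 + Im z ^+ 2.
Proof. by case: z => a b /=; rewrite sqr_sqrtr ?addr_ge0 ?sqr_ge0. Qed.
Lemma normcM z w : normc (z * w) = normc z * normc w.
Proof. exact: ComplexField.Normc.normcM. Qed.
Lemma normcD z w : normc (z + w) <= normc z + normc w.
Proof. exact: le_normcD. Qed.
Lemma normcB z w : normc (z - w) <= normc z + normc w.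
Proof. by rewrite -(normcN w) normcD. Qed.
Lemma normcR (x : R) : normc x%:C = `|x|.
Proof. by rewrite /= expr0n addr0 sqrtr_sqr. Qed.
Lemma normc_eq0 z : (normc z == 0) = (z == 0).
Proof.
apply/eqP/eqP => [/ComplexField.Normc.eq0_normc//|->].
by rewrite /= expr0n/= addr0 sqrtr0.
Qed.
Lemma normc_gt0 z : (0 < normc z) = (z != 0).
Proof. by rewrite lt_neqAle normc_ge0 andbT eq_sym normc_eq0. Qed.
Lemma cexpD z w : cexp (z + w) = cexp z * cexp w.
Proof.
rewrite /cexp ReD ImD expRD cosD sinD; apply: complexP; rewrite !(ReM,ImM)/=; ring.
Qed.
Lemma cexp0 : cexp (0 : R[i]) = 1.
Proof. by rewrite /cexp /= expR0 cos0 sin0 mul1r. Qed.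
Lemma normc_cexp z : normc (cexp z) = expR (Re z).
Proof.
by rewrite /cexp normcM normcR gtr0_norm ?expR_gt0//= cos2Dsin2 sqrtr1 mulr1.
Qed.
Lemma cexp_neq0 z : cexp z != 0.
Proof. by rewrite -normc_gt0 normc_cexp expR_gt0. Qed.
Lemma cexpN z : cexp (- z) = (cexp z)^-1.
Proof.
apply: (mulfI (cexp_neq0 z)); rewrite -cexpD subrr cexp0 divff//.
exact: cexp_neq0.
Qed.
Lemma cexpR (x : R) : cexp x%:C = (expR x)%:C.
Proof. by rewrite /cexp /= cos0 sin0 mulr1. Qed.

(** Re and Im are differentiated separately, which keeps the real-variable
    theory of derivatives applicable without any topology on [R[i]]. *)
Definition cder f x (d : R[i]) :=
  is_derive x 1 (fun r => Re (f r)) (Re d) /\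
  is_derive x 1 (fun r => Im (f r)) (Im d).

Lemma cder_eq f x d d' : cder f x d -> d = d' -> cder f x d'.
Proof. by move=> ? <-. Qed.

Lemma cder_ext f g x d : (\forall y \near x, f y = g y) ->
  cder f x d -> cder g x d.
Proof.
move=> fg [f1 f2]; split.
  by apply: (near_eq_is_derive (f := fun r => Re (f r))) => //;
    near=> y; congr Re; near: y.
by apply: (near_eq_is_derive (f := fun r => Im (f r))) => //;
    near=> y; congr Im; near: y.
Unshelve. all: by end_near. Qed.

Lemma cder_cst (c : R[i]) x : cder (fun=> c) x 0.
Proof. by split; exact: is_derive_cst. Qed.

Lemma cderD f g x d e : cder f x d -> cder g x e ->
  cder (fun y => f y + g y) x (d + e).
Proof.
move=> [f1 f2] [g1 g2]; split.
  rewrite (_ : (fun _ => _) = (fun r => Re (f r)) + (fun r => Re (g r))); last first.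
    by apply/funext => r; rewrite ReD.
  by rewrite ReD; exact: is_deriveD.
rewrite (_ : (fun _ => _) = (fun r => Im (f r)) + (fun r => Im (g r))); last first.
  by apply/funext => r; rewrite ImD.
by rewrite ImD; exact: is_deriveD.
Qed.

Lemma cderN f x d : cder f x d -> cder (fun y => - f y) x (- d).
Proof.
move=> [f1 f2]; split.
  rewrite (_ : (fun _ => _) = - (fun r => Re (f r))); last first.
    by apply/funext => r; rewrite ReN.
  by rewrite ReN; exact: is_deriveN.
rewrite (_ : (fun _ => _) = - (fun r => Im (f r))); last first.
  by apply/funext => r; rewrite ImN.
by rewrite ImN; exact: is_deriveN.
Qed.

Lemma cderB f g x d e : cder f x d -> cder g x e ->
  cder (fun y => f y - g y) x (d - e).
Proof. by move=> cf /cderN; exact: cderD. Qed.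

Lemma cderM f g x d e : cder f x d -> cder g x e ->
  cder (fun y => f y * g y) x (d * g x + f x * e).
Proof.
move=> [f1 f2] [g1 g2]; split.
  rewrite (_ : (fun _ => _) = (fun r => Re (f r)) * (fun r => Re (g r)) -
     (fun r => Im (f r)) * (fun r => Im (g r))); last first.
    by apply/funext => r; rewrite ReM.
  apply: is_derive_eq; rewrite ReD !ReM /GRing.scale/=; ring.
rewrite (_ : (fun _ => _) = (fun r => Re (f r)) * (fun r => Im (g r)) +
     (fun r => Im (f r)) * (fun r => Re (g r))); last first.
  by apply/funext => r; rewrite ImM.
apply: is_derive_eq (is_deriveD (is_deriveM f1 g2) (is_deriveM f2 g1)) _; rewrite [RHS]ImD [in RHS](ImM d) [in RHS](ImM (f x)).
rewrite -![_ *: _]/(_ * _).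
move: (Re (f x)) (Im (f x)) (Re (g x)) (Im (g x)) (Re d) (Im d) (Re e) (Im e) => *; ring.
Qed.

Lemma cderZ c f x d : cder f x d -> cder (fun y => c * f y) x (c * d).
Proof.
by move=> /(cderM (cder_cst c x)) /cder_eq; apply; rewrite mul0r add0r.
Qed.

Lemma cder_real (h : R -> R) x (d : R) : is_derive x 1 h d ->
  cder (fun y => (h y)%:C) x d%:C.
Proof. by move=> hd; split => //=; exact: is_derive_cst. Qed.

Lemma cder_cexp f x d : cder f x d ->
  cder (fun y => cexp (f y)) x (d * cexp (f x)).
Proof.
move=> [f1 f2].
rewrite /cexp.
have h1 : cder (fun y => (expR (Re (f y)))%:C) x (Re d * expR (Re (f x)))%:C.
  apply: cder_real.
  rewrite (_ : (fun _ => _) = expR \o (fun r => Re (f r)))//.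
  by apply: is_derive_eq; rewrite /GRing.scale/= mulrC.
have h2 : cder (fun y => cos (Im (f y)) +i* sin (Im (f y))) x
    ((- sin (Im (f x)) * Im d) +i* (cos (Im (f x)) * Im d)).
  split => /=.
    rewrite (_ : (fun _ => _) = cos \o (fun r => Im (f r)))//.
    by apply: is_derive_eq; rewrite /GRing.scale/= mulrC.
  rewrite (_ : (fun _ => _) = sin \o (fun r => Im (f r)))//.
  by apply: is_derive_eq; rewrite /GRing.scale/= mulrC.
apply: cder_eq (cderM h1 h2) _.
apply: complexP; rewrite !(ReM,ImM,ReD,ImD)/=; ring.
Qed.

Lemma cder_comp f (h : R -> R) x d e : is_derive x 1 h e ->
  cder f (h x) d -> cder (fun y => f (h y)) x (d * e%:C).
Proof.
move=> he [f1 f2]; split.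
  rewrite (_ : (fun _ => _) = (fun r => Re (f r)) \o h)//.
  by apply: is_derive_eq; rewrite ReM/= /GRing.scale/=; ring.
rewrite (_ : (fun _ => _) = (fun r => Im (f r)) \o h)//.
by apply: is_derive_eq; rewrite ImM/= /GRing.scale/=; ring.
Qed.

Lemma cder_uniq f x d e : cder f x d -> cder f x e -> d = e.
Proof.
move=> [[_ d1] [_ d2]] [[_ e1] [_ e2]]; apply: complexP.
  by rewrite -d1 -e1.
by rewrite -d2 -e2.
Qed.

Lemma cder_cderive f x d : cder f x d -> cderive f x = d.
Proof.
move=> [[_ d1] [_ d2]]; apply: complexP => /=.
  by rewrite derive1E.
by rewrite derive1E.
Qed.

Lemma cder_ln x : 0 < x -> cder (fun y => (ln y)%:C) x (x^-1)%:C.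
Proof. by move=> x0; apply: cder_real; exact: is_derive1_ln. Qed.

Lemma cder_id x : cder (fun y => y%:C) x 1.
Proof. exact: (cder_real (is_derive_id x 1)). Qed.

Lemma cpowR_gt0S x z : 0 < x -> cpowR x (z + 1) = cpowR x z * x%:C.
Proof.
by move=> x0; rewrite /cpowR mulrDl cexpD mul1r cexpR lnK.
Qed.

Lemma cpowRD x z w : cpowR x (z + w) = cpowR x z * cpowR x w.
Proof. by rewrite /cpowR mulrDl cexpD. Qed.

Lemma cpowR0 x : cpowR x 0 = 1 :> R[i].
Proof. by rewrite /cpowR mul0r cexp0. Qed.

Lemma cpowR1 x : 0 < x -> cpowR x 1 = x%:C.
Proof. by move=> x0; rewrite /cpowR mul1r cexpR lnK. Qed.

Lemma cpowRN x z : cpowR x (- z) = (cpowR x z)^-1.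
Proof. by rewrite /cpowR mulNr cexpN. Qed.

Lemma cpowRN1 x : 0 < x -> cpowR x (- 1) = (x^-1)%:C.
Proof. by move=> x0; rewrite cpowRN cpowR1// fmorphV. Qed.

Lemma cpowR_neq0 x z : cpowR x z != 0.
Proof. exact: cexp_neq0. Qed.

Lemma normc_cpowR x z : normc (cpowR x z) = expR (Re z * ln x).
Proof. by rewrite /cpowR normc_cexp ReM/= mulr0 subr0. Qed.

Lemma cder_cpowR z x : 0 < x -> cder (fun y => cpowR y z) x (z * cpowR x (z - 1)).
Proof.
move=> x0; apply: cder_eq (cder_cexp (cderZ z (cder_ln x0))) _.
by rewrite -/(cpowR x z) cpowRD cpowRN1//; ring.
Qed.

End ComplexToolkit.

(** * Integration over the half-line *)

Section HalfLine.
Context {R : realType}.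
Implicit Types (f g F : R -> R) (a b x y e K : R).
Local Notation mu := (@lebesgue_measure R).
Local Notation Rp := (@Rpos R).

Definition Rint f := mu.-integrable Rp (EFin \o f).
Definition rI f : R := \int[mu]_(r in Rp) f r.

Lemma RposP x : Rp x <-> 0 < x.
Proof. by rewrite /Rpos /= in_itv/= andbT. Qed.

Lemma Rpos_gt0 x : Rp x -> 0 < x. Proof. by move/RposP. Qed.

Lemma measurable_Rpos : measurable Rp.
Proof. exact: measurable_itv. Qed.
Local Hint Resolve measurable_Rpos : core.

Lemma open_Rpos : open Rp.
Proof. exact: interval_open. Qed.

Lemma measurable_cont_Rpos f : (forall x, 0 < x -> {for x, continuous f}) ->
  measurable_fun Rp f.
Proof.
move=> cf; apply: open_continuous_measurable_fun; first exact: open_Rpos.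
by move=> x; rewrite inE => /Rpos_gt0 /cf.
Qed.

Lemma Rint_meas f : Rint f -> measurable_fun Rp f.
Proof. by move=> /measurable_int /measurable_EFinP. Qed.

Lemma Rint_le f g : measurable_fun Rp f -> (forall x, 0 < x -> `|f x| <= g x) ->
  Rint g -> Rint f.
Proof.
move=> mf fg ig; apply: le_integrable (ig) => //; first exact/measurable_EFinP.
by move=> x /Rpos_gt0 /fg fgx; rewrite /= lee_fin (le_trans fgx)// ler_norm.
Qed.

Lemma Rint_eq f g : (forall x, 0 < x -> f x = g x) -> Rint f -> Rint g.
Proof.
move=> fg; apply: eq_integrable => //= x; rewrite inE => /Rpos_gt0 /fg.
by move=> /= ->.
Qed.

Lemma RintD f g : Rint f -> Rint g -> Rint (fun x => f x + g x).
Proof. by move=> i j; rewrite /Rint /comp; under eq_fun do rewrite EFinD; exact: integrableD. Qed.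

Lemma RintZ c f : Rint f -> Rint (fun x => c * f x).
Proof. by move=> i; rewrite /Rint /comp; under eq_fun do rewrite EFinM; exact: integrableZl. Qed.

Lemma RintN f : Rint f -> Rint (fun x => - f x).
Proof. by move=> /(RintZ (-1)); apply: Rint_eq => x _; rewrite mulN1r. Qed.

Lemma RintB f g : Rint f -> Rint g -> Rint (fun x => f x - g x).
Proof. by move=> i /RintN j; exact: RintD. Qed.

Lemma Rint_norm f : Rint f -> Rint (fun x => `|f x|).
Proof. by move=> i; exact: integrable_norm. Qed.

Lemma Rint0 : Rint (fun=> 0).
Proof. exact: integrable0. Qed.

Lemma rI_eq f g : (forall x, 0 < x -> f x = g x) -> rI f = rI g.
Proof. by move=> fg; apply: eq_Rintegral => x; rewrite inE => /Rpos_gt0 /fg. Qed.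

Lemma rID f g : Rint f -> Rint g -> rI (fun x => f x + g x) = rI f + rI g.
Proof. by move=> i j; rewrite /rI RintegralD. Qed.

Lemma rIZ c f : Rint f -> rI (fun x => c * f x) = c * rI f.
Proof. by move=> i; rewrite /rI RintegralZl. Qed.

Lemma rIB f g : Rint f -> Rint g -> rI (fun x => f x - g x) = rI f - rI g.
Proof. by move=> i j; rewrite /rI RintegralB. Qed.

Lemma rI_le f g : Rint f -> Rint g -> (forall x, 0 < x -> f x <= g x) ->
  rI f <= rI g.
Proof. by move=> i j fg; apply: le_Rintegral => // x /Rpos_gt0 /fg. Qed.

Lemma rI_ge0 f : (forall x, 0 < x -> 0 <= f x) -> 0 <= rI f.
Proof. by move=> f0; apply: Rintegral_ge0 => x /Rpos_gt0 /f0. Qed.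

Lemma rI_norm_le f g : Rint f -> Rint g -> (forall x, 0 < x -> `|f x| <= g x) ->
  `|rI f| <= rI g.
Proof.
move=> i j fg; apply: le_trans (le_normr_Rintegral _ _) _ => //.
by apply: rI_le => //; exact: Rint_norm.
Qed.

Lemma EFin_rI f : Rint f -> (rI f)%:E = (\int[mu]_(x in Rp) (f x)%:E)%E.
Proof. by move=> i; rewrite /rI /Rintegral fineK//; exact: integrable_fin_num. Qed.

Lemma rI_dct (fn : nat -> R -> R) f g :
  (forall n, measurable_fun Rp (fn n)) ->
  (forall x, 0 < x -> fn ^~ x @ \oo --> f x) ->
  Rint g -> (forall n x, 0 < x -> `|fn n x| <= g x) ->
  Rint f /\ (fun n => rI (fn n)) @ \oo --> rI f.
Proof.
move=> mfn fnf ig fng.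
have mf : measurable_fun Rp f.
  apply: measurable_fun_cvg => [|x /Rpos_gt0]; [exact: mfn|exact: fnf].
have [] := @dominated_convergence _ _ _ mu _ measurable_Rpos
  (fun n x => (fn n x)%:E) (EFin \o f) (EFin \o g).
- by move=> n; apply/measurable_EFinP; exact: mfn.
- by apply/measurable_EFinP.
- by apply: aeW => x /Rpos_gt0 x0 /=; apply: cvg_EFin; [exact: nearW|exact: fnf].
- exact: ig.
- by apply: aeW => x n /Rpos_gt0 x0 /=; rewrite lee_fin fng.
move=> i _ cv; split => //.
by move: cv; rewrite -(EFin_rI i) => /fine_cvg.
Qed.

(** The compact intervals [r/n, rn] exhaust the half-line and are exchanged
    with themselves by the inversion [t |-> r^2/t]. *)
Definition exh r (n : nat) : set R := `[r / n.+1%:R, r * n.+1%:R].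

Lemma exhP r n x : exh r n x <-> (r / n.+1%:R <= x <= r * n.+1%:R).
Proof. by rewrite /exh /= in_itv /=. Qed.

Lemma exh_sub r n : 0 < r -> exh r n `<=` Rp.
Proof.
move=> r0 x /exhP/andP[rx _]; apply/RposP; apply: lt_le_trans rx.
by rewrite divr_gt0.
Qed.

Lemma exh_near r x : 0 < r -> 0 < x -> \forall n \near \oo, exh r n x.
Proof.
move=> r0 x0.
near=> n; apply/exhP; apply/andP; split.
  rewrite ler_pdivrMr// mulrC -ler_pdivrMr//.
  have : r / x <= n%:R by near: n; exact: nbhs_infty_ger.
  by move=> /le_trans; apply; rewrite ler_nat.
rewrite mulrC -ler_pdivrMr//.
have : x / r <= n%:R by near: n; exact: nbhs_infty_ger.
by move=> /le_trans; apply; rewrite ler_nat.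
Unshelve. all: by end_near. Qed.

Lemma rI_exh r f : 0 < r -> Rint f ->
  (fun n => \int[mu]_(x in exh r n) f x) @ \oo --> rI f.
Proof.
move=> r0 i.
have [||||_] := @rI_dct (fun n => f \_ (exh r n)) f (fun x => `|f x|).
- move=> n; apply/measurable_restrict => //; first exact: measurable_itv.
  by apply: measurable_funS (Rint_meas i) => // x [].
- move=> x x0; apply: (@cvg_near_cst _ R^o).
  near=> n; rewrite patchE mem_set//; near: n; exact: exh_near.
- exact: Rint_norm.
- by move=> n x x0; rewrite patchE; case: ifP => //; rewrite normr0.
rewrite [X in X @ _](_ : _ = (fun n => \int[mu]_(x in exh r n) f x))//.
apply/funext => n; rewrite /rI -Rintegral_mkcondr setIidr//.
exact: exh_sub.
Unshelve. all: by end_near. Qed.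

Lemma cont_is_derive f x d : is_derive x 1 f d -> {for x, continuous f}.
Proof.
by move=> [df _]; apply: differentiable_continuous; exact/derivable1_diffP.
Qed.

Lemma exh_FTC2 F f a b : 0 < a -> a < b ->
  (forall x, 0 < x -> is_derive x 1 F (f x)) ->
  (forall x, 0 < x -> {for x, continuous f}) ->
  (\int[mu]_(x in `[a, b]) (f x)%:E = (F b - F a)%:E)%E.
Proof.
move=> a0 ab dF cf; rewrite (@continuous_FTC2 _ f F)//.
- apply: continuous_in_subspaceT => x; rewrite inE/= in_itv/= => /andP[ax _].
  by apply: cf; exact: lt_le_trans ax.
- split.
  + move=> x; rewrite in_itv/= => /andP[ax _].
    by have [] := dF x (lt_trans a0 ax).
  + apply: cvg_at_right_filter.
    exact: (cont_is_derive (dF a a0)).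
  + apply: cvg_at_left_filter.
    exact: (cont_is_derive (dF b (lt_trans a0 ab))).
- move=> x; rewrite in_itv/= => /andP[ax _].
  by have [_ <-] := dF x (lt_trans a0 ax); rewrite derive1E.
Qed.

Lemma exh1_lt n : (0 < n)%N -> (1 : R) / n.+1%:R < 1 * n.+1%:R.
Proof.
case: n => // n _.
rewrite div1r mul1r (@lt_le_trans _ _ 1)// ?invf_lt1 ?ltr1n// ler1n//.
Qed.

(** The values [A] and [B] at the two ends are taken along the exhaustion by
    [exh], where the fundamental theorem on a compact interval applies. *)
Lemma rI_FTC F f A B :
  (forall x, 0 < x -> is_derive x 1 F (f x)) ->
  (forall x, 0 < x -> {for x, continuous f}) ->
  Rint f ->
  (fun n => F (n.+1%:R^-1)) @ \oo --> A -> (fun n => F n.+1%:R) @ \oo --> B ->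
  rI f = B - A.
Proof.
move=> dF cf i FA FB.
have /(cvg_unique _ (rI_exh ltr01 i)) -> // : 
  (fun n => \int[mu]_(x in exh 1 n) f x) @ \oo --> B - A.
rewrite -(cvg_shiftS (fun n => \int[mu]_(x in exh 1 n) f x)).
under eq_fun => n.
  rewrite /exh /Rintegral (@exh_FTC2 F) ?divr_gt0 ?exh1_lt//.
  rewrite /= div1r mul1r.
  over.
apply: cvgB.
  by move: FB; rewrite -(cvg_shiftS (fun n => F n.+1%:R)).
by move: FA; rewrite -(cvg_shiftS (fun n => F (n.+1%:R^-1))).
Qed.

(** Monotone convergence along [exh]: the integrals over its members are
    increments of [F]. *)
Lemma Rint_primitive F f M :
  (forall x, 0 < x -> is_derive x 1 F (f x)) ->
  (forall x, 0 < x -> {for x, continuous f}) ->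
  (forall x, 0 < x -> 0 <= f x) -> (forall x, 0 < x -> 0 <= F x <= M) ->
  Rint f.
Proof.
move=> dF cf f0 FM.
apply/integrableP; split.
  by apply/measurable_EFinP; exact: measurable_cont_Rpos.
have E : \bigcup_n exh 1 n = Rp.
  apply/seteqP; split => x; first by move=> [n _] /(exh_sub ltr01).
  move=> /Rpos_gt0 x0; have [n _ nx] := exh_near ltr01 x0.
  by exists n => //; apply: nx => /=.
have nd : nondecreasing_seq (exh 1).
  move=> m n mn; rewrite subsetEset => x /exhP/andP[mx xm]; apply/exhP.
  apply/andP; split.
    apply: le_trans mx; rewrite !div1r lef_pV2 ?posrE ?ltr0n// ler_nat//.
  by apply: le_trans xm _; rewrite !mul1r ler_nat.
have := @ge0_nondecreasing_set_cvg_integral _ (measurableTypeR R) R (exh 1) (fun x => `|f x|%:E)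
  mu nd (fun n => measurable_itv _).
rewrite E => cv.
apply: (@le_lt_trans _ _ M%:E); last exact: ltry.
have {}cv := cv _ _.
rewrite -(cvg_lim _ (cv _ _))//.
- apply: lime_le.
    apply/cvg_ex; eexists; apply: cv => //.
    move=> n; apply/measurable_EFinP/measurableT_comp => //.
    apply: measurable_funS (measurable_cont_Rpos cf) => //.
    exact: exh_sub.
  near=> n.
  have -> : (\int[mu]_(x in exh 1 n) `|f x|%:E = \int[mu]_(x in exh 1 n) (f x)%:E)%E.
    apply: eq_integral => x; rewrite inE => /(exh_sub ltr01) /Rpos_gt0 x0.
    by rewrite ger0_norm// f0.
  have n0 : (0 < n)%N by near: n; exact: nbhs_infty_gt.
  have nlt : (1 : R) / n.+1%:R < 1 * n.+1%:R by exact: exh1_lt.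
  rewrite /exh (@exh_FTC2 F)// ?divr_gt0// lee_fin.
  have /andP[_ ?] := FM (1 * n.+1%:R) (mulr_gt0 ltr01 (ltr0Sn _ _)).
  have /andP[? _] := FM (1 / n.+1%:R) (divr_gt0 ltr01 (ltr0Sn _ _)).
  lra.
- move=> n; apply/measurable_EFinP/measurableT_comp => //.
  apply: measurable_funS (measurable_cont_Rpos cf) => //.
  exact: exh_sub.
Unshelve. all: by end_near. Qed.

End HalfLine.
#[export] Hint Resolve measurable_Rpos : core.

Section ComplexIntegral.
Context {R : realType}.
Implicit Types (f g F : R -> R[i]) (x : R).
Local Notation mu := (@lebesgue_measure R).

Definition Cint f := Rint (fun x => Re (f x)) /\ Rint (fun x => Im (f x)).
Definition cmeas f := measurable_fun Rpos (fun x => Re (f x)) /\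
  measurable_fun Rpos (fun x => Im (f x)).
Definition ccont f := forall x, 0 < x ->
  {for x, continuous (fun x => Re (f x))} /\ {for x, continuous (fun x => Im (f x))}.

Lemma ccont_meas f : ccont f -> cmeas f.
Proof. by move=> c; split; apply: measurable_cont_Rpos => x /c[]. Qed.

Lemma Cint_meas f : Cint f -> cmeas f.
Proof. by move=> [/Rint_meas ? /Rint_meas ?]. Qed.

Lemma cder_ccont f (d : R -> R[i]) : (forall x, 0 < x -> cder f x (d x)) -> ccont f.
Proof. by move=> df x /df[d1 d2]; split; apply: cont_is_derive. Qed.

Lemma ccontD f g : ccont f -> ccont g -> ccont (fun x => f x + g x).
Proof.
move=> cf cg x x0; have [f1 f2] := cf x x0; have [g1 g2] := cg x x0; split.
  rewrite (_ : (fun x => _) = (fun x => Re (f x) + Re (g x))).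
    exact: continuousD.
  by apply/funext => y; rewrite ReD.
rewrite (_ : (fun x => _) = (fun x => Im (f x) + Im (g x))).
  exact: continuousD.
by apply/funext => y; rewrite ImD.
Qed.

Lemma ccontM f g : ccont f -> ccont g -> ccont (fun x => f x * g x).
Proof.
move=> cf cg x x0; have [f1 f2] := cf x x0; have [g1 g2] := cg x x0; split.
  rewrite (_ : (fun x => _) = (fun x => Re (f x) * Re (g x) - Im (f x) * Im (g x))).
    by apply: continuousB; exact: continuousM.
  by apply/funext => y; rewrite ReM.
rewrite (_ : (fun x => _) = (fun x => Re (f x) * Im (g x) + Im (f x) * Re (g x))).
  by apply: continuousD; exact: continuousM.
by apply/funext => y; rewrite ImM.
Qed.

Lemma ccont_cst (c : R[i]) : ccont (fun=> c).
Proof. by move=> x _; split; exact: cst_continuous. Qed.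

Lemma ccont_real (h : R -> R) : (forall x, 0 < x -> {for x, continuous h}) ->
  ccont (fun x => (h x)%:C).
Proof. by move=> ch x x0; split => /=; [exact: ch|exact: cst_continuous]. Qed.

Lemma cmeasM f g : cmeas f -> cmeas g -> cmeas (fun x => f x * g x).
Proof.
move=> [f1 f2] [g1 g2]; split.
  under eq_fun do rewrite ReM.
  by apply: measurable_funB; exact: measurable_funM.
under eq_fun do rewrite ImM.
by apply: measurable_funD; exact: measurable_funM.
Qed.

Lemma cmeasD f g : cmeas f -> cmeas g -> cmeas (fun x => f x + g x).
Proof.
move=> [f1 f2] [g1 g2]; split.
  by under eq_fun do rewrite ReD; exact: measurable_funD.
by under eq_fun do rewrite ImD; exact: measurable_funD.
Qed.

Lemma cmeas_cst (c : R[i]) : cmeas (fun=> c).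
Proof. by split; exact: measurable_cst. Qed.

Lemma cmeasB f g : cmeas f -> cmeas g -> cmeas (fun x => f x - g x).
Proof.
move=> mf mg; have := cmeasD mf (cmeasM (cmeas_cst (-1)) mg).
by under eq_fun do rewrite mulN1r.
Qed.

Lemma cmeas_normc f : cmeas f -> measurable_fun Rpos (fun x => normc (f x)).
Proof.
move=> [f1 f2].
rewrite (_ : (fun _ => _) = Num.sqrt \o
  (fun x => Re (f x) ^+ 2 + Im (f x) ^+ 2)); last first.
  by apply/funext => x /=; case: (f x).
apply: measurableT_comp.
  by apply: continuous_measurable_fun => x; exact: sqrt_continuous.
by apply: measurable_funD; exact: measurable_funX.
Qed.

Lemma Cint_le f (g : R -> R) : cmeas f -> (forall x, 0 < x -> normc (f x) <= g x) ->
  Rint g -> Cint f.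
Proof.
move=> [m1 m2] fg ig; split; apply: (Rint_le _ _ ig) => // x x0;
  apply: le_trans (fg x x0); [exact: normc_Re|exact: normc_Im].
Qed.

Lemma Cint_normc f : Cint f -> Rint (fun x => normc (f x)).
Proof.
move=> [i1 i2].
apply: (Rint_le (g := fun x => `|Re (f x)| + `|Im (f x)|)).
- by apply: cmeas_normc; apply: Cint_meas.
- by move=> x _; rewrite ger0_norm ?normc_ge0// normc_le.
- by apply: RintD; exact: Rint_norm.
Qed.

Lemma Cint_eq f g : (forall x, 0 < x -> f x = g x) -> Cint f -> Cint g.
Proof. by move=> fg [i1 i2]; split; [apply: Rint_eq i1|apply: Rint_eq i2] => x /fg ->. Qed.

Lemma CintD f g : Cint f -> Cint g -> Cint (fun x => f x + g x).
Proof.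
move=> [i1 i2] [j1 j2]; split.
  by under eq_fun do rewrite ReD; exact: RintD.
by under eq_fun do rewrite ImD; exact: RintD.
Qed.

Lemma CintZ c f : Cint f -> Cint (fun x => c * f x).
Proof.
move=> [i1 i2]; split.
  by under eq_fun do rewrite ReM; apply: RintB; exact: RintZ.
by under eq_fun do rewrite ImM; apply: RintD; exact: RintZ.
Qed.

Lemma CintB f g : Cint f -> Cint g -> Cint (fun x => f x - g x).
Proof.
move=> i /(CintZ (-1)) j; have := CintD i j.
by under eq_fun do rewrite mulN1r.
Qed.

Lemma cintE f : cint f = rI (fun x => Re (f x)) +i* rI (fun x => Im (f x)).
Proof. by []. Qed.

Lemma cint_eq f g : (forall x, 0 < x -> f x = g x) -> cint f = cint g.
Proof.
by move=> fg; rewrite !cintE; congr (_ +i* _); apply: rI_eq => x /fg ->.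
Qed.

Lemma cintD f g : Cint f -> Cint g -> cint (fun x => f x + g x) = cint f + cint g.
Proof.
move=> [i1 i2] [j1 j2]; rewrite !cintE; apply: complexP => /=.
  by rewrite -rID//; apply: rI_eq => x _; rewrite ReD.
by rewrite -rID//; apply: rI_eq => x _; rewrite ImD.
Qed.

Lemma cintZ c f : Cint f -> cint (fun x => c * f x) = c * cint f.
Proof.
move=> [i1 i2]; rewrite !cintE; apply: complexP; rewrite ?ReM ?ImM/=.
  by rewrite -!rIZ// -rIB; [apply: rI_eq => x _; rewrite ReM|exact: RintZ|exact: RintZ].
by rewrite -!rIZ// -rID; [apply: rI_eq => x _; rewrite ImM|exact: RintZ|exact: RintZ].
Qed.

Lemma cintN f : Cint f -> cint (fun x => - f x) = - cint f.
Proof. by move=> i; rewrite -mulN1r -cintZ//; apply: cint_eq => x _; rewrite mulN1r. Qed.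

Lemma cintB f g : Cint f -> Cint g -> cint (fun x => f x - g x) = cint f - cint g.
Proof.
move=> i j; rewrite cintD ?cintN//.
by have := CintZ (-1) j; apply: Cint_eq => x _; rewrite mulN1r.
Qed.

Lemma cint0 : cint (fun=> 0) = 0 :> R[i].
Proof.
have i : Cint (fun=> 0 : R[i]) by split; exact: Rint0.
by have := cintZ 0 i; rewrite !mul0r.
Qed.

Lemma normc_cint f (g : R -> R) : Cint f -> Rint g ->
  (forall x, 0 < x -> normc (f x) <= g x) -> normc (cint f) <= 2 * rI g.
Proof.
move=> [i1 i2] ig fg; rewrite cintE.
apply: le_trans (normc_le _) _ => /=; rewrite mulr_natl mulr2n.
by apply: lerD; apply: rI_norm_le => // x x0; apply: le_trans (fg x x0);
  [exact: normc_Re|exact: normc_Im].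
Qed.

Definition ccvg (u : nat -> R[i]) (l : R[i]) :=
  (fun n => Re (u n)) @ \oo --> Re l /\ (fun n => Im (u n)) @ \oo --> Im l.

Lemma ccvg_uniq u l l' : ccvg u l -> ccvg u l' -> l = l'.
Proof.
by move=> [u1 u2] [v1 v2]; apply: complexP; [exact: cvg_unique u1 v1|exact: cvg_unique u2 v2].
Qed.

Lemma ccvg_norm0 (u : nat -> R[i]) (v : nat -> R) l :
  (\forall n \near \oo, normc (u n - l) <= v n) -> v @ \oo --> 0 -> ccvg u l.
Proof.
move=> uv v0.
have H (p : R[i] -> R) : (forall n, `|p (u n) - p l| <= normc (u n - l)) ->
    (fun n => p (u n)) @ \oo --> p l.
  move=> hp; apply/subr_cvg0; apply: norm_cvg0.
  apply: (squeeze_cvgr _ (cvg_cst 0) v0).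
  by near=> n; rewrite normr_ge0/= (le_trans (hp n))//; near: n.
by split; [apply: (H (@Re R)) => n|apply: (H (@Im R)) => n];
  apply: le_trans (_ : _ <= _); rewrite -?ReN -?ReD -?ImN -?ImD;
  [exact: normc_Re|exact: lexx|exact: normc_Im|exact: lexx].
Unshelve. all: by end_near. Qed.

Lemma ccvg_cst (l : R[i]) : ccvg (fun=> l) l.
Proof. by split; exact: cvg_cst. Qed.

Lemma cint_FTC F f A B : (forall x, 0 < x -> cder F x (f x)) -> ccont f -> Cint f ->
  ccvg (fun n => F (n.+1%:R^-1)) A -> ccvg (fun n => F n.+1%:R) B ->
  cint f = B - A.
Proof.
move=> dF cf [i1 i2] [A1 A2] [B1 B2]; rewrite cintE; apply: complexP => /=.
  rewrite ReD ReN; apply: (rI_FTC (F := fun x => Re (F x))) => //.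
  - by move=> x /dF[].
  - by move=> x /cf[].
rewrite ImD ImN; apply: (rI_FTC (F := fun x => Im (F x))) => //.
- by move=> x /dF[].
- by move=> x /cf[].
Qed.

Lemma cint_dct (fn : nat -> R -> R[i]) f (g : R -> R) :
  (forall n, cmeas (fn n)) ->
  (forall x, 0 < x -> ccvg (fn ^~ x) (f x)) ->
  Rint g -> (forall n x, 0 < x -> normc (fn n x) <= g x) ->
  Cint f /\ ccvg (fun n => cint (fn n)) (cint f).
Proof.
move=> mfn cv ig dom.
have [i1 c1] : Rint (fun x => Re (f x)) /\
    (fun n => rI (fun x => Re (fn n x))) @ \oo --> rI (fun x => Re (f x)).
  apply: (rI_dct _ _ ig); first by move=> n; exact: (mfn n).1.
    by move=> x /cv[].
  by move=> n x x0; apply: le_trans (dom n x x0); exact: normc_Re.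
have [i2 c2] : Rint (fun x => Im (f x)) /\
    (fun n => rI (fun x => Im (fn n x))) @ \oo --> rI (fun x => Im (f x)).
  apply: (rI_dct _ _ ig); first by move=> n; exact: (mfn n).2.
    by move=> x /cv[].
  by move=> n x x0; apply: le_trans (dom n x x0); exact: normc_Im.
by split.
Qed.

Lemma cint_diff_under (f df : R -> R -> R[i]) (g : R -> R) a u v :
  u < a < v ->
  (forall x, u < x < v -> Cint (f x)) ->
  (forall x t, u < x < v -> 0 < t -> cder (f ^~ t) x (df x t)) ->
  Rint g -> (forall x t, u < x < v -> 0 < t -> normc (df x t) <= g t) ->
  cder (fun x => cint (f x)) a (cint (df a)).
Proof.
move=> auv intf hdf ig dom.
have g0 t : 0 < t -> 0 <= g t.
  by move=> t0; apply: le_trans (dom a t auv t0); exact: normc_ge0.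
have H (p : R[i] -> R) : (forall x, u < x < v -> Rint (fun t => p (f x t))) ->
   (forall x t, u < x < v -> 0 < t -> is_derive x 1 (fun x => p (f x t)) (p (df x t))) ->
   (forall z, `|p z| <= normc z) ->
   is_derive a 1 (fun x => rI (fun t => p (f x t))) (rI (fun t => p (df a t))).
  move=> ip dp pn.
  pose h := fun x t => p (f x t).
  have Ia : `]u, v[%classic a by rewrite /= in_itv.
  have h1 : forall x, `]u, v[%classic x -> mu.-integrable (@Rpos R) (EFin \o h x).
    by move=> x; rewrite /= in_itv/=; exact: ip.
  have h2 : forall x y, `]u, v[%classic x -> (@Rpos R) y -> derivable (h ^~ y) x 1.
    by move=> x y; rewrite /= in_itv/= => xuv /Rpos_gt0 y0; have [] := dp x y xuv y0.
  have h3 : forall y, 0 <= (fun t => `|g t|) y by move=> y; exact: normr_ge0.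
  have h4 : forall x y, `]u, v[%classic x -> (@Rpos R) y ->
      `|partial1of2 h x y| <= `|g y|.
    move=> x y; rewrite /= in_itv/= => xuv /Rpos_gt0 y0; rewrite partial1of2E.
    have [_ ->] := dp x y xuv y0.
    by rewrite (le_trans (pn _))// ger0_norm ?g0// dom.
  have D := @derivable_under_integral R _ _ mu h Rpos measurable_Rpos _ _ _ Ia h1 h2 _ h3 (Rint_norm ig) h4.
  have E := @differentiation_under_integral R _ _ mu h Rpos measurable_Rpos _ _ _ Ia h1 h2 _ h3 (Rint_norm ig) h4.
  apply: DeriveDef; first exact: D.
  rewrite -derive1E E; apply: rI_eq => t t0; rewrite partial1of2E.
  by have [_ ->] := dp a t auv t0.
split; apply: H => //.
- by move=> x /intf[].
- by move=> x t xuv t0; have [] := hdf x t xuv t0.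
- exact: normc_Re.
- by move=> x /intf[].
- by move=> x t xuv t0; have [] := hdf x t xuv t0.
- exact: normc_Im.
Qed.

End ComplexIntegral.

Section RealPowers.
Context {R : realType}.
Implicit Types (a b e x t K : R).

Definition pw a t : R := expR (a * ln t).

Lemma pw_gt0 a t : 0 < pw a t. Proof. exact: expR_gt0. Qed.
Lemma pw_ge0 a t : 0 <= pw a t. Proof. exact: expR_ge0. Qed.
Lemma pwD a b t : pw (a + b) t = pw a t * pw b t.
Proof. by rewrite /pw mulrDl expRD. Qed.
Lemma pwN a t : pw (- a) t = (pw a t)^-1.
Proof. by rewrite /pw mulNr expRN. Qed.
Lemma pw0 t : pw 0 t = 1.
Proof. by rewrite /pw mul0r expR0. Qed.
Lemma pw1 t : 0 < t -> pw 1 t = t.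
Proof. by move=> t0; rewrite /pw mul1r lnK. Qed.
Lemma pw2 t : 0 < t -> pw 2 t = t ^+ 2.
Proof. by move=> t0; rewrite (_ : 2 = 1 + 1)// pwD pw1. Qed.
Lemma pwN1 t : 0 < t -> pw (-1) t = t^-1.
Proof. by move=> t0; rewrite pwN pw1. Qed.
Lemma pwM a s t : 0 < s -> 0 < t -> pw a (s * t) = pw a s * pw a t.
Proof. by move=> s0 t0; rewrite /pw lnM// mulrDr expRD. Qed.
Lemma pwV a t : 0 < t -> pw a t^-1 = pw (- a) t.
Proof. by move=> t0; rewrite /pw lnV// mulrN mulNr. Qed.
Lemma pw_pw a b t : pw a (pw b t) = pw (a * b) t.
Proof. by rewrite /pw expRK mulrA. Qed.
Lemma pw_1 a : pw a 1 = 1.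
Proof. by rewrite /pw ln1 mulr0 expR0. Qed.
Lemma ler_pw a s t : 0 <= a -> 0 < s -> s <= t -> pw a s <= pw a t.
Proof.
move=> a0 s0 st; have t0 := lt_le_trans s0 st.
by rewrite ler_expR ler_wpM2l// ler_ln.
Qed.
Lemma pw_ge1 a t : 0 <= a -> 1 <= t -> 1 <= pw a t.
Proof. by move=> a0 t1; rewrite -[leLHS](pw_1 a) ler_pw. Qed.
Lemma ler_pw_exp a b t : a <= b -> 1 <= t -> pw a t <= pw b t.
Proof. by move=> ab t1; rewrite ler_expR ler_wpM2r// ln_ge0. Qed.
Lemma ler_pw_exp1 a b t : a <= b -> 0 < t -> t <= 1 -> pw b t <= pw a t.
Proof. by move=> ab t0 t1; rewrite ler_expR ler_wnM2r// ln_le0. Qed.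

Lemma is_derive_pw a t : 0 < t -> is_derive t 1 (pw a) (a * pw (a - 1) t).
Proof.
move=> t0; have dl := is_derive1_ln t0.
rewrite (_ : pw a = expR \o (fun t => a * ln t))//.
have d : is_derive t 1 (fun t => a * ln t) (a * t^-1).
  rewrite (_ : (fun _ => _) = a \*: @ln R)//.
  by apply: is_derive_eq; rewrite /GRing.scale.
by apply: is_derive_eq; rewrite /GRing.scale/= -/(pw a t) pwD pwN1//; ring.
Qed.

Lemma pw_cont a t : 0 < t -> {for t, continuous (pw a)}.
Proof. by move=> t0; apply: cont_is_derive; exact: is_derive_pw. Qed.

Lemma normc_cpowR_pw t (z : R[i]) : normc (cpowR t z) = pw (Re z) t.
Proof. exact: normc_cpowR. Qed.

(** [t^(e-1) / (1 + t^e)^2] has the bounded primitive [- 1 / (e (1 + t^e))] and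
    is comparable with the smaller of [t^(e-1)] and [t^(-e-1)]. *)
Lemma Rint_pw_min e : 0 < e ->
  Rint (fun t => pw (e - 1) t / (1 + pw e t) ^+ 2).
Proof.
move=> e0.
have p0 t : 0 < 1 + pw e t by rewrite addr_gt0// pw_gt0.
refine (@Rint_primitive R (fun t => e^-1 - e^-1 * (1 + pw e t)^-1)
  (fun t => pw (e - 1) t / (1 + pw e t) ^+ 2) e^-1 _ _ _ _).
- move=> t t0.
  have d := is_derive_pw e t0.
  have d1 : is_derive t 1 (fun t => 1 + pw e t) (e * pw (e - 1) t).
    rewrite (_ : (fun _ => _) = cst 1 + pw e)//.
    by apply: is_derive_eq; rewrite add0r.
  have nz : 1 + pw e t != 0 by rewrite gt_eqF.
  have d2 := @is_deriveV _ (fun t => 1 + pw e t) _ _ _ nz d1.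
  rewrite (_ : (fun _ => _) = cst e^-1 - e^-1 \*: (fun t => (1 + pw e t)^-1))//.
  apply: is_derive_eq.
  rewrite /GRing.scale/=; field.
  by rewrite gt_eqF//= gt_eqF.
- move=> t t0; apply: continuousM; first exact: pw_cont.
  apply: (@continuousV _ _ (fun t => (1 + pw e t) ^+ 2)).
    by rewrite expf_neq0// gt_eqF.
  rewrite (_ : (fun _ => _) = (fun t => (1 + pw e t) * (1 + pw e t)))//.
  by apply: continuousM; apply: continuousD; by [exact: cst_continuous|exact: pw_cont].
- by move=> t t0; rewrite divr_ge0 ?pw_ge0// sqr_ge0.
- move=> t t0.
  have h1 : (1 + pw e t)^-1 <= 1 by rewrite invf_le1// lerDl pw_ge0.
  have h2 : 0 <= (1 + pw e t)^-1 by rewrite invr_ge0 ltW.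
  have h3 : 0 < e^-1 by rewrite invr_gt0.
  by apply/andP; split; nra.
Qed.

(** Integrability is always obtained from two power bounds, one better than
    [t^-1] at [0] and one better than [t^-1] at infinity. *)
Lemma Rint_pw (f : R -> R) e K : 0 < e -> measurable_fun Rpos f ->
  (forall t, 0 < t -> `|f t| <= K * pw (e - 1) t) ->
  (forall t, 0 < t -> `|f t| <= K * pw (- e - 1) t) -> Rint f.
Proof.
move=> e0 mf f1 f2.
have K0 : 0 <= K.
  have := f1 1 ltr01; rewrite pw_1 mulr1; apply: le_trans; exact: normr_ge0.
apply: (Rint_le mf _ (RintZ (4 * K) (Rint_pw_min e0))) => t t0.
have p0 : 0 < pw e t by exact: pw_gt0.
have [h|h] := lerP (pw e t) 1.
  apply: le_trans (f1 t t0) _.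
  rewrite mulrA ler_pdivlMr ?exprn_gt0 ?addr_gt0//.
  rewrite -(mulrA 4); have := mulr_ge0 K0 (pw_ge0 (e - 1) t).
  set X := K * _ => X0; rewrite (mulrC 4) ler_wpM2l//; nra.
apply: le_trans (f2 t t0) _.
rewrite mulrA ler_pdivlMr ?exprn_gt0 ?addr_gt0//.
have -> : pw (e - 1) t = pw e t ^+ 2 * pw (- e - 1) t.
  have {1}-> : e - 1 = e + (e + (- e - 1)) by ring.
  by rewrite !pwD expr2 mulrA.
have q0 := pw_ge0 (- e - 1) t.
rewrite (_ : 4 * K * _ = K * pw (- e - 1) t * (4 * pw e t ^+ 2)); last by ring.
rewrite ler_wpM2l ?mulr_ge0//; nra.
Qed.

(** The maximum over [t > 0] of [t^a exp (- s t)], reached at [t = a / s]. *)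
Definition cexpw a s : R := expR (a * ln (a / s) - a).

Lemma cexpw_gt0 a s : 0 < cexpw a s. Proof. exact: expR_gt0. Qed.

Lemma exp_le_pw a s t : 0 < a -> 0 < s -> 0 < t ->
  expR (- (s * t)) <= cexpw a s * pw (- a) t.
Proof.
move=> a0 s0 t0; rewrite /cexpw /pw -expRD ler_expR.
have h : ln (s * t / a) <= s * t / a - 1.
  have -> : s * t / a = 1 + (s * t / a - 1) by ring.
  rewrite {2}addrC addrK; apply: le_ln1Dx; rewrite ltrBrDl subrr.
  by rewrite divr_gt0// mulr_gt0.
have {h} : a * ln (s * t / a) <= s * t - a.
  have -> : s * t - a = a * (s * t / a - 1) by field; rewrite gt_eqF.
  by rewrite ler_wpM2l// ltW.
have -> : ln (s * t / a) = ln t - ln (a / s).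
  by rewrite -ln_div ?posrE ?divr_gt0//; congr ln; field; rewrite !gt_eqF.
nra.
Qed.

Lemma abs_ln_le e t : 0 < e -> 0 < t -> `|ln t| <= e^-1 * (pw e t + pw (- e) t).
Proof.
move=> e0 t0; rewrite ler_pdivlMl//.
have h (y : R) : y <= expR y by apply: le_trans (expR_ge1Dx y); rewrite lerDr.
have -> : e * `|ln t| = `|e * ln t| by rewrite normrM (gtr0_norm e0).
rewrite /pw mulNr ler_norml; apply/andP; split.
  have := h (- (e * ln t)); have := expR_ge0 (e * ln t); lra.
have := h (e * ln t); have := expR_ge0 (- (e * ln t)); lra.
Qed.

End RealPowers.

(** * Mean value estimates *)

Section MeanValue.
Context {R : realType}.
Implicit Types (f q : R -> R) (a b x y : R).

Lemma derive_ge0_le f (df : R -> R) a b : a <= b ->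
  (forall x, a <= x <= b -> is_derive x 1 f (df x)) ->
  (forall x, a <= x <= b -> 0 <= df x) -> f a <= f b.
Proof.
rewrite le_eqVlt => /predU1P[->//|ab] d p.
have [||c cab E] := @MVT R f df a b ab.
- by move=> x; rewrite in_itv/= => /andP[ax xb]; apply: d; rewrite !ltW.
- apply: derivable_within_continuous => x; rewrite in_itv/= => xab.
  by have [] := d x xab.
- move: cab; rewrite in_itv/= => /andP[ac cb].
  have c0 : 0 <= df c by apply: p; rewrite !ltW.
  by rewrite -subr_ge0 E mulr_ge0// subr_ge0 ltW.
Qed.

(** The mean value inequality in the form that [q - f] and [q + f] are monotone;
    a variable bound [dq] replaces an integral of [`|df|]. *)
Lemma increment_le f q (df dq : R -> R) a b : a <= b ->
  (forall x, a <= x <= b -> is_derive x 1 f (df x)) ->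
  (forall x, a <= x <= b -> is_derive x 1 q (dq x)) ->
  (forall x, a <= x <= b -> `|df x| <= dq x) -> `|f b - f a| <= q b - q a.
Proof.
move=> ab hf hq h; rewrite ler_norml; apply/andP; split.
  have := @derive_ge0_le (q + f) (fun x => dq x + df x) a b ab.
  have -> : (q + f) a = q a + f a by [].
  have -> : (q + f) b = q b + f b by [].
  move=> H; have {H} : q a + f a <= q b + f b.
    apply: H => x xab.
      have := hf x xab; have := hq x xab => ? ?; exact: is_deriveD.
    by have := h x xab; rewrite ler_norml => /andP[]; lra.
  lra.
have := @derive_ge0_le (q - f) (fun x => dq x - df x) a b ab.
have -> : (q - f) a = q a - f a by [].
have -> : (q - f) b = q b - f b by [].
move=> H; have {H} : q a - f a <= q b - f b.
  apply: H => x xab.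
    have := hf x xab; have := hq x xab => ? ?; exact: is_deriveB.
  by have := h x xab; rewrite ler_norml => /andP[]; lra.
lra.
Qed.

Lemma increment_le_cst f (df : R -> R) M a b : a <= b ->
  (forall x, a <= x <= b -> is_derive x 1 f (df x)) ->
  (forall x, a <= x <= b -> `|df x| <= M) -> `|f b - f a| <= M * (b - a).
Proof.
move=> ab hf h; rewrite mulrBr.
apply: (@increment_le f (fun x => M * x) df (fun=> M)) => // x _.
rewrite (_ : (fun x => M * x) = M \*: (@id R))//.
by apply: is_derive_eq; rewrite /GRing.scale/= mulr1.
Qed.

Lemma abs_sin_le y : `|sin y| <= `|y|.
Proof.
wlog y0 : y / 0 <= y => [H|].
  have [/H//|y0] := lerP 0 y.
  by rewrite -normrN -(normrN y) -sinN; apply: H; rewrite oppr_ge0 ltW.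
have := @increment_le_cst sin cos 1 0 y y0 _ _.
rewrite sin0 !subr0 mul1r (ger0_norm y0).
by apply => x _; first [exact: cos_max|exact: is_derive_sin].
Qed.

Lemma abs_cos1_le y : `|cos y - 1| <= `|y|.
Proof.
wlog y0 : y / 0 <= y => [H|].
  have [/H//|y0] := lerP 0 y.
  by rewrite -(normrN y) -cosN; apply: H; rewrite oppr_ge0 ltW.
have := @increment_le_cst cos (fun x => - sin x) 1 0 y y0 _ _.
rewrite cos0 !subr0 mul1r (ger0_norm y0).
by apply => x _; first [exact: is_derive_cos|rewrite normrN; exact: sin_max].
Qed.

Lemma normc_cexpN1 (w : R[i]) : 0 <= Re w ->
  normc (cexp (- w) - 1) <= 3 * normc w.
Proof.
move=> w0.
have e1 : expR (- Re w) <= 1 by rewrite -expR0 ler_expR oppr_le0.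
have e0 := expR_ge0 (- Re w).
have e2 : 1 - Re w <= expR (- Re w) by exact: expR_ge1Dx.
apply: le_trans (normc_le _) _.
rewrite /cexp !(ReD, ImD, ReM, ImM, ReN, ImN)/= cosN sinN !mul0r !subr0 addr0 mulrN.
have := normc_Re w; rewrite (ger0_norm w0) => n1; have n2 := normc_Im w.
have c1 := abs_cos1_le (Im w); have s1 := abs_sin_le (Im w).
have h1 : `|expR (- Re w) * cos (Im w) - 1| <= Re w + `|Im w|.
  have -> : expR (- Re w) * cos (Im w) - 1 =
    (expR (- Re w) - 1) * cos (Im w) + (cos (Im w) - 1) by ring.
  apply: le_trans (ler_normD _ _) _; apply: lerD => //.
  rewrite normrM -[leRHS]mulr1; apply: ler_pM => //; last exact: cos_max.
  by rewrite ler_norml; apply/andP; split; lra.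
have h2 : `|- (expR (- Re w) * sin (Im w))| <= `|Im w|.
  rewrite normrN normrM -[leRHS]mul1r; apply: ler_pM => //.
  by rewrite ger0_norm.
move: h1 h2 n1 n2; lra.
Qed.

Lemma normc_cexpN1_pw (th : R) (w : R[i]) : 0 <= th <= 1 -> 0 <= Re w -> w != 0 ->
  normc (cexp (- w) - 1) <= 3 * pw th (normc w).
Proof.
move=> /andP[t0 t1] w0 wn.
have p : 0 < normc w by rewrite normc_gt0.
have [w1|w1] := lerP (normc w) 1.
  apply: le_trans (normc_cexpN1 w0) _; rewrite ler_wpM2l//.
  by rewrite -[leLHS]pw1// ler_pw_exp1.
apply: le_trans (normcB _ _) _; rewrite normc_cexp -[1 in leLHS]/(1%:C) normcR normr1.
have h : expR (Re (- w)) <= 1 by rewrite -expR0 ler_expR ReN oppr_le0.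
have := pw_ge1 t0 (ltW w1); lra.
Qed.

End MeanValue.

(** * The integral [int_0^oo exp (- p (t + r^2 / t)) t^(m - 1) dt] *)

Section Kernel.
Context {R : realType}.
Implicit Types (p m : R[i]) (r t a b s e K : R).

(** The Gamma density with shape [b] and rate [s], which dominates all kernels
    below. *)
Definition gam b s t : R := expR (- (s * t)) * pw (b - 1) t.

Lemma gam_ge0 b s t : 0 <= gam b s t.
Proof. by rewrite mulr_ge0 ?expR_ge0 ?pw_ge0. Qed.

Lemma gam_le_pw e s t : 0 < s -> 0 < t -> gam (e + 1) s t <= pw e t.
Proof.
move=> s0 t0; rewrite /gam addrK ler_piMl ?pw_ge0// -expR0 ler_expR.
by rewrite oppr_le0 mulr_ge0 ?ltW.
Qed.

Lemma gam_le_pwN e s t : 0 < e -> 0 < s -> 0 < t ->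
  gam (e + 1) s t <= cexpw (2 * e) s * pw (- e) t.
Proof.
move=> e0 s0 t0; rewrite /gam addrK.
have -> : - e = - (2 * e) + e by ring.
by rewrite pwD mulrA ler_wpM2r ?pw_ge0// exp_le_pw// mulr_gt0.
Qed.

Lemma gam_cont b s t : 0 < t -> {for t, continuous (gam b s)}.
Proof.
move=> t0; apply: continuousM; last exact: pw_cont.
apply: (@continuous_comp _ _ _ (fun t => - (s * t)) expR).
  apply: (@continuousN _ R^o); apply: continuousM; [exact: cst_continuous|exact: id].
exact: continuous_expR.
Qed.

Lemma Rint_gam b s : 0 < b -> 0 < s -> Rint (gam b s).
Proof.
move=> b0 s0.
apply: (@Rint_pw R _ b (1 + cexpw (2 * b) s)) => //.
- by apply: measurable_cont_Rpos => t; exact: gam_cont.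
- move=> t t0; rewrite ger0_norm ?gam_ge0// /gam ler_wpM2r ?pw_ge0//.
  rewrite (@le_trans _ _ 1)//; last by rewrite lerDl ltW// cexpw_gt0.
  by rewrite -expR0 ler_expR oppr_le0 mulr_ge0// ltW.
- move=> t t0; rewrite ger0_norm ?gam_ge0// /gam.
  have -> : - b - 1 = - (2 * b) + (b - 1) by ring.
  rewrite (pwD (- (2 * b))) mulrA ler_wpM2r ?pw_ge0//.
  apply: le_trans (exp_le_pw (a := 2 * b) _ s0 t0) _; first by rewrite mulr_gt0.
  by rewrite ler_wpM2r ?pw_ge0// lerDr.
Qed.

(** [G p r m] is [2 r^m K_m(2 p r)] with the modified Bessel function [K_m]; at
    [r = 0] it is the Gamma integral [p^(- m) Gamma(m)]. *)
Definition kern p r m t : R[i] :=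
  cexp (- (p * (t + r ^+ 2 / t)%:C) + (m - 1) * (ln t)%:C).

Definition G p r m : R[i] := cint (kern p r m).

(** Recurrences in [m] come from the fact that powers of [t] shift [m]. *)
Lemma kernD p r m m' t : kern p r (m + m') t = cpowR t m' * kern p r m t.
Proof. by rewrite /kern /cpowR -cexpD; congr cexp; ring. Qed.

Lemma kernS p r m t : 0 < t -> kern p r (m + 1) t = t%:C * kern p r m t.
Proof. by move=> t0; rewrite kernD cpowR1. Qed.

Lemma kernN p r m t : 0 < t -> kern p r (m - 1) t = (t^-1)%:C * kern p r m t.
Proof. by move=> t0; rewrite kernD cpowRN1. Qed.

Lemma normc_kern p r m t :
  normc (kern p r m t) = expR (- (Re p * (t + r ^+ 2 / t))) * pw (Re m - 1) t.
Proof.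
rewrite /kern normc_cexp ReD ReN !ReM /= !mulr0 !subr0 expRD.
by rewrite ReD ReN.
Qed.

Lemma cder_kern p r m t : 0 < t ->
  cder (kern p r m) t
    ((- (p * (1 - r ^+ 2 / t ^+ 2)%:C) + (m - 1) * (t^-1)%:C) * kern p r m t).
Proof.
move=> t0; apply: cder_cexp; apply: cderD; last by apply: cderZ; exact: cder_ln.
apply: cderN; apply: cderZ; apply: cder_real.
have tn : t != 0 by rewrite gt_eqF.
have dV := @is_deriveV _ id t 1 1 tn (is_derive_id t 1).
rewrite (_ : (fun _ => _) = id + (r ^+ 2 \*: (fun y : R => y^-1)))//.
by apply: is_derive_eq; rewrite /GRing.scale/=; field.
Qed.

Lemma ccont_kern p r m : ccont (kern p r m).
Proof. by apply: cder_ccont => t; exact: cder_kern. Qed.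

Lemma cmeas_kern p r m : cmeas (kern p r m).
Proof. exact: ccont_meas (ccont_kern p r m). Qed.

Lemma kern_le p r m t : 0 <= Re p -> 0 < t ->
  normc (kern p r m t) <= gam (Re m) (Re p) t.
Proof.
move=> p0 t0; rewrite normc_kern /gam ler_wpM2r ?pw_ge0// ler_expR lerN2.
by rewrite ler_wpM2l// lerDl divr_ge0 ?sqr_ge0// ltW.
Qed.

(** The factor [exp (- p r^2 / t)] can be traded for any power [(t / r^2)^a];
    half of the exponential decay in [t + r^2 / t >= 2 r] is kept. *)
Lemma kern_le_pw p r m t a : 0 < Re p -> 0 < a -> 0 < r -> 0 < t ->
  normc (kern p r m t) <= cexpw a (Re p / 2) * pw (- (2 * a)) r *
    expR (- (Re p * r)) * gam (Re m + a) (Re p / 2) t.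
Proof.
move=> p0 a0 r0 t0; rewrite normc_kern /gam.
have r2 : 0 < r ^+ 2 by rewrite exprn_gt0.
have h : expR (- (Re p * (t + r ^+ 2 / t))) <=
    expR (- (Re p * r)) * expR (- (Re p / 2 * t)) * expR (- (Re p / 2 * (r ^+ 2 / t))).
  rewrite -!expRD ler_expR -!opprD lerN2.
  have : 2 * r <= t + r ^+ 2 / t.
    rewrite -subr_ge0.
    have -> : t + r ^+ 2 / t - 2 * r = (t - r) ^+ 2 / t by field; rewrite gt_eqF.
    by rewrite divr_ge0 ?sqr_ge0// ltW.
  nra.
apply: le_trans (ler_wpM2r (pw_ge0 _ _) h) _.
have k := @exp_le_pw R a (Re p / 2) (r ^+ 2 / t) a0 _ _.
have {}k : expR (- (Re p / 2 * (r ^+ 2 / t))) <=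
    cexpw a (Re p / 2) * pw (- (2 * a)) r * pw a t.
  apply: le_trans (k _ _) _; rewrite ?divr_gt0//.
  rewrite pwM ?invr_gt0// pwV// opprK -(pw2 r0) pw_pw.
  by rewrite (_ : - a * 2 = - (2 * a)) ?mulrA//; ring.
apply: le_trans (ler_wpM2r (pw_ge0 _ _) (ler_wpM2l _ k)) _.
  by rewrite mulr_ge0 ?expR_ge0.
rewrite (_ : Re m + a - 1 = a + (Re m - 1)); last by ring.
rewrite (pwD a) le_eqVlt; apply/orP; left; apply/eqP; ring.
Qed.

Lemma Cint_kern p r m : 0 < Re p -> 0 < r -> Cint (kern p r m).
Proof.
move=> p0 r0; pose a := 1 + `|Re m|.
have a0 : 0 < a by rewrite ltr_pwDl.
have b0 : 0 < Re m + a.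
  by rewrite /a; have := ler_norm (- Re m); rewrite normrN; lra.
apply: (Cint_le (g := fun t => cexpw a (Re p / 2) * pw (- (2 * a)) r *
    expR (- (Re p * r)) * gam (Re m + a) (Re p / 2) t) (cmeas_kern p r m)).
  by move=> t t0; exact: kern_le_pw.
by apply: RintZ; apply: Rint_gam => //; rewrite divr_gt0.
Qed.

Lemma Cint_kern0 p r m : 0 < Re p -> 0 < Re m -> Cint (kern p r m).
Proof.
move=> p0 m0.
apply: (Cint_le (g := gam (Re m) (Re p)) (cmeas_kern p r m)); last exact: Rint_gam.
by move=> t t0; exact: kern_le (ltW p0) t0.
Qed.

Lemma pw_cvg0 e K : 0 < e -> (fun n : nat => K * pw (- e) n.+1%:R) @ \oo --> (0 : R).
Proof.
move=> e0.
suff h : (fun n : nat => pw (- e) n.+1%:R) @ \oo --> (0 : R).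
  by rewrite -(mulr0 K); apply: cvgM; [exact: cvg_cst|exact: h].
apply/cvgrPdist_le => d d0; near=> n.
rewrite sub0r normrN ger0_norm ?pw_ge0// pwN -[leRHS]invrK lef_pV2 ?posrE ?invr_gt0 ?pw_gt0//.
rewrite -[leLHS](@lnK R) ?posrE ?invr_gt0// /pw ler_expR.
rewrite -ler_pdivrMl// -[leLHS]expRK ler_ln ?posrE ?expR_gt0//.
have : expR (e^-1 * ln d^-1) <= n%:R by near: n; exact: nbhs_infty_ger.
by move=> /le_trans; apply; rewrite ler_nat.
Unshelve. all: by end_near. Qed.

(** Integration by parts: the boundary terms vanish when [F] is dominated both
    by a positive and by a negative power. *)
Lemma cint_boundary0 (F f : R -> R[i]) e K : 0 < e ->
  (forall t, 0 < t -> cder F t (f t)) -> ccont f -> Cint f ->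
  (forall t, 0 < t -> normc (F t) <= K * pw e t) ->
  (forall t, 0 < t -> normc (F t) <= K * pw (- e) t) ->
  cint f = 0.
Proof.
move=> e0 dF cf i F0 Foo.
rewrite (@cint_FTC R F f 0 0)// ?subr0//.
  apply: (ccvg_norm0 (v := fun n : nat => K * pw (- e) n.+1%:R)); last exact: pw_cvg0.
  near=> n; rewrite subr0 -pwV ?ltr0n//; apply: F0; by rewrite invr_gt0.
apply: (ccvg_norm0 (v := fun n : nat => K * pw (- e) n.+1%:R)); last exact: pw_cvg0.
by near=> n; rewrite subr0; apply: Foo.
Unshelve. all: by end_near. Qed.

Lemma G_boundary p r m e C : 0 < Re p -> 0 < e ->
  (forall t, 0 < t -> normc (kern p r (m + 1) t) <= C * gam (e + 1) (Re p / 2) t) ->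
  0 <= C -> Cint (kern p r (m + 1)) -> Cint (kern p r m) -> Cint (fun t => (r ^+ 2)%:C * kern p r (m - 1) t) ->
  m * G p r m = p * G p r (m + 1) - p * cint (fun t => (r ^+ 2)%:C * kern p r (m - 1) t).
Proof.
move=> p0 e0 dom C0 i1 i0 iN.
have p2 : 0 < Re p / 2 by rewrite divr_gt0.
pose f t := m * kern p r m t - p * kern p r (m + 1) t +
  p * ((r ^+ 2)%:C * kern p r (m - 1) t).
have : cint f = 0.
  apply: (@cint_boundary0 (kern p r (m + 1)) f e (C * (1 + cexpw (2 * e) (Re p / 2)))) => //.
  - move=> t t0; apply: cder_eq (cder_kern _ _ _ t0) _.
    rewrite /f kernN// kernS//.
    have tn : t%:C != 0 :> R[i] by rewrite eq_complex/= gt_eqF.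
    rewrite !(rmorphB, rmorphM, fmorphV, rmorphXn, rmorph1)/=.
    by field.
  - apply: ccontD; last first.
      apply: ccontM; first exact: ccont_cst.
      by apply: ccontM; [exact: ccont_cst|exact: ccont_kern].
    apply: ccontD; first by apply: ccontM; [exact: ccont_cst|exact: ccont_kern].
    have := ccontM (ccont_cst (- p)) (ccont_kern p r (m + 1)).
    by rewrite (_ : (fun _ => _) = (fun x => - (p * kern p r (m + 1) x)))//;
      apply/funext => x; rewrite mulNr.
  - by apply: CintD; [apply: CintB; exact: CintZ|exact: CintZ].
  - move=> t t0; apply: le_trans (dom t t0) _; rewrite -mulrA ler_wpM2l//.
    apply: le_trans (gam_le_pw e p2 t0) _; rewrite ler_peMl ?pw_ge0// lerDl.
    by rewrite ltW// cexpw_gt0.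
  - move=> t t0; apply: le_trans (dom t t0) _; rewrite -mulrA ler_wpM2l//.
    apply: le_trans (gam_le_pwN e0 p2 t0) _; rewrite ler_wpM2r ?pw_ge0// lerDr.
    exact: ler01.
rewrite /f cintD; [|by apply: CintB; exact: CintZ|exact: CintZ].
rewrite cintB; [|exact: CintZ|exact: CintZ].
rewrite !(cintZ _ i1, cintZ _ i0, cintZ _ iN) -!/(G _ _ _) => /eqP; rewrite addr_eq0 => /eqP h.
by rewrite -h; ring.
Qed.

(** Integration by parts against [d (t^m)]. *)
Lemma G_rec p r m : 0 < Re p -> 0 < r ->
  m * G p r m = p * G p r (m + 1) - p * (r ^+ 2)%:C * G p r (m - 1).
Proof.
move=> p0 r0.
have iN := Cint_kern (m - 1) p0 r0.
rewrite -[X in _ - X](mulrA p) -(cintZ _ iN).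
pose a := 1 + `|Re m|.
have a0 : 0 < a by rewrite ltr_pwDl.
have b0 : 0 < Re m + a.
  by rewrite /a; have := ler_norm (- Re m); rewrite normrN; lra.
apply: (@G_boundary p r m (Re m + a) (cexpw a (Re p / 2) * pw (- (2 * a)) r *
    expR (- (Re p * r)))) => //.
- move=> t t0; apply: le_trans (kern_le_pw _ p0 a0 r0 t0) _.
  by rewrite ReD/= addrAC.
- by rewrite !mulr_ge0 ?expR_ge0 ?pw_ge0.
- exact: Cint_kern.
- exact: Cint_kern.
- exact: CintZ.
Qed.

Lemma G0_rec p m : 0 < Re p -> 0 < Re m -> m * G p 0 m = p * G p 0 (m + 1).
Proof.
move=> p0 m0.
have z t : (0 ^+ 2)%:C * kern p 0 (m - 1) t = 0 by rewrite expr0n /= mul0r.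
have m1 : 0 < Re (m + 1) by rewrite ReD addr_gt0//=.
rewrite (@G_boundary _ _ _ (Re m) 1) => //.
- under [X in cint X]eq_fun do rewrite z.
  by rewrite cint0 mulr0 subr0.
- move=> t t0; rewrite mul1r; apply: le_trans (kern_le _ _ (ltW p0) t0) _.
  rewrite ReD/= /gam ler_wpM2r ?pw_ge0// ler_expR lerN2; nra.
- exact: Cint_kern0.
- exact: Cint_kern0.
- by under eq_fun do rewrite z; split; exact: Rint0.
Qed.

Lemma G_bound p m d : 0 < Re p -> 0 < d -> 0 < Re m + d ->
  exists2 C, 0 <= C & forall r, 0 < r ->
    normc (G p r m) <= C * pw (- (2 * d)) r * expR (- (Re p * r)).
Proof.
move=> p0 d0 md; exists (2 * (cexpw d (Re p / 2) * rI (gam (Re m + d) (Re p / 2)))).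
  rewrite !mulr_ge0//; first by rewrite ltW// cexpw_gt0.
  by apply: rI_ge0 => t _; exact: gam_ge0.
move=> r r0.
have ig : Rint (gam (Re m + d) (Re p / 2)) by apply: Rint_gam => //; rewrite divr_gt0.
have i2 := RintZ (cexpw d (Re p / 2) * pw (- (2 * d)) r * expR (- (Re p * r))) ig.
apply: le_trans (normc_cint (Cint_kern m p0 r0) i2 _) _.
  by move=> t t0; exact: kern_le_pw.
by rewrite rIZ// le_eqVlt; apply/orP; left; apply/eqP; ring.
Qed.

(** The two kernels differ by the factor [exp (- p r^2 / t) - 1], which is of
    size [(r^2 / t)^th] for [th <= 1]; [th < Re m] keeps the loss [t^(- th)]
    integrable. *)
Lemma G_cvg0 p m th : 0 < Re p -> 0 < th <= 1 -> th < Re m ->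
  exists2 C, 0 <= C & forall r, 0 < r ->
    normc (G p r m - G p 0 m) <= C * pw (2 * th) r.
Proof.
move=> p0 /andP[th0 th1] thm.
have m0 : 0 < Re m by exact: lt_trans thm.
have pn : 0 < normc p.
  by rewrite normc_gt0; apply: contraTneq p0 => ->; rewrite ltxx.
exists (2 * (3 * pw th (normc p) * rI (gam (Re m - th) (Re p)))).
  by rewrite !mulr_ge0 ?pw_ge0//; apply: rI_ge0 => t _; exact: gam_ge0.
move=> r r0.
have ig : Rint (gam (Re m - th) (Re p)) by apply: Rint_gam => //; rewrite subr_gt0.
have i1 := Cint_kern m p0 r0; have i0 := Cint_kern0 0 p0 m0.
rewrite /G -cintB//.
apply: le_trans (normc_cint (g := fun t => (3 * pw th (normc p) * pw (2 * th) r) * gam (Re m - th) (Re p) t) (CintB i1 i0) (RintZ _ ig) _) _; last first.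
  by rewrite rIZ// le_eqVlt; apply/orP; left; apply/eqP; ring.
move=> t t0.
have r2 : 0 < r ^+ 2 / t by rewrite divr_gt0// exprn_gt0.
have -> : kern p r m t = kern p 0 m t * cexp (- (p * (r ^+ 2 / t)%:C)).
  rewrite /kern -cexpD; congr cexp; rewrite expr0n/= mul0r addr0 rmorphD/=; ring.
rewrite -{2}[kern p 0 m t]mulr1 -mulrBr normcM.
have h : normc (cexp (- (p * (r ^+ 2 / t)%:C)) - 1) <= 3 * pw th (normc (p * (r ^+ 2 / t)%:C)).
  apply: normc_cexpN1_pw; first by rewrite ltW.
    by rewrite ReM/= mulr0 subr0 mulr_ge0// ltW.
  by rewrite -normc_gt0 normcM mulr_gt0// normcR gtr0_norm.
apply: le_trans (ler_pM (normc_ge0 _) (normc_ge0 _) (kern_le _ _ (ltW p0) t0) h) _.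
rewrite normcM normcR (gtr0_norm r2) pwM// (pwM _ (exprn_gt0 2 r0)) ?invr_gt0// pwV// -(pw2 r0) pw_pw.
rewrite /gam (_ : Re m - th - 1 = - th + (Re m - 1)); last by ring.
rewrite (pwD (- th)) (mulrC th 2) le_eqVlt; apply/orP; left; apply/eqP; ring.
Qed.

(** Differentiating [exp (- p r^2 / t)] in [r] brings down [- 2 p r / t], which
    lowers [m] by one. *)
Lemma cder_G p r m : 0 < Re p -> 0 < r ->
  cder (fun r => G p r m) r (- (2 * r%:C * p * G p r (m - 1))).
Proof.
move=> p0 r0.
have iN := Cint_kern (m - 1) p0 r0.
rewrite -mulNr -cintZ//.
pose a := 2 + `|Re m|.
have a0 : 0 < a by rewrite ltr_pwDl.
have b0 : 0 < Re (m - 1) + a.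
  by rewrite /a ReD ReN/=; have := ler_norm (- Re m); rewrite normrN; lra.
have r20 : 0 < r / 2 by rewrite divr_gt0.
pose c := 4 * r * normc p * (cexpw a (Re p / 2) * pw (- (2 * a)) (r / 2)).
apply: (@cint_diff_under R (fun r t => kern p r m t)
  (fun r t => - (2 * r%:C * p) * kern p r (m - 1) t)
  (fun t => c * gam (Re (m - 1) + a) (Re p / 2) t) r (r / 2) (2 * r)).
- by apply/andP; split; lra.
- by move=> x /andP[xr _]; apply: Cint_kern => //; exact: lt_trans xr.
- move=> x t _ t0.
  have d : is_derive x 1 (fun r => t + r ^+ 2 / t) (2 * x / t).
    rewrite (_ : (fun _ => _) = cst t + (t^-1 \*: ((@id R) ^+ 2)))//; last first.
      by apply/funext => y; rewrite !fctE /GRing.scale/= mulrC.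
    by apply: is_derive_eq; rewrite /GRing.scale/= expr1; ring.
  apply: cder_eq (cder_cexp (cderD (cderN (cderZ p (cder_real d))) (cder_cst _ _))) _.
  rewrite -/(kern p x m t) kernN// !rmorphM/= rmorph_nat; ring.
- by apply: RintZ; apply: Rint_gam => //; rewrite divr_gt0.
- move=> x t /andP[xr xr2] t0.
  have x0 : 0 < x by exact: lt_trans xr.
  have e : normc (- (2 * x%:C * p)) = 2 * x * normc p.
    rewrite normcN !normcM normcR (gtr0_norm x0).
    have -> : (2 : R[i]) = 2%:C by rewrite rmorph_nat.
    by rewrite normcR ger0_norm.
  have k := kern_le_pw (m - 1) p0 a0 x0 t0 .
  have {}k : normc (kern p x (m - 1) t) <=
     cexpw a (Re p / 2) * pw (- (2 * a)) (r / 2) * gam (Re (m - 1) + a) (Re p / 2) t.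
    apply: le_trans k _; rewrite ler_wpM2r ?gam_ge0// -mulrA ler_wpM2l ?(ltW (cexpw_gt0 _ _))//.
    rewrite -[leRHS]mulr1; apply: ler_pM (pw_ge0 _ _) (expR_ge0 _) _ _.
      rewrite !(pwN (2 * a)) lef_pV2 ?posrE ?pw_gt0//; apply: ler_pw => //; last exact: ltW.
      by rewrite mulr_ge0// ltW.
    by rewrite -expR0 ler_expR oppr_le0 mulr_ge0// ltW.
  rewrite normcM e /c -[leRHS]mulrA; apply: ler_pM; rewrite ?normc_ge0//.
    by rewrite !mulr_ge0 ?normc_ge0// ltW.
  rewrite ler_wpM2r ?normc_ge0//; lra.
Qed.

End Kernel.

(** * Inversion, and the logarithmic kernel *)

Section Inversion.
Context {R : realType}.
Implicit Types (h : R -> R) (r t x : R).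
Local Notation mu := (@lebesgue_measure R).

Lemma is_derive_inv r t : 0 < t ->
  is_derive t 1 (fun t => r ^+ 2 / t) (- (r ^+ 2 / t ^+ 2)).
Proof.
move=> t0; have tn : t != 0 by rewrite gt_eqF.
have dV := @is_deriveV _ id t 1 1 tn (is_derive_id t 1).
rewrite (_ : (fun _ => _) = r ^+ 2 \*: (fun y : R => y^-1))//.
by apply: is_derive_eq; rewrite /GRing.scale/= mulr1 mulrN.
Qed.

(** The substitution [t = r^2 / u] exchanges the two ends of the half-line. *)
Lemma rI_inversion r h : 0 < r -> (forall t, 0 < t -> {for t, continuous h}) ->
  Rint h -> Rint (fun t => h (r ^+ 2 / t) * (r ^+ 2 / t ^+ 2)) ->
  rI h = rI (fun t => h (r ^+ 2 / t) * (r ^+ 2 / t ^+ 2)).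
Proof.
move=> r0 ch i1 i2.
have c1 := rI_exh r0 i1; have c2 := rI_exh r0 i2.
suff E : (fun n => \int[mu]_(x in exh r n) h x) =
    (fun n => \int[mu]_(x in exh r n) (h (r ^+ 2 / x) * (r ^+ 2 / x ^+ 2))).
  by move: c1; rewrite E => c1; exact: (cvg_unique _ c1 c2).
apply/funext => n; rewrite /exh /Rintegral; congr fine.
pose F (t : R) := r ^+ 2 / t.
have : (1 : R) <= n.+1%:R by rewrite ler1n.
move: (n.+1%:R : R) => N N1.
have N0 : 0 < N by exact: lt_le_trans N1.
set a := r / N; set b := r * N.
have a0 : 0 < a by rewrite divr_gt0.
have b0 : 0 < b by rewrite mulr_gt0.
have Fa : F a = b by rewrite /F /a /b; field; rewrite !gt_eqF.
have Fb : F b = a by rewrite /F /a /b; field; rewrite !gt_eqF.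
have ab : a <= b.
  by rewrite ler_pdivrMr// /b -mulrA ler_peMr ?(ltW r0)//; nra.
have dF t : 0 < t -> derive1 F t = - (r ^+ 2 / t ^+ 2).
  by move=> t0; rewrite derive1E; have [_ ->] := is_derive_inv r t0.
have cdF t : 0 < t -> {for t, continuous (fun t => - (r ^+ 2 / t ^+ 2))}.
  move=> t0; apply: (@continuousN _ R^o).
  apply: continuousM; first exact: cst_continuous.
  apply: (@continuousV _ _ (fun t => t ^+ 2)); first by rewrite expf_neq0// gt_eqF.
  exact: exprn_continuous.
have ndF t : 0 < t -> {near t, derive1 F =1 (fun t => - (r ^+ 2 / t ^+ 2))}.
  move=> t0; near=> u; apply: dF; apply: Rpos_gt0; near: u.
  by apply: (@open_nbhs_nbhs R); split; [exact: open_Rpos|exact/RposP].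
have cF t : 0 < t -> derive1 F x @[x --> t] --> - (r ^+ 2 / t ^+ 2).
  move=> t0; apply: cvg_trans (cdF t t0).
  apply: near_eq_cvg; have := ndF t t0; by apply: filterS => u ->.
have := @integration_by_substitution_decreasing R F h a b ab.
rewrite Fa Fb => ->.
- apply: eq_integral => t; rewrite inE/= in_itv/= => /andP[at_ tb].
  have t0 : 0 < t by exact: lt_le_trans at_.
  by congr EFin; rewrite /= !fctE dF// opprK.
- move=> x y; rewrite !in_itv/= => /andP[ax _] /andP[ay _] xy.
  by rewrite /F ltr_pM2l ?exprn_gt0// ltf_pV2 ?posrE// (lt_le_trans a0).
- move=> x; rewrite in_itv/= => /andP[ax _].
  have x0 : 0 < x by exact: lt_trans ax.
  by rewrite /continuous_at dF//; exact: cF.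
- apply/cvg_ex; exists (- (r ^+ 2 / a ^+ 2)); apply: cvg_at_right_filter; exact: cF.
- apply/cvg_ex; exists (- (r ^+ 2 / b ^+ 2)); apply: cvg_at_left_filter; exact: cF.
- split.
  + move=> x; rewrite in_itv/= => /andP[ax _].
    by have [] := is_derive_inv r (lt_trans a0 ax).
  + apply: cvg_at_right_filter; exact: (cont_is_derive (is_derive_inv r a0)).
  + apply: cvg_at_left_filter; exact: (cont_is_derive (is_derive_inv r b0)).
- apply: continuous_in_subspaceT => x; rewrite inE/= in_itv/= => /andP[ax _].
  by apply: ch; exact: lt_le_trans ax.
Unshelve. all: by end_near. Qed.

Lemma cint_inversion r (f : R -> R[i]) : 0 < r -> ccont f -> Cint f ->
  Cint (fun t => f (r ^+ 2 / t) * (r ^+ 2 / t ^+ 2)%:C) ->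
  cint f = cint (fun t => f (r ^+ 2 / t) * (r ^+ 2 / t ^+ 2)%:C).
Proof.
move=> r0 cf [i1 i2] [j1 j2]; rewrite !cintE.
have e1 : (fun x => Re (f (r ^+ 2 / x) * (r ^+ 2 / x ^+ 2)%:C)) =
    (fun x => Re (f (r ^+ 2 / x)) * (r ^+ 2 / x ^+ 2)).
  by apply/funext => x; rewrite ReM/= mulr0 subr0.
have e2 : (fun x => Im (f (r ^+ 2 / x) * (r ^+ 2 / x ^+ 2)%:C)) =
    (fun x => Im (f (r ^+ 2 / x)) * (r ^+ 2 / x ^+ 2)).
  by apply/funext => x; rewrite ImM/= mulr0 add0r.
congr (_ +i* _).
  rewrite e1 -(rI_inversion (h := fun x => Re (f x)))//.
    by move=> t /cf[].
  by rewrite -e1.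
rewrite e2 -(rI_inversion (h := fun x => Im (f x)))//.
  by move=> t /cf[].
by rewrite -e2.
Qed.

End Inversion.

Section KernelInversion.
Context {R : realType}.
Implicit Types (p m : R[i]) (r t a b s e K : R).

Lemma ln_inv r t : 0 < r -> 0 < t -> ln (r ^+ 2 / t) = 2 * ln r - ln t.
Proof. by move=> r0 t0; rewrite ln_div ?posrE ?exprn_gt0// lnXn// mulr_natl. Qed.

Lemma kern_inversion p r m t : 0 < r -> 0 < t ->
  kern p r m (r ^+ 2 / t) * (r ^+ 2 / t ^+ 2)%:C =
  cpowR r (2 * m) * kern p r (- m) t.
Proof.
move=> r0 t0.
have rn : r != 0 by rewrite gt_eqF.
have tn : t != 0 by rewrite gt_eqF.
have -> : (r ^+ 2 / t ^+ 2)%:C = cexp (2%:C * (ln r)%:C - 2%:C * (ln t)%:C).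
  rewrite -!rmorphM -rmorphB cexpR; congr (_%:C).
  rewrite -[LHS]lnK ?posrE ?divr_gt0 ?exprn_gt0//.
  by rewrite ln_div ?posrE ?exprn_gt0// !lnXn// !mulr_natl.
have two : (2 : R[i]) = 2%:C by rewrite rmorph_nat.
rewrite /kern /cpowR -!cexpD; congr cexp; rewrite ln_inv// rmorphB rmorphM.
have -> : r ^+ 2 / t + r ^+ 2 / (r ^+ 2 / t) = t + r ^+ 2 / t.
  by field; rewrite ?rn ?tn.
by rewrite two; ring.
Qed.

(** [t + r^2 / t] is invariant under [t |-> r^2 / t], while [t^m dt / t] becomes
    [r^(2 m) t^(- m) dt / t]: this is the evenness of [K_m] in [m]. *)
Lemma G_inversion p r m : 0 < Re p -> 0 < r ->
  G p r m = cpowR r (2 * m) * G p r (- m).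
Proof.
move=> p0 r0.
have i := Cint_kern m p0 r0; have j := Cint_kern (- m) p0 r0.
have E t : 0 < t -> cpowR r (2 * m) * kern p r (- m) t =
   kern p r m (r ^+ 2 / t) * (r ^+ 2 / t ^+ 2)%:C.
  by move=> t0; rewrite kern_inversion.
rewrite /G (cint_inversion r0 (ccont_kern p r m) i); last first.
  by apply: Cint_eq E _; exact: CintZ.
rewrite -cintZ//; apply: cint_eq => t t0; by rewrite E.
Qed.

(** At [m] different from [0] the kernel integral splits exactly into its two
    power behaviours, with coefficients continuous down to [r = 0]. *)
Lemma G_split p r m : 0 < Re p -> 0 < r -> m != 0 ->
  G p r m = p / m * (G p r (m + 1) - cpowR r (2 * m) * G p r (1 - m)).
Proof.
move=> p0 r0 m0; have := G_rec m p0 r0.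
rewrite (G_inversion (m - 1) p0 r0) opprB.
have -> : 2 * (m - 1) = 2 * m - 1 - 1 by ring.
rewrite 2!(cpowRD r _ (- 1)) cpowRN1// => h.
apply: (mulfI m0); rewrite h rmorphXn fmorphV/=.
have rn : r%:C != 0 :> R[i] by rewrite eq_complex/= gt_eqF.
by field; rewrite m0 rn.
Qed.

(** At [m = 0] the two powers [r^m] and [r^(- m)] coalesce; the kernel with a
    logarithm supplies the missing behaviour. *)
Definition lnkern p r m t : R[i] := (ln t)%:C * kern p r m t.
Definition H p r : R[i] := cint (lnkern p r 1).

Lemma ccont_lnkern p r m : ccont (lnkern p r m).
Proof.
apply: ccontM; last exact: ccont_kern.
by apply: ccont_real => t t0; exact: continuous_ln.
Qed.

Lemma normc_ln e t : 0 < e -> 0 < t ->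
  normc ((ln t)%:C : R[i]) <= e^-1 * (pw e t + pw (- e) t).
Proof. by move=> e0 t0; rewrite normcR abs_ln_le. Qed.

Lemma pw_gam a b s t : pw a t * gam b s t = gam (b + a) s t.
Proof.
rewrite /gam (_ : b + a - 1 = a + (b - 1)); first by rewrite (pwD a) mulrCA.
by ring.
Qed.

Lemma pw_gam_eq a b c s t : b + a = c -> pw a t * gam b s t = gam c s t.
Proof. by move=> <-; rewrite pw_gam. Qed.

Lemma gam_le_any b a d s t : 0 < a -> 0 < s -> 0 < t -> b - 1 - a = d ->
  gam b s t <= cexpw a s * pw d t.
Proof.
move=> a0 s0 t0 <-; rewrite /gam (addrC (b - 1)) (pwD (- a)) mulrA ler_wpM2r ?pw_ge0//.
exact: exp_le_pw.
Qed.

Lemma Cint_lnkern p r m : 0 < Re p -> 0 < r -> Cint (lnkern p r m).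
Proof.
move=> p0 r0; pose a := 2 + `|Re m|.
have a0 : 0 < a by rewrite ltr_pwDl.
have b0 : 0 < Re m + a - 1.
  by rewrite /a; have := ler_norm (- Re m); rewrite normrN; lra.
have q0 : 0 < Re p / 2 by rewrite divr_gt0.
pose c := cexpw a (Re p / 2) * pw (- (2 * a)) r * expR (- (Re p * r)).
pose q := Re p / 2.
have i1 : Rint (gam (Re m + a + 1) q) by apply: Rint_gam => //; lra.
have i2 : Rint (gam (Re m + a + -1) q) by apply: Rint_gam.
apply: (Cint_le (g := fun t => c * (gam (Re m + a + 1) q t + gam (Re m + a + -1) q t))
   (ccont_meas (ccont_lnkern p r m))); last by apply: RintZ; exact: RintD.
move=> t t0; rewrite /lnkern normcM.
apply: le_trans (ler_pM (normc_ge0 _) (normc_ge0 _) (normc_ln ltr01 t0)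
  (kern_le_pw m p0 a0 r0 t0)) _.
by rewrite invr1 mul1r -/c -/q mulrCA mulrDl !pw_gam.
Qed.

Lemma lnkern_le p r t e : 0 <= Re p -> 0 < e -> 0 < t ->
  normc (lnkern p r 1 t) <= e^-1 * (gam (1 + e) (Re p) t + gam (1 - e) (Re p) t).
Proof.
move=> p0 e0 t0; rewrite /lnkern normcM.
apply: le_trans (ler_pM (normc_ge0 _) (normc_ge0 _) (normc_ln e0 t0)
  (kern_le r 1 p0 t0)) _.
by rewrite -mulrA mulrDl !pw_gam.
Qed.

Lemma Cint_lnkern0 p r : 0 < Re p -> Cint (lnkern p r 1).
Proof.
move=> p0; have h0 : 0 < (2^-1 : R) by rewrite invr_gt0.
apply: (Cint_le (g := fun t => 2^-1^-1 * (gam (1 + 2^-1) (Re p) t + gam (1 - 2^-1) (Re p) t))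
   (ccont_meas (ccont_lnkern p r 1))).
  by move=> t t0; apply: lnkern_le => //; exact: ltW.
by apply: RintZ; apply: RintD; apply: Rint_gam => //; lra.
Qed.

(** Integration by parts against [d (ln t)] and inversion: for [m = 0] one of
    the two powers is replaced by a logarithm. *)
Lemma G_split0 p r : 0 < Re p -> 0 < r ->
  G p r 0 = 2 * p * H p r - 2 * p * (ln r)%:C * G p r 1.
Proof.
move=> p0 r0.
have i0 := Cint_kern 0 p0 r0; have i1 := Cint_lnkern 1 p0 r0.
have iN := Cint_lnkern (-1) p0 r0.
have k1 := Cint_kern (-1) p0 r0.
have two : (2 : R[i]) = 2%:C by rewrite rmorph_nat.
have E1 : G p r 0 = p * H p r - p * (r ^+ 2)%:C * cint (lnkern p r (-1)).
  pose f t := kern p r 0 t - p * lnkern p r 1 t + (p * (r ^+ 2)%:C) * lnkern p r (-1) t.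
  have : cint f = 0.
    pose q := Re p / 2.
    pose c := cexpw 2 q * pw (- (2 * 2)) r * expR (- (Re p * r)).
    have c0 : 0 <= c.
      exact: mulr_ge0 (mulr_ge0 (ltW (cexpw_gt0 _ _)) (pw_ge0 _ _)) (expR_ge0 _).
    have q0 : 0 < q by rewrite divr_gt0.
    have dom t : 0 < t -> normc (lnkern p r 1 t) <=
        c * (gam 4 q t + gam 2 q t).
      move=> t0; rewrite /lnkern normcM.
      apply: le_trans (ler_pM (normc_ge0 _) (normc_ge0 _) (normc_ln ltr01 t0)
        (kern_le_pw 1 p0 (ltr0Sn _ 1) r0 t0)) _.
      rewrite invr1 mul1r -/c mulrCA mulrDl.
      have e1 : (Re 1 : R) + 2 + 1 = 4 by rewrite /=; ring.
      have e2 : (Re 1 : R) + 2 + (- 1) = 2 by rewrite /=; ring.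
      by rewrite (pw_gam_eq _ _ e1) (pw_gam_eq _ _ e2).
    apply: (@cint_boundary0 R (lnkern p r 1) f 1
      (c * (cexpw 2 q + cexpw 4 q + 1 + cexpw 2 q))) => //.
    - move=> t t0; apply: cder_eq (cderM (cder_ln t0) (cder_kern _ _ _ t0)) _.
      have := kernN p r 1 t0; rewrite subrr => k0.
      have := kernN p r 0 t0; rewrite sub0r k0 => kN.
      rewrite /f /lnkern k0 kN.
      have tn : t%:C != 0 :> R[i] by rewrite eq_complex/= gt_eqF.
      rewrite !(rmorphB, rmorphM, fmorphV, rmorphXn, rmorph1)/=.
      by field.
    - apply: ccontD; last by apply: ccontM; [exact: ccont_cst|exact: ccont_lnkern].
      apply: ccontD; first exact: ccont_kern.
      have := ccontM (ccont_cst (- p)) (ccont_lnkern p r 1).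
      by rewrite (_ : (fun _ => _) = (fun x => - (p * lnkern p r 1 x)))//;
        apply/funext => x; rewrite mulNr.
    - by apply: CintD; [apply: CintB => //; exact: CintZ|exact: CintZ].
    - move=> t t0; apply: le_trans (dom t t0) _; rewrite -mulrA ler_wpM2l//.
      have e1 : (4 : R) - 1 - 2 = 1 by ring.
      have e2 : (2 : R) - 1 - 2 = -1 by ring.
      have h1 : gam 4 q t <= cexpw 2 q * pw 1 t by exact: gam_le_any.
      have h2 : gam 2 q t <= pw 1 t by exact: (gam_le_pw 1).
      have p1 := mulr_gt0 (cexpw_gt0 2 q) (pw_gt0 (1) t).
      have p2 := mulr_gt0 (cexpw_gt0 4 q) (pw_gt0 (1) t).
      have p3 := pw_gt0 (1) t.
      by rewrite !mulrDl mul1r; lra.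
    - move=> t t0; apply: le_trans (dom t t0) _; rewrite -mulrA ler_wpM2l//.
      have e1 : (4 : R) - 1 - 4 = -1 by ring.
      have e2 : (2 : R) - 1 - 2 = -1 by ring.
      have h1 : gam 4 q t <= cexpw 4 q * pw (- 1) t by exact: gam_le_any.
      have h2 : gam 2 q t <= cexpw 2 q * pw (- 1) t by exact: gam_le_any.
      have p1 := mulr_gt0 (cexpw_gt0 2 q) (pw_gt0 (- 1) t).
      have p2 := mulr_gt0 (cexpw_gt0 4 q) (pw_gt0 (- 1) t).
      have p3 := pw_gt0 (- 1) t.
      by rewrite !mulrDl mul1r; lra.
  rewrite /f cintD; [|by apply: CintB => //; exact: CintZ|exact: CintZ].
  rewrite cintB//; last exact: CintZ.
  rewrite !(cintZ _ i1, cintZ _ iN) => /eqP; rewrite addr_eq0 subr_eq addrC => /eqP h.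
  exact: h.
have r2 : cpowR r (2 : R[i]) = (r ^+ 2)%:C.
  by rewrite (_ : (2 : R[i]) = 1 + 1)// cpowRD cpowR1// expr2 rmorphM.
have E2 : H p r = 2 * (ln r)%:C * G p r 1 - (r ^+ 2)%:C * cint (lnkern p r (-1)).
  have F t : 0 < t -> lnkern p r 1 (r ^+ 2 / t) * (r ^+ 2 / t ^+ 2)%:C =
     2 * (ln r)%:C * (r ^+ 2)%:C * kern p r (-1) t - (r ^+ 2)%:C * lnkern p r (-1) t.
    move=> t0; rewrite /lnkern -mulrA kern_inversion// ln_inv// mulr1.
    rewrite r2 rmorphB (rmorphM _ 2)/= two; ring.
  have iF : Cint (fun t => lnkern p r 1 (r ^+ 2 / t) * (r ^+ 2 / t ^+ 2)%:C).
    apply: (Cint_eq (f := fun t => 2 * (ln r)%:C * (r ^+ 2)%:C * kern p r (-1) t -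
      (r ^+ 2)%:C * lnkern p r (-1) t)); first by move=> t t0; rewrite F.
    by apply: CintB; exact: CintZ.
  rewrite /H (cint_inversion r0 (ccont_lnkern p r 1) i1 iF).
  rewrite (cint_eq F) cintB; [|exact: CintZ|exact: CintZ].
  rewrite !(cintZ _ k1, cintZ _ iN) (G_inversion 1 p0 r0) mulr1.
  by rewrite r2 /G; ring.
have E3 : (r ^+ 2)%:C * cint (lnkern p r (-1)) = 2 * (ln r)%:C * G p r 1 - H p r.
  by rewrite E2; ring.
by rewrite E1 -mulrA E3; ring.
Qed.

(** As for [G_cvg0]; the logarithm costs an arbitrarily small power of [t], which
    is why [th = 1] is excluded. *)
Lemma H_cvg0 p th : 0 < Re p -> 0 < th < 1 ->
  exists2 C, 0 <= C & forall r, 0 < r ->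
    normc (H p r - H p 0) <= C * pw (2 * th) r.
Proof.
move=> p0 /andP[th0 th1].
have pn : 0 < normc p.
  by rewrite normc_gt0; apply: contraTneq p0 => ->; rewrite ltxx.
pose e := (1 - th) / 2.
have e0 : 0 < e by rewrite /e; lra.
pose g t := gam (1 + e + - th) (Re p) t + gam (1 - e + - th) (Re p) t.
have ig : Rint g by apply: RintD; apply: Rint_gam => //; rewrite /e; lra.
exists (2 * (3 * pw th (normc p) * e^-1 * rI g)).
  rewrite !mulr_ge0 ?pw_ge0 ?invr_ge0 ?(ltW e0)//.
  by apply: rI_ge0 => t _; rewrite addr_ge0 ?gam_ge0.
move=> r r0.
have i1 := Cint_lnkern0 r p0; have i0 := Cint_lnkern0 0 p0.
rewrite /H -cintB//.
pose c := 3 * pw th (normc p) * e^-1 * pw (2 * th) r.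
apply: le_trans (normc_cint (CintB i1 i0) (RintZ c ig) _) _; last first.
  by rewrite rIZ// le_eqVlt; apply/orP; left; apply/eqP; rewrite /c; ring.
move=> t t0.
have r2 : 0 < r ^+ 2 / t by rewrite divr_gt0// exprn_gt0.
have -> : lnkern p r 1 t = lnkern p 0 1 t * cexp (- (p * (r ^+ 2 / t)%:C)).
  rewrite /lnkern -mulrA; congr (_ * _).
  rewrite /kern -cexpD; congr cexp; rewrite expr0n/= mul0r addr0 rmorphD/=; ring.
rewrite -{2}[lnkern p 0 1 t]mulr1 -mulrBr normcM.
have h : normc (cexp (- (p * (r ^+ 2 / t)%:C)) - 1) <= 3 * pw th (normc (p * (r ^+ 2 / t)%:C)).
  apply: normc_cexpN1_pw; first by rewrite !ltW.
    by rewrite ReM/= mulr0 subr0 mulr_ge0// ltW.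
  by rewrite -normc_gt0 normcM mulr_gt0// normcR gtr0_norm.
apply: le_trans (ler_pM (normc_ge0 _) (normc_ge0 _) (lnkern_le 0 (ltW p0) e0 t0) h) _.
rewrite normcM normcR (gtr0_norm r2) pwM// (pwM _ (exprn_gt0 2 r0)) ?invr_gt0// pwV// -(pw2 r0) pw_pw.
rewrite /c /g -!pw_gam (mulrC th 2) le_eqVlt; apply/orP; left; apply/eqP; ring.
Qed.

End KernelInversion.

(** * Rotation of the contour, Gamma function and Euler constant *)

Section Rotation.
(* one constant for the two boundary bounds in [rot_cint0] *)
Let lin1 (F : realFieldType) (a b c2 c4 P : F) : a <= c2 * P -> b <= P ->
  0 < c2 -> 0 < c4 -> 0 < P -> a + b <= (c2 + c4 + 1 + c2) * P.
Proof. move=> *; nra. Qed.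
Let lin2 (F : realFieldType) (a b c2 c4 P : F) : a <= c4 * P -> b <= c2 * P ->
  0 < c2 -> 0 < c4 -> 0 < P -> a + b <= (c2 + c4 + 1 + c2) * P.
Proof. move=> *; nra. Qed.

Context {R : realType}.
Variables (s m A B : R[i]).
Hypothesis s_im : `|Im s| < pi / 2.
Hypothesis m_re : 0 < Re m.
Implicit Types (t tau : R).

Definition rotl tau t : R[i] := (ln t)%:C + s * tau%:C.
Definition rote tau t : R[i] :=
  cexp (- (cexp (s * tau%:C) * t%:C) + m * rotl tau t).
Definition roti tau t : R[i] := (t^-1)%:C * (rote tau t * (A + B * rotl tau t)).
Definition rotd tau t : R[i] := s * ((t^-1)%:C * (rote tau t *
  ((m - cexp (s * tau%:C) * t%:C) * (A + B * rotl tau t) + B))).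

Lemma cder_rotl tau t : cder (rotl ^~ t) tau s.
Proof.
have := cderD (cder_cst ((ln t)%:C) tau) (cderZ s (cder_id tau)).
by rewrite add0r mulr1.
Qed.

Lemma cder_roti tau t : 0 < t -> cder (roti ^~ t) tau (rotd tau t).
Proof.
move=> t0.
have d1 := cder_cexp (cderZ s (cder_id tau)).
have d2 := cder_rotl tau t.
have d3 := cderN (cderM d1 (cder_cst (t%:C) tau)).
have d4 := cder_cexp (cderD d3 (cderZ m d2)).
have d5 := cderM d4 (cderD (cder_cst A tau) (cderZ B d2)).
apply: cder_eq (cderZ (t^-1)%:C d5) _.
by rewrite /rotd -/(rote tau t); ring.
Qed.

(** The integrand is [Phi (ln t + s tau) / t] with [Phi] holomorphic, so that
    its derivative in [tau] is [s] times a derivative in [t]. *)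
Lemma cder_rotF tau t : 0 < t ->
  cder (fun t => s * (rote tau t * (A + B * rotl tau t))) t (rotd tau t).
Proof.
move=> t0.
have d2 : cder (rotl tau) t ((t^-1)%:C + 0) by exact: cderD (cder_ln t0) (cder_cst _ _).
have d3 := cderN (cderZ (cexp (s * tau%:C)) (cder_id t)).
have d4 := cder_cexp (cderD d3 (cderZ m d2)).
have d5 := cderM d4 (cderD (cder_cst A t) (cderZ B d2)).
apply: cder_eq (cderZ s d5) _.
have tn : t%:C != 0 :> R[i] by rewrite eq_complex/= gt_eqF.
rewrite /rotd -/(rote tau t) fmorphV/=; by field.
Qed.

Let ccont_rotl tau : ccont (fun t => A + B * rotl tau t).
Proof.
apply: ccontD; first exact: ccont_cst.
apply: ccontM; first exact: ccont_cst.
apply: ccontD; last exact: ccont_cst.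
by apply: ccont_real => t; exact: continuous_ln.
Qed.

Let ccont_rote tau : ccont (rote tau).
Proof.
apply: (@cder_ccont _ _ (fun t => (- (cexp (s * tau%:C) * 1) + m * ((t^-1)%:C + 0)) * rote tau t)) => t t0.
apply: cder_cexp; apply: cderD; first by apply: cderN; apply: cderZ; exact: cder_id.
by apply: cderZ; exact: cderD (cder_ln t0) (cder_cst _ _).
Qed.

Let ccont_inv : ccont (fun t : R => (t^-1)%:C : R[i]).
Proof.
apply: ccont_real => t t0.
by apply: (@continuousV _ _ id); [rewrite gt_eqF|exact: id].
Qed.

Lemma ccont_roti tau : ccont (roti tau).
Proof. exact: ccontM ccont_inv (ccontM (ccont_rote tau) (ccont_rotl tau)). Qed.

Lemma ccont_rotd tau : ccont (rotd tau).
Proof.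
have c : ccont (fun t => m - cexp (s * tau%:C) * t%:C).
  have -> : (fun x => m - cexp (s * tau%:C) * x%:C) = (fun x => m + (- cexp (s * tau%:C)) * x%:C).
    by apply/funext => x; rewrite mulNr.
  apply: ccontD; first exact: ccont_cst.
  apply: ccontM; first exact: ccont_cst.
  by apply: ccont_real => x x0; exact: id.
apply: (ccontM (ccont_cst s)); apply: (ccontM ccont_inv); apply: (ccontM (ccont_rote tau)).
exact: ccontD (ccontM c (ccont_rotl tau)) (ccont_cst B).
Qed.

(** [tau] ranges over an open neighbourhood of [[0, 1]] on which the rays
    [exp (s tau) t] stay in the right half-plane. *)
Let T : R := 1 + (pi / 2 - `|Im s|) / (2 * (`|Im s| + 1)).

Let pi2_gt0 : 0 < pi / 2 :> R. Proof. by rewrite divr_gt0// pi_gt0. Qed.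

Let T_gt1 : 1 < T.
Proof.
by rewrite /T ltrDl divr_gt0 ?subr_gt0// mulr_gt0// ltr_wpDl.
Qed.

Let T_lt : T * `|Im s| < pi / 2.
Proof.
have h := normr_ge0 (Im s); have h1 := T_gt1; move: h1; rewrite /T.
set y := `|Im s| in h *; set q := _ / (2 * _); rewrite ltrDl => q0.
have E : q * (2 * (y + 1)) = pi / 2 - y by rewrite /q; field; rewrite gt_eqF// ltr_wpDl.
nra.
Qed.

Let s0 : R := expR (- (T * `|Re s|)) * cos (T * `|Im s|).

Let s0_gt0 : 0 < s0.
Proof.
rewrite mulr_gt0 ?expR_gt0// cos_gt0_pihalf// T_lt andbT.
rewrite (@lt_le_trans _ _ 0)//; first by rewrite oppr_lt0.
by rewrite mulr_ge0// ltW// (lt_trans _ T_gt1).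
Qed.

Let Re_rot tau : - T < tau < T -> s0 <= Re (cexp (s * tau%:C)).
Proof.
move=> /andP[t1 t2].
have tT : `|tau| <= T by rewrite ler_norml !ltW.
have T0 : 0 <= T by rewrite ltW// (lt_trans _ T_gt1).
rewrite /cexp ReM/= !mul0r subr0 !(ReM, ImM)/= !mulr0 subr0 add0r.
apply: ler_pM; rewrite ?expR_ge0//.
- apply: cos_ge0_pihalf; rewrite (ltW T_lt) andbT.
  rewrite (@le_trans _ _ 0)//; first by rewrite oppr_le0 ltW.
  by rewrite mulr_ge0.
- rewrite ler_expR lerNl; apply: le_trans (ler_norm _) _.
  by rewrite normrN normrM mulrC; apply: ler_pM.
- rewrite -(cos_norm (Im s * tau)) normrM (mulrC `|Im s|).
  have h : T * `|Im s| <= pi by apply: le_trans (ltW T_lt) _; have := pi_gt0 R; lra.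
  have h1 : `|tau| * `|Im s| <= T * `|Im s| by rewrite ler_wpM2r.
  have a1 : `|tau| * `|Im s| \in `[0, pi] by rewrite in_itv/= mulr_ge0//= (le_trans h1 h).
  have a2 : T * `|Im s| \in `[0, pi] by rewrite in_itv/= mulr_ge0.
  by rewrite leNgt (ltr_cos a2 a1) -leNgt.
Qed.

Let e : R := Re m / 2.
Let e0 : 0 < e. Proof. by rewrite divr_gt0. Qed.

Let W t : R := pw e t + pw (- e) t.

Let W_ge1 t : 1 <= W t.
Proof.
rewrite /W pwN; have p := pw_gt0 e t.
have q : 0 < (pw e t)^-1 by rewrite invr_gt0.
have pq : pw e t * (pw e t)^-1 = 1 by rewrite divff// gt_eqF.
have := sqr_ge0 (pw e t - (pw e t)^-1); nra.
Qed.

Let K1 : R := normc A + normc B * (e^-1 + T * normc s).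

Let K1_ge0 : 0 <= K1.
Proof.
rewrite addr_ge0 ?normc_ge0// mulr_ge0 ?normc_ge0// addr_ge0 ?invr_ge0 ?(ltW e0)//.
by rewrite mulr_ge0 ?normc_ge0// ltW// (lt_trans _ T_gt1).
Qed.

Let AB_le tau t : - T < tau < T -> 0 < t -> normc (A + B * rotl tau t) <= K1 * W t.
Proof.
move=> /andP[t1 t2] t0.
have tT : `|tau| <= T by rewrite ler_norml !ltW.
have W1 := W_ge1 t.
apply: le_trans (normcD _ _) _; rewrite normcM /K1 mulrDl.
apply: lerD; first by rewrite ler_peMr ?normc_ge0.
rewrite -mulrA ler_wpM2l ?normc_ge0// mulrDl.
apply: le_trans (normcD _ _) _; apply: lerD; first exact: normc_ln.
rewrite normcM normcR mulrC; apply: (@le_trans _ _ (T * normc s)).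
  by rewrite ler_wpM2r ?normc_ge0.
by rewrite ler_peMr// mulr_ge0 ?normc_ge0// ltW// (lt_trans _ T_gt1).
Qed.

Let M2 : R := expR (T * normc (m * s)).

Let rote_le tau t : - T < tau < T -> 0 < t ->
  normc (rote tau t) <= M2 * gam (Re m + 1) s0 t.
Proof.
move=> tT t0; have h := Re_rot tT.
have tT' : `|tau| <= T by move/andP: tT => [? ?]; rewrite ler_norml !ltW.
rewrite /rote normc_cexp /M2 /gam /pw -!expRD ler_expR addrK.
rewrite /rotl mulrDr !ReD ReN mulrA.
have -> : Re (cexp (s * tau%:C) * t%:C) = Re (cexp (s * tau%:C)) * t.
  by rewrite ReM/= mulr0 subr0.
have -> : Re (m * (ln t)%:C) = Re m * ln t by rewrite ReM/= mulr0 subr0.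
have -> : Re (m * s * tau%:C) = Re (m * s) * tau by rewrite [LHS]ReM/= mulr0 subr0.
have h1 : s0 * t <= Re (cexp (s * tau%:C)) * t by rewrite ler_wpM2r// ltW.
have h2 : Re (m * s) * tau <= T * normc (m * s).
  apply: le_trans (ler_norm _) _; rewrite normrM mulrC.
  by apply: ler_pM => //; exact: normc_Re.
lra.
Qed.

Let g t : R := gam (Re m + 1 + e) s0 t + gam (Re m + 1 - e) s0 t +
  (gam (Re m + e) s0 t + gam (Re m - e) s0 t).

Let g_ge0 t : 0 <= g t. Proof. by rewrite !addr_ge0 ?gam_ge0. Qed.

Let Rint_g : Rint g.
Proof.
have := m_re => m0.
by apply: RintD; apply: RintD; apply: Rint_gam => //; rewrite /e; lra.
Qed.

Let gE1 t : W t * gam (Re m + 1) s0 t =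
  gam (Re m + 1 + e) s0 t + gam (Re m + 1 - e) s0 t.
Proof. by rewrite /W mulrDl !pw_gam. Qed.

Let gE2 t : 0 < t -> t^-1 * (W t * gam (Re m + 1) s0 t) =
  gam (Re m + e) s0 t + gam (Re m - e) s0 t.
Proof.
move=> t0; rewrite gE1 -(pwN1 t0) mulrDr.
by congr (_ + _); apply: pw_gam_eq; ring.
Qed.

Let roti_le tau t : - T < tau < T -> 0 < t -> normc (roti tau t) <= M2 * K1 * g t.
Proof.
move=> tT t0; rewrite /roti normcM (normcM (rote tau t)) normcR gtr0_norm ?invr_gt0//.
have := ler_pM (normc_ge0 _) (normc_ge0 _) (rote_le tT t0) (AB_le tT t0).
have ti : 0 <= t^-1 by rewrite invr_ge0 ltW.
move=> /(ler_wpM2l ti) h; apply: le_trans h _.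
rewrite (_ : t^-1 * _ = M2 * K1 * (t^-1 * (W t * gam (Re m + 1) s0 t))); last by ring.
rewrite gE2// ler_wpM2l ?mulr_ge0 ?expR_ge0// /g lerDr addr_ge0 ?gam_ge0//.
Qed.

Let rotF_le tau t : - T < tau < T -> 0 < t ->
  normc (s * (rote tau t * (A + B * rotl tau t))) <= normc s * (M2 * K1) *
   (gam (Re m + 1 + e) s0 t + gam (Re m + 1 - e) s0 t).
Proof.
move=> tT t0; rewrite normcM (normcM (rote tau t)) -[leRHS]mulrA ler_wpM2l ?normc_ge0//.
apply: le_trans (ler_pM (normc_ge0 _) (normc_ge0 _) (rote_le tT t0) (AB_le tT t0)) _.
by rewrite -gE1 le_eqVlt; apply/orP; left; apply/eqP; ring.
Qed.

Let M1 : R := expR (T * `|Re s|).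
Let K3 : R := (normc m + M1) * K1 + normc B.

Let rotd_le tau t : - T < tau < T -> 0 < t ->
  normc (rotd tau t) <= normc s * (M2 * K3) * g t.
Proof.
move=> tT t0; rewrite /rotd normcM -mulrA ler_wpM2l ?normc_ge0//.
have tT' : `|tau| <= T by move/andP: tT => [? ?]; rewrite ler_norml !ltW.
have hm : normc (m - cexp (s * tau%:C) * t%:C) <= (normc m + M1) * (1 + t).
  apply: le_trans (normcB _ _) _; rewrite normcM normcR (gtr0_norm t0) normc_cexp.
  have h : expR (Re (s * tau%:C)) <= M1.
    rewrite ler_expR ReM/= mulr0 subr0; apply: le_trans (ler_norm _) _.
    by rewrite normrM mulrC; apply: ler_pM.
  have := normc_ge0 m; have := expR_ge0 (T * `|Re s|); rewrite -/M1 => ? ?.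
  have := ler_wpM2r (ltW t0) h; nra.
have h1 : normc ((m - cexp (s * tau%:C) * t%:C) * (A + B * rotl tau t) + B) <=
    K3 * ((1 + t) * W t).
  apply: le_trans (normcD _ _) _; rewrite normcM /K3 mulrDl; apply: lerD.
    apply: le_trans (ler_pM (normc_ge0 _) (normc_ge0 _) hm (AB_le tT t0)) _.
    by rewrite le_eqVlt; apply/orP; left; apply/eqP; ring.
  rewrite ler_peMr ?normc_ge0//.
  by have := W_ge1 t; nra.
rewrite normcM (normcM (rote tau t)) normcR gtr0_norm ?invr_gt0//.
have := ler_pM (normc_ge0 _) (normc_ge0 _) (rote_le tT t0) h1.
have ti : 0 <= t^-1 by rewrite invr_ge0 ltW.
move=> /(ler_wpM2l ti) h; apply: le_trans h _.
rewrite (_ : t^-1 * _ = M2 * K3 * (t^-1 * (W t * gam (Re m + 1) s0 t) +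
  W t * gam (Re m + 1) s0 t)); last by field; rewrite gt_eqF.
by rewrite gE2// gE1 /g addrC.
Qed.

Lemma rot_cint0 tau : - T < tau < T -> cint (rotd tau) = 0.
Proof.
move=> tT.
have i : Cint (rotd tau).
  apply: (Cint_le (g := fun t => normc s * (M2 * K3) * g t)).
  - exact: ccont_meas (ccont_rotd tau).
  - by move=> t t0; exact: rotd_le.
  - exact: RintZ _ Rint_g.
pose K := normc s * (M2 * K1) * (cexpw (2 * e) s0 + cexpw (4 * e) s0 + 1 + cexpw (2 * e) s0).
have K0 : 0 <= normc s * (M2 * K1) by rewrite !mulr_ge0 ?normc_ge0 ?expR_ge0.
apply: (cint_boundary0 (K := K) e0 (fun t => @cder_rotF tau t) (ccont_rotd tau) i) => t t0.
  apply: le_trans (rotF_le tT t0) _; rewrite /K -[leRHS]mulrA ler_wpM2l//.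
  have h1 : gam (Re m + 1 + e) s0 t <= cexpw (2 * e) s0 * pw e t.
    by apply: gam_le_any => //; [rewrite mulr_gt0|rewrite /e; field].
  have h2 : gam (Re m + 1 - e) s0 t <= pw e t.
    by rewrite (_ : Re m + 1 - e = e + 1); [exact: gam_le_pw|rewrite /e; field].
  exact: lin1 h1 h2 (cexpw_gt0 _ _) (cexpw_gt0 _ _) (pw_gt0 _ _).
apply: le_trans (rotF_le tT t0) _; rewrite /K -[leRHS]mulrA ler_wpM2l//.
have h1 : gam (Re m + 1 + e) s0 t <= cexpw (4 * e) s0 * pw (- e) t.
  by apply: gam_le_any => //; [rewrite mulr_gt0|rewrite /e; field].
have h2 : gam (Re m + 1 - e) s0 t <= cexpw (2 * e) s0 * pw (- e) t.
  by apply: gam_le_any => //; [rewrite mulr_gt0|rewrite /e; field].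
exact: lin2 h1 h2 (cexpw_gt0 _ _) (cexpw_gt0 _ _) (pw_gt0 _ _).
Qed.

Lemma Cint_roti tau : - T < tau < T -> Cint (roti tau).
Proof.
move=> tT; apply: (Cint_le (g := fun t => M2 * K1 * g t)).
- exact: ccont_meas (ccont_roti tau).
- by move=> t t0; exact: roti_le.
- exact: RintZ _ Rint_g.
Qed.

(** The [tau]-derivative of [cint (roti tau)] is [cint (rotd tau)], the integral of
    a [t]-derivative whose primitive vanishes at both ends. *)
Lemma rotation : cint (roti 1) = cint (roti 0).
Proof.
have D tau : - T < tau < T -> cder (fun tau => cint (roti tau)) tau 0.
  move=> tT; rewrite -(rot_cint0 tT).
  apply: (@cint_diff_under R roti rotd (fun t => normc s * (M2 * K3) * g t) tau (- T) T).
  - exact: tT.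
  - by move=> x; exact: Cint_roti.
  - by move=> x t _ t0; exact: cder_roti.
  - exact: RintZ _ Rint_g.
  - by move=> x t; exact: rotd_le.
have I x : 0 <= x <= 1 -> - T < x < T.
  move=> /andP[x0 x1]; rewrite (le_lt_trans x1 T_gt1) andbT.
  by apply: lt_le_trans x0; rewrite oppr_lt0 (lt_trans _ T_gt1).
have c1 := @increment_le_cst R (fun tau => Re (cint (roti tau))) (fun=> 0) 0 0 1 ler01.
have c2 := @increment_le_cst R (fun tau => Im (cint (roti tau))) (fun=> 0) 0 0 1 ler01.
apply: complexP; apply/eqP; rewrite -subr_eq0 -normr_le0.
  rewrite -[leRHS](mul0r (1 - 0 : R)); apply: c1.
    by move=> x /I /D[].
  by move=> x _; rewrite normr0.
rewrite -[leRHS](mul0r (1 - 0 : R)); apply: c2.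
  by move=> x /I /D[].
by move=> x _; rewrite normr0.
Qed.

End Rotation.

Section GammaEuler.
Context {R : realType}.
Implicit Types (s m z : R[i]) (t x y N : R).
Local Notation mu := (@lebesgue_measure R).

Lemma kern0E s t m (tau : R) : 0 < t ->
  rote s m tau t = cexp (m * (s * tau%:C)) * (t%:C * kern (cexp (s * tau%:C)) 0 m t).
Proof.
move=> t0.
rewrite -kernS//.
rewrite /rote /rotl /kern -!cexpD; congr cexp.
by rewrite expr0n/= mul0r addr0; ring.
Qed.

Lemma roti_kern s m A B (tau : R) t : 0 < t ->
  roti s m A B tau t = cexp (m * (s * tau%:C)) *
    ((A + B * (s * tau%:C)) * kern (cexp (s * tau%:C)) 0 m t +
     B * lnkern (cexp (s * tau%:C)) 0 m t).
Proof.
move=> t0; rewrite /roti kern0E// /lnkern /rotl.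
have tn : t%:C != 0 :> R[i] by rewrite eq_complex/= gt_eqF.
by rewrite fmorphV/=; field.
Qed.

Definition Gam z : R[i] := G 1 0 z.

Lemma Re_cexp z : Re (cexp z) = expR (Re z) * cos (Im z).
Proof. by rewrite /cexp ReM/= mul0r subr0. Qed.

Lemma Re1_gt0 : 0 < Re (1 : R[i]). Proof. exact: ltr01. Qed.

Lemma Re_cexp_gt0 s : `|Im s| < pi / 2 -> 0 < Re (cexp s).
Proof.
rewrite ltr_norml => h; rewrite /cexp ReM/= mul0r subr0 mulr_gt0 ?expR_gt0//.
exact: cos_gt0_pihalf.
Qed.

(** [rotation] without logarithm: the Gamma integral along the ray of argument
    [Im s] equals the one along the positive axis. *)
Lemma G0_rotation s m : `|Im s| < pi / 2 -> 0 < Re m ->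
  cexp (m * s) * G (cexp s) 0 m = Gam m.
Proof.
move=> sp m0.
have p0 := Re_cexp_gt0 sp.
have := rotation 1 0 sp m0.
have -> : cint (roti s m 1 0 1) = cexp (m * s) * G (cexp s) 0 m.
  rewrite /G -cintZ; last exact: Cint_kern0.
  by apply: cint_eq => t t0; rewrite roti_kern// mul0r addr0 mul1r mul0r addr0 mulr1.
move=> ->; apply: cint_eq => t t0.
by rewrite roti_kern// mul0r addr0 mul1r mul0r addr0 mulr0 mulr0 cexp0 mul1r.
Qed.

(** [rotation] with a logarithm: [ln t] picks up the argument [s] of the ray. *)
Lemma H0_rotation s : `|Im s| < pi / 2 ->
  cexp s * H (cexp s) 0 = H 1 0 - s * Gam 1.
Proof.
move=> sp; have p0 := Re_cexp_gt0 sp.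
have := rotation 0 1 sp Re1_gt0.
have -> : cint (roti s 1 0 1 1) = cexp s * (s * G (cexp s) 0 1 + H (cexp s) 0).
  have i1 : Cint (kern (cexp s) 0 1) by apply: Cint_kern0 => //; exact: Re1_gt0.
  have i2 : Cint (lnkern (cexp s) 0 1) by exact: Cint_lnkern0.
  rewrite /G /H -(cintZ _ i1) -cintD//; last exact: CintZ.
  rewrite -cintZ; last by apply: CintD => //; exact: CintZ.
  by apply: cint_eq => t t0; rewrite roti_kern// mulr1 !mul1r add0r.
have -> : cint (roti s 1 0 1 0) = H 1 0.
  apply: cint_eq => t t0.
  by rewrite roti_kern// mulr0 mulr0 cexp0 mul1r addr0 mul0r add0r mul1r.
have := G0_rotation sp Re1_gt0; rewrite mul1r => <- <-; ring.
Qed.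

(** ** The Gamma function *)

Lemma Gamma_intE z : Gamma_int z = Gam z.
Proof.
apply: cint_eq => t t0; rewrite /kern /cpowR expr0n/= mul0r addr0 mul1r.
by rewrite cexpD [RHS]mulrC; congr (_ * _); rewrite -rmorphN cexpR.
Qed.

Lemma Gam_rec z : 0 < Re z -> z * Gam z = Gam (z + 1).
Proof. by move=> z0; rewrite /Gam G0_rec ?mul1r//; exact: Re1_gt0. Qed.

Lemma rI0 : rI (fun=> 0 : R) = 0.
Proof. by have := rIZ 0 (@Rint0 R); rewrite !mul0r. Qed.

Definition gR x : R := rI (gam x 1).

Lemma kern1_real x t : kern 1 0 x%:C t = (gam x 1 t)%:C.
Proof.
rewrite /kern /gam /pw expr0n/= mul0r addr0 -expRD -cexpR; congr cexp.
by rewrite !mul1r rmorphD rmorphN rmorphM rmorphB.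
Qed.

Lemma Gam_real x : 0 < x -> Gam x%:C = (gR x)%:C.
Proof.
move=> x0; rewrite /Gam /G cintE -[RHS]/(gR x +i* 0); congr (_ +i* _).
  by apply: rI_eq => t _; rewrite kern1_real.
transitivity (rI (fun=> 0 : R)); first by apply: rI_eq => t _; rewrite kern1_real.
exact: rI0.
Qed.

Lemma gR_rec x : 0 < x -> gR (x + 1) = x * gR x.
Proof.
move=> x0; apply: (@complexI R); rewrite rmorphM/= -!Gam_real ?addr_gt0//.
by rewrite rmorphD/= -Gam_rec.
Qed.

Lemma gR1 : gR 1 = 1.
Proof.
suff : rI (gam 1 1) = 0 - (- 1) :> R by rewrite sub0r opprK.
apply: (@rI_FTC R (fun t => - expR (- t)) (gam 1 1) (-1) 0).
- move=> t t0; have -> : gam 1 1 t = - (- 1 * expR (- t)).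
    by rewrite /gam subrr pw0 mulr1 mul1r mulN1r opprK.
  rewrite (_ : (fun _ => _) = - (expR \o -%R))//.
  by apply: is_derive_eq; rewrite /GRing.scale/=; ring.
- by move=> t; exact: gam_cont.
- by apply: Rint_gam; rewrite ltr01.
- have -> : (- 1 : R) = - expR (- 0) by rewrite oppr0 expR0.
  apply: cvgN.
  apply: continuous_cvg; first exact: continuous_expR.
  by apply: cvgN; exact: cvg_harmonic.
- rewrite -oppr0; apply: cvgN.
  by rewrite (cvg_shiftS (fun n => expR (- n%:R))); exact: cvgn_expR.
Qed.

Lemma Gam1 : Gam 1 = 1 :> R[i].
Proof. by rewrite -[X in Gam X]/(1%:C) Gam_real// gR1. Qed.

Lemma gR_gt0 x : 0 < x -> 0 < gR x.
Proof.
move=> x0.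
have i : Rint (gam x 1) by exact: Rint_gam.
pose c := expR (- 2) * Num.min (pw (x - 1) 1) (pw (x - 1) 2).
have c0 : 0 < c by rewrite mulr_gt0 ?expR_gt0// lt_min !pw_gt0.
have lb t : 1 <= t <= 2 -> c <= gam x 1 t.
  move=> /andP[t1 t2]; have t0 : 0 < t by lra.
  rewrite /c /gam; apply: ler_pM; rewrite ?expR_ge0//.
  - by rewrite le_min !pw_ge0.
  - by rewrite ler_expR; lra.
  - rewrite ge_min; have [h|h] := lerP 0 (x - 1).
      by apply/orP; left; exact: ler_pw.
    apply/orP; right; rewrite -[x - 1]opprK !(pwN (- (x - 1))) lef_pV2 ?posrE ?pw_gt0//.
    by apply: ler_pw => //; lra.
have sub : `[1, 2] `<=` @Rpos R.
  by move=> t /=; rewrite in_itv/= => /andP[t1 _]; apply/RposP; lra.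
have m12 : measurable (`[1, 2]%classic : set R) by exact: measurable_itv.
have i2 : mu.-integrable (`[1, 2]%classic : set R) (EFin \o gam x 1).
  apply: integrableS (i) => //; exact: measurable_Rpos.
suff : c * 1 <= gR x by apply: lt_le_trans; rewrite mulr1.
have mu12 : fine (mu (`[1, 2]%classic : set R)) = 1.
  by rewrite lebesgue_measure_itv/= lte_fin ltr1n/=; lra.
rewrite -mu12 -(Rintegral_cst mu m12).
apply: (@le_trans _ _ (\int[mu]_(t in `[1, 2]%classic) gam x 1 t)).
  apply: le_Rintegral; [exact: m12| |exact: i2|].
  - apply: continuous_compact_integrable; first exact: segment_compact.
    by apply: continuous_subspaceT => ?; exact: cst_continuous.
  - by move=> t; rewrite /= in_itv/=; exact: lb.
rewrite -lee_fin (EFin_rI i) /Rintegral fineK; last exact: integrable_fin_num.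
apply: ge0_subset_integral => //; first exact: measurable_Rpos.
  by apply/measurable_EFinP; exact: Rint_meas.
by move=> t _; rewrite lee_fin gam_ge0.
Qed.

Lemma sqr_ln_le (u : R) : 0 < u -> ln u ^+ 2 <= 4 * (u + u^-1 - 2).
Proof.
move=> u0; pose v := ln u / 2.
have E : u = expR v * expR v by rewrite -expRD /v -[ln u / 2 + _]splitr lnK.
have key (w : R) : 0 <= w -> w <= expR w - expR (- w).
  move=> w0; have h1 := expR_ge1Dx w.
  have : expR (- w) <= 1 by rewrite -expR0 ler_expR oppr_le0.
  lra.
have h : v ^+ 2 <= (expR v - expR (- v)) ^+ 2.
  have [v0|v0] := lerP 0 v.
    by apply: lerXn2r; rewrite ?nnegrE ?(le_trans v0)// key.
  have := key (- v); rewrite oppr_ge0 (ltW v0) opprK => /(_ isT) k.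
  rewrite -(sqrrN v) -(sqrrN (_ - _)) opprB.
  by apply: lerXn2r; rewrite ?nnegrE ?oppr_ge0 ?(ltW v0)//; lra.
have -> : ln u ^+ 2 = 4 * v ^+ 2 by rewrite /v; field.
rewrite ler_wpM2l//; apply: le_trans h _.
rewrite E expRN le_eqVlt; apply/orP; left; apply/eqP.
by field; rewrite gt_eqF// expR_gt0.
Qed.

Lemma cos_ge_sqr y : 1 - y ^+ 2 / 2 <= cos y.
Proof.
wlog y0 : y / 0 <= y => [HH|].
  have [/HH//|y0] := lerP 0 y.
  by rewrite -cosN -sqrrN; apply: HH; rewrite oppr_ge0 ltW.
have D (x : R) : is_derive x 1 (fun x => x ^+ 2 / 2) x.
  rewrite (_ : (fun _ => _) = 2^-1 \*: ((@id R) ^+ 2)); last first.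
    by apply/funext => z; rewrite !fctE /GRing.scale/= mulrC.
  by apply: is_derive_eq; rewrite /GRing.scale/= expr1; field.
have := @increment_le R cos (fun x => x ^+ 2 / 2) (fun x => - sin x) id 0 y y0
  (fun x _ => is_derive_cos x) (fun x _ => D x).
rewrite cos0 expr0n/= mul0r subr0 => h.
have {h} : `|cos y - 1| <= y ^+ 2 / 2.
  by apply: h => x /andP[x0 _]; rewrite normrN -[leRHS]ger0_norm// abs_sin_le.
rewrite ler_norml => /andP[]; lra.
Qed.

(** Under the density [t^(N-1) exp (- t) / Gamma(N)] the variable [ln (t / N)]
    has mean square at most [4 / (N - 1)], so that [Gamma(N + i y) N^(- i y)]
    is close to [Gamma(N)] for [N] large; the functional equation then excludes
    zeros of [Gamma] everywhere. *)
Lemma Gam_neq0_large N y : 1 + 2 * y ^+ 2 < N -> Gam (N +i* y) != 0.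
Proof.
move=> hN; have y2 := sqr_ge0 y.
have N1 : 1 < N by lra.
have N0 : 0 < N by lra.
have mN : 0 < Re (N +i* y) by [].
have iz : Cint (kern 1 0 (N +i* y)) by apply: Cint_kern0 => //; exact: Re1_gt0.
pose w : R[i] := cexp (- (0 +i* (y * ln N))).
suff : 0 < Re (w * Gam (N +i* y)).
  by apply: contraTneq => ->; rewrite mulr0 ltxx.
rewrite /Gam /G -cintZ//.
rewrite (_ : Re (cint _) = rI (fun x => Re (w * kern 1 0 (N +i* y) x)))//.
have E t : 0 < t -> Re (w * kern 1 0 (N +i* y) t) =
    gam N 1 t * cos (y * (ln t - ln N)).
  move=> t0; rewrite /w /kern -cexpD Re_cexp.
  have -> : 0 ^+ 2 / t = 0 :> R by rewrite expr0n/= mul0r.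
  rewrite addr0 mul1r.
  rewrite !(ReD, ReN, ImD, ImN, ReM, ImM)/= /gam /pw -expRD.
  by congr (expR _ * cos _); ring.
have [iw _] := CintZ w iz.
pose h t := gam N 1 t + - (2 * y ^+ 2) * (N^-1 * gam (N + 1) 1 t + N * gam (N - 1) 1 t
  + - 2 * gam N 1 t).
have i0 : Rint (gam N 1) by exact: Rint_gam.
have i1 : Rint (gam (N + 1) 1) by apply: Rint_gam => //; lra.
have i2 : Rint (gam (N - 1) 1) by apply: Rint_gam => //; lra.
have i3 : Rint (fun t => N^-1 * gam (N + 1) 1 t + N * gam (N - 1) 1 t) by apply: RintD; exact: RintZ.
have i4 : Rint (fun t => N^-1 * gam (N + 1) 1 t + N * gam (N - 1) 1 t + - 2 * gam N 1 t).
  by apply: RintD => //; exact: RintZ.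
have ih : Rint h by apply: RintD => //; exact: RintZ.
apply: (@lt_le_trans _ _ (rI h)); last first.
  apply: rI_le => // t t0; rewrite E//.
  have := cos_ge_sqr (y * (ln t - ln N)).
  have u0 : 0 < t / N by rewrite divr_gt0.
  have := sqr_ln_le u0; rewrite ln_div ?posrE// => l1 l2.
  have -> : h t = gam N 1 t * (1 - 2 * y ^+ 2 * (t / N + (t / N)^-1 - 2)).
    rewrite /h -(pw_gam 1 N 1 t) -(pw_gam (-1) N 1 t) pw1// pwN1//.
    by field; rewrite !gt_eqF.
  rewrite ler_wpM2l ?gam_ge0//; apply: le_trans l2.
  rewrite exprMn; nra.
rewrite /h rID//; last exact: RintZ.
rewrite rIZ// rID//; last exact: RintZ.
rewrite rID; [|exact: RintZ|exact: RintZ].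
rewrite !rIZ// -!/(gR _) gR_rec//.
have e2 : gR N = (N - 1) * gR (N - 1) by rewrite -gR_rec ?subrK// subr_gt0.
have g0 : 0 < gR (N - 1) by apply: gR_gt0; lra.
rewrite mulrA mulVf ?gt_eqF// mul1r e2.
nra.
Qed.

(** [Gam_rec] moves [z] into the region of [Gam_neq0_large]. *)
Lemma Gam_neq0 z : 0 < Re z -> Gam z != 0.
Proof.
move=> z0; apply/negP => /eqP G0.
have H0 n : Gam (z + n%:R) = 0.
  elim: n => [|n IH]; first by rewrite addr0.
  by rewrite -natr1 addrA -Gam_rec ?IH ?mulr0// ReD ltr_wpDr// -(rmorph_nat (real_complex R)) /= ler0n.
pose n := (Num.truncn (1 + 2 * Im z ^+ 2)).+1.
have hn : 1 + 2 * Im z ^+ 2 < n%:R.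
  by apply: truncnS_gt; have := sqr_ge0 (Im z); lra.
have hz : 1 + 2 * Im z ^+ 2 < Re z + n%:R by lra.
have := Gam_neq0_large hz.
have -> : (Re z + n%:R) +i* Im z = z + n%:R.
  by apply: complexP; rewrite ?ReD ?ImD -(rmorph_nat (real_complex R))/= ?addr0.
by rewrite H0 eqxx.
Qed.

Lemma Gamma_strip m : m != 0 -> `|Re m| < 1 -> Gamma m = Gam (1 + m) / m.
Proof.
move=> m0; rewrite ltr_norml => /andP[m1 m2]; rewrite /Gamma.
case: ifPn => [mp|]; first by rewrite Gamma_intE addrC -Gam_rec// mulrC mulKf.
rewrite -leNgt => mn.
have -> : Num.truncn (- Re m) = 0%N.
  by apply/eqP; rewrite truncn_eq ?oppr_ge0//=; apply/andP; split; lra.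
by rewrite big_ord1 addr0 Gamma_intE addrC.
Qed.

(** ** Euler's constant *)

(** Euler's constant is reached through the sequence [lI n / n!], which satisfies
    the recursion of the harmonic numbers by [lI_rec] and differs from [ln n] by
    at most [1 / n] by [lI_bounds]. *)
Definition lI n : R := rI (fun t => ln t * gam n.+1%:R 1 t).

Lemma lnkern1_real x t : lnkern 1 0 x%:C t = (ln t * gam x 1 t)%:C.
Proof. by rewrite /lnkern kern1_real -rmorphM. Qed.

Lemma Rint_lngam x : 0 < x -> Rint (fun t => ln t * gam x 1 t).
Proof.
move=> x0; pose e := x / 2; have e0 : 0 < e by rewrite divr_gt0.
apply: (Rint_le (g := fun t => e^-1 * (gam (x + e) 1 t + gam (x + - e) 1 t))).
- apply: measurable_cont_Rpos => t t0; apply: continuousM; first exact: continuous_ln.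
  exact: gam_cont.
- move=> t t0; rewrite normrM (ger0_norm (gam_ge0 _ _ _)).
  rewrite -(pw_gam e x) -(pw_gam (- e) x) -mulrDl [leRHS]mulrA ler_wpM2r ?gam_ge0//.
  exact: abs_ln_le.
- by apply: RintZ; apply: RintD; apply: Rint_gam => //; rewrite /e; lra.
Qed.

Lemma gR_fact n : gR n.+1%:R = n`!%:R.
Proof.
elim: n => [|n IH]; first exact: gR1.
by rewrite -natr1 gR_rec// IH factS natrM.
Qed.

Lemma lI_rec n : lI n.+1 = n.+1%:R * lI n + n`!%:R.
Proof.
set x : R := n.+1%:R.
have x0 : 0 < x by [].
have i1 := Rint_lngam (addr_gt0 x0 (@ltr01 R)).
have i2 := Rint_lngam x0.
have i3 : Rint (gam x 1) by exact: Rint_gam.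
have e1 : lI n.+1 = rI (fun t => ln t * gam (x + 1) 1 t).
  by rewrite /lI -[n.+2%:R]natr1.
rewrite e1 /lI -/x -gR_fact -/x /gR.
have : rI (fun t => (x * (ln t * gam x 1 t) + gam x 1 t) - ln t * gam (x + 1) 1 t) = 0.
  have iF : Rint (fun t => (x * (ln t * gam x 1 t) + gam x 1 t) - ln t * gam (x + 1) 1 t).
    by apply: RintB => //; apply: RintD => //; exact: RintZ.
  pose f t : R[i] := (x * (ln t * gam x 1 t) + gam x 1 t - ln t * gam (x + 1) 1 t)%:C.
  have : cint f = 0.
    pose F t : R[i] := (ln t * gam (x + 1) 1 t)%:C.
    have D t : 0 < t -> is_derive t 1 (gam (x + 1) 1) (x * gam x 1 t - gam (x + 1) 1 t).
      move=> t0; have dp := is_derive_pw x t0.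
      have -> : gam (x + 1) 1 = (expR \o -%R) * pw x.
        by apply/funext => u; rewrite /gam addrK mul1r.
      apply: is_derive_eq.
      rewrite (_ : ((expR \o -%R) * pw x) t = expR (- t) * pw x t)//.
      by rewrite /GRing.scale/= /gam mul1r; ring.
    apply: (@cint_boundary0 R F f (x / 2) ((x / 2)^-1 * (cexpw x 1 + 1 + cexpw (2 * x) 1 + cexpw x 1))).
    - by rewrite divr_gt0.
    - move=> t t0; apply: cder_real.
      have d1 := is_derive1_ln t0; have d2 := D t t0.
      rewrite (_ : (fun _ => _) = @ln R * gam (x + 1) 1)//.
      apply: is_derive_eq; rewrite /GRing.scale/=.
      have -> : gam (x + 1) 1 t = t * gam x 1 t by rewrite -pw_gam pw1.
      by field; rewrite gt_eqF.
    - apply: ccont_real => t t0.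
      have cl := continuous_ln t0.
      apply: continuousB; last by apply: continuousM => //; exact: gam_cont.
      apply: continuousD; last exact: gam_cont.
      apply: continuousM; first exact: cst_continuous.
      by apply: continuousM => //; exact: gam_cont.
    - by split => //=; exact: Rint0.
    - move=> t t0; rewrite /F normcR normrM (ger0_norm (gam_ge0 _ _ _)).
      have x20 : 0 < x / 2 by rewrite divr_gt0.
      apply: le_trans (ler_wpM2r (gam_ge0 _ _ _) (abs_ln_le x20 t0)) _.
      rewrite -!mulrA ler_wpM2l ?invr_ge0 ?(ltW x20)// mulrDl !pw_gam.
      have h1 : gam (x + 1 + x / 2) 1 t <= cexpw x 1 * pw (x / 2) t.
        by apply: gam_le_any => //; field.
      have h2 : gam (x + 1 - x / 2) 1 t <= pw (x / 2) t.
        by rewrite (_ : x + 1 - x / 2 = x / 2 + 1); [exact: gam_le_pw|field].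
      have := pw_gt0 (x / 2) t; have := cexpw_gt0 x (1 : R); have := cexpw_gt0 (2 * x) (1 : R).
      nra.
    - move=> t t0; rewrite /F normcR normrM (ger0_norm (gam_ge0 _ _ _)).
      have x20 : 0 < x / 2 by rewrite divr_gt0.
      apply: le_trans (ler_wpM2r (gam_ge0 _ _ _) (abs_ln_le x20 t0)) _.
      rewrite -!mulrA ler_wpM2l ?invr_ge0 ?(ltW x20)// mulrDl !pw_gam.
      have h1 : gam (x + 1 + x / 2) 1 t <= cexpw (2 * x) 1 * pw (- (x / 2)) t.
        by apply: gam_le_any => //; [rewrite mulr_gt0|field].
      have h2 : gam (x + 1 - x / 2) 1 t <= cexpw x 1 * pw (- (x / 2)) t.
        by apply: gam_le_any => //; field.
      have := pw_gt0 (- (x / 2)) t; have := cexpw_gt0 x (1 : R); have := cexpw_gt0 (2 * x) (1 : R).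
      nra.
  by rewrite cintE => /(congr1 (@Re R)).
rewrite rIB//; last by apply: RintD => //; exact: RintZ.
rewrite rID//; last exact: RintZ.
by rewrite rIZ// => /eqP; rewrite subr_eq0 => /eqP.
Qed.

Lemma lI_sum n : lI n = n`!%:R * (lI 0 + \sum_(1 <= k < n.+1) (k%:R : R)^-1).
Proof.
elim: n => [|n IH]; first by rewrite big_geq// addr0 mul1r.
rewrite lI_rec IH [in RHS]big_nat_recr//= factS natrM.
by field; rewrite gt_eqF.
Qed.

(** The tangent lines [1 - n / t <= ln (t / n) <= t / n - 1] have mean [0] and
    [1 / n] under the density [t^n exp (- t) / n!]. *)
Lemma lI_bounds n : (0 < n)%N ->
  0 <= lI 0 + \sum_(1 <= k < n.+1) (k%:R : R)^-1 - ln (n%:R : R) <= n%:R^-1.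
Proof.
move=> n0.
have f0 : (0 : R) < n`!%:R by rewrite ltr0n fact_gt0.
suff : n`!%:R * ln (n%:R : R) <= lI n <= n`!%:R * (ln (n%:R : R) + n%:R^-1).
  rewrite lI_sum !ler_pM2l// => /andP[h1 h2]; apply/andP; split; lra.
have N0 : (0 : R) < n%:R by rewrite ltr0n.
have iL : Rint (fun t => ln t * gam n.+1%:R 1 t) by exact: Rint_lngam.
have i0 : Rint (gam (n.+1%:R : R) 1) by exact: Rint_gam.
have i1 : Rint (gam (n.+1%:R + 1 : R) 1) by apply: Rint_gam => //; rewrite addr_gt0.
have i2 : Rint (gam (n%:R : R) 1) by exact: Rint_gam.
have g2 : gR n%:R = n`!%:R / n%:R.
  by rewrite -gR_fact -natr1 gR_rec// mulrAC divff ?mul1r// gt_eqF.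
have pN t : 0 < t -> gam (n%:R : R) 1 t = t^-1 * gam n.+1%:R 1 t.
  by move=> t0; rewrite -pwN1//; apply/esym; apply: pw_gam_eq; rewrite -natr1; ring.
have pS t : 0 < t -> gam (n.+1%:R + 1 : R) 1 t = t * gam n.+1%:R 1 t.
  by move=> t0; rewrite -{2}(pw1 t0) pw_gam.
apply/andP; split.
  pose h t := (ln n%:R + 1) * gam n.+1%:R 1 t + (- n%:R) * gam (n%:R : R) 1 t.
  have ih : Rint h by apply: RintD; exact: RintZ.
  have -> : n`!%:R * ln n%:R = rI h.
    rewrite /h rID; [|exact: RintZ|exact: RintZ].
    rewrite !rIZ// -!/(gR _) g2 gR_fact.
    by field; rewrite gt_eqF.
  apply: rI_le => // t t0; rewrite /h pN// [X in _ + X <= _]mulrA -mulrDl ler_wpM2r ?gam_ge0//.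
  have u0 : 0 < n%:R / t by rewrite divr_gt0.
  have : ln (n%:R / t) <= n%:R / t - 1.
    have -> : n%:R / t = 1 + (n%:R / t - 1) :> R by ring.
    by rewrite [X in _ <= X]addrAC subrr add0r; apply: le_ln1Dx; rewrite ltrBrDl subrr.
  rewrite ln_div ?posrE//; lra.
pose h t := (ln n%:R - 1) * gam n.+1%:R 1 t + n%:R^-1 * gam (n.+1%:R + 1 : R) 1 t.
have ih : Rint h by apply: RintD; exact: RintZ.
have -> : n`!%:R * (ln n%:R + n%:R^-1) = rI h.
  rewrite /h rID; [|exact: RintZ|exact: RintZ].
  rewrite !rIZ// -!/(gR _) gR_rec// gR_fact -natr1.
  by field; rewrite gt_eqF.
apply: rI_le => // t t0; rewrite /h pS// [X in _ <= _ + X]mulrA -mulrDl ler_wpM2r ?gam_ge0//.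
have u0 : 0 < t / n%:R by rewrite divr_gt0.
have : ln (t / n%:R) <= t / n%:R - 1.
  have -> : t / n%:R = 1 + (t / n%:R - 1) :> R by ring.
  by rewrite [X in _ <= X]addrAC subrr add0r; apply: le_ln1Dx; rewrite ltrBrDl subrr.
rewrite ln_div ?posrE//; lra.
Qed.

Lemma euler_gammaE : euler_gamma = - lI 0 :> R.
Proof.
apply/cvg_lim => //.
rewrite -[X in _ --> X]add0r; apply/subr_cvg0.
apply: (squeeze_cvgr (f := fun=> 0 : R) (h := fun n : nat => (n%:R : R)^-1)).
- near=> n; have n0 : (0 < n)%N by near: n; exact: nbhs_infty_gt.
  have /andP[h1 h2] := lI_bounds n0.
  by apply/andP; split; rewrite add0r opprK; lra.
- exact: cvg_cst.
- apply/cvgrPdist_le => d d0; near=> n.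
  have n0 : (0 : R) < n%:R by rewrite ltr0n; near: n; exact: nbhs_infty_gt.
  rewrite sub0r normrN ger0_norm ?invr_ge0// -[leRHS]invrK lef_pV2 ?posrE ?invr_gt0//.
  by near: n; exact: nbhs_infty_ger.
Unshelve. all: by end_near. Qed.

Lemma H10 : H 1 0 = (- euler_gamma)%:C :> R[i].
Proof.
rewrite euler_gammaE opprK /H cintE; apply: complexP => /=.
  by apply: rI_eq => t _; exact: (congr1 (@Re R) (lnkern1_real 1 t)).
transitivity (rI (fun=> 0 : R)).
  by apply: rI_eq => t _; exact: (congr1 (@Im R) (lnkern1_real 1 t)).
exact: rI0.
Qed.

End GammaEuler.

(** * Smooth functions, cutoffs and test functions *)

Section Smoothness.
Context {R : realType}.
Implicit Types (f g : R -> R[i]) (U V : set R) (x a b : R).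

(** Smoothness through the total derivative [cderive] on an open set, which is
    stable under products, primitives and restriction; [smooth_csm] relates it to
    [smooth]. *)
Fixpoint smn U n f : Prop :=
  if n is n'.+1 then (forall x, U x -> cder f x (cderive f x)) /\ smn U n' (cderive f)
  else True.

Definition csm U f := forall n, smn U n f.

Lemma cder_near U f g x d : open U -> (forall y, U y -> f y = g y) -> U x ->
  cder f x d -> cder g x d.
Proof.
move=> oU fg Ux; apply: cder_ext.
by apply: filterS (open_nbhs_nbhs (conj oU Ux)) => y /fg.
Qed.

Lemma smn_ext U n f g : open U -> (forall x, U x -> f x = g x) ->
  smn U n f -> smn U n g.
Proof.
move=> oU; elim: n f g => [//|n IH f g fg [d s]].
have E x : U x -> cderive f x = cderive g x.
  by move=> Ux; apply/esym/cder_cderive/(cder_near oU fg Ux)/d.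
split; last by apply: IH s.
by move=> x Ux; rewrite -E//; apply: cder_near (oU) (fg) (Ux) (d x Ux).
Qed.

Lemma smn_intro U n f g : open U -> (forall x, U x -> cder f x (g x)) ->
  smn U n g -> smn U n.+1 f.
Proof.
move=> oU d s; have E x : U x -> g x = cderive f x by move=> /d /cder_cderive.
split; first by move=> x Ux; rewrite -E//; exact: d.
exact: smn_ext E s.
Qed.

Lemma smn_le U n f : smn U n.+1 f -> smn U n f.
Proof. by elim: n f => [//|n IH f [d s]]; split => //; exact: IH. Qed.

Lemma smn_cst U n (c : R[i]) : open U -> smn U n (fun=> c).
Proof.
move=> oU; elim: n c => [//|n IH c].
by apply: (@smn_intro _ _ _ (fun=> 0)) => // x _; exact: cder_cst.
Qed.

Lemma smnD U n f g : open U -> smn U n f -> smn U n g -> smn U n (fun x => f x + g x).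
Proof.
move=> oU; elim: n f g => [//|n IH f g [d s] [d' s']].
apply: (@smn_intro _ _ _ (fun x => cderive f x + cderive g x)) => //; last exact: IH.
by move=> x Ux; apply: cderD; [exact: d|exact: d'].
Qed.

Lemma smnM U n f g : open U -> smn U n f -> smn U n g -> smn U n (fun x => f x * g x).
Proof.
move=> oU; elim: n f g => [//|n IH f g sf sg]; have [d s] := sf; have [d' s'] := sg.
apply: (@smn_intro _ _ _ (fun x => cderive f x * g x + f x * cderive g x)) => //.
  by move=> x Ux; apply: cderM; [exact: d|exact: d'].
by apply: smnD => //; apply: IH => //; exact: smn_le.
Qed.

Lemma csm_cst U (c : R[i]) : open U -> csm U (fun=> c).
Proof. by move=> oU n; exact: smn_cst. Qed.

Lemma csmD U f g : open U -> csm U f -> csm U g -> csm U (fun x => f x + g x).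
Proof. by move=> oU sf sg n; exact: smnD. Qed.

Lemma csmM U f g : open U -> csm U f -> csm U g -> csm U (fun x => f x * g x).
Proof. by move=> oU sf sg n; exact: smnM. Qed.

Lemma csmZ U c f : open U -> csm U f -> csm U (fun x => c * f x).
Proof. by move=> oU; apply: csmM => //; exact: csm_cst. Qed.

Lemma csmB U f g : open U -> csm U f -> csm U g -> csm U (fun x => f x - g x).
Proof.
move=> oU sf sg n; apply: (@smn_ext _ _ (fun x => f x + -1 * g x)) => //.
  by move=> x _; rewrite mulN1r.
by apply: smnD => //; apply: smnM => //; exact: smn_cst.
Qed.

Lemma csm_ext U f g : open U -> (forall x, U x -> f x = g x) -> csm U f -> csm U g.
Proof. by move=> oU fg sf n; exact: smn_ext fg _. Qed.

Lemma csm_intro U f g : open U -> (forall x, U x -> cder f x (g x)) -> csm U g -> csm U f.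
Proof. by move=> oU d s n; apply: smn_le; exact: smn_intro d _. Qed.

Lemma csm_cderive U f : csm U f -> csm U (cderive f).
Proof. by move=> s n; have [] := s n.+1. Qed.

Lemma csm_cder U f x : csm U f -> U x -> cder f x (cderive f x).
Proof. by move=> s; have [d _] := s 1%N; exact: d. Qed.

Lemma csm_sub U V f : V `<=` U -> csm U f -> csm V f.
Proof.
move=> VU s n; elim: n f s => [//|n IH f s]; split; last exact: IH (csm_cderive s).
by move=> x /VU; exact: csm_cder.
Qed.

Lemma csm_union U V f : csm U f -> csm V f -> csm (U `|` V) f.
Proof.
move=> s s' n; elim: n f s s' => [//|n IH f s s'].
split; last by apply: IH; exact: csm_cderive.
by move=> x [Ux|Vx]; [exact: csm_cder s Ux|exact: csm_cder s' Vx].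
Qed.

Lemma csm_affine f a b : csm setT f -> csm setT (fun x => f (a * x + b)).
Proof.
move=> s n; elim: n f s => [//|n IH f s].
apply: (@smn_intro _ _ _ (fun x => cderive f (a * x + b) * a%:C)); first exact: openT.
  move=> x _; apply: cder_comp; last exact: csm_cder s I.
  rewrite (_ : (fun _ => _) = a \*: (@id R) + cst b)//.
  by apply: is_derive_eq; rewrite /GRing.scale/= mulr1 addr0.
apply: smnM; [exact: openT|exact: IH (csm_cderive s)|exact: smn_cst openT].
Qed.

Lemma smooth_csm f : smooth f <-> csm setT f.
Proof.
split.
  move=> s n; elim: n f s => [//|n IH f s]; split.
    by move=> x _; have [d1 d2] := s 0%N x; split;
      [apply: (DeriveDef d1)|apply: (DeriveDef d2)]; rewrite /= derive1E.
  apply: IH => k x; have [] := s k.+1 x; rewrite !derive1Sn => d1 d2; split.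
    exact: d1.
  exact: d2.
move=> s n; elim: n f s => [|n IH] f s x.
  have [[d1 _] [d2 _]] := csm_cder s (I : setT x).
  by split; [exact: d1|exact: d2].
by rewrite !derive1Sn; exact: IH (csm_cderive s) x.
Qed.

Lemma csm_ccont f : csm Rpos f -> ccont f.
Proof. by move=> s; apply: cder_ccont => x /RposP; exact: csm_cder s. Qed.

(** ** The elementary functions *)

Lemma csm_cpowR (z : R[i]) : csm Rpos (fun r => cpowR r z).
Proof.
move=> n; elim: n z => [//|n IH z].
apply: (@smn_intro _ _ _ (fun r => z * cpowR r (z - 1))); first exact: open_Rpos.
  by move=> x /Rpos_gt0; exact: cder_cpowR.
by apply: smnM; [exact: open_Rpos|exact: smn_cst open_Rpos|exact: IH].
Qed.

Lemma csm_id U : open U -> csm U (fun r => r%:C).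
Proof.
move=> oU; apply: (@csm_intro _ _ (fun=> 1)) => //; last exact: csm_cst.
by move=> x _; exact: cder_id.
Qed.

Lemma csm_ln : csm Rpos (fun r => (ln r)%:C).
Proof.
apply: (@csm_intro _ _ (fun r => cpowR r (-1))); first exact: open_Rpos.
  by move=> x /Rpos_gt0 x0; rewrite cpowRN1//; exact: cder_ln.
exact: csm_cpowR.
Qed.

Lemma csm_G p m : 0 < Re p -> csm Rpos (fun r => G p r m).
Proof.
move=> p0 n; elim: n m => [//|n IH m].
apply: (@smn_intro _ _ _ (fun r => (- 2 * p) * (r%:C * G p r (m - 1)))); first exact: open_Rpos.
  move=> x /Rpos_gt0 x0; apply: cder_eq (cder_G m p0 x0) _; ring.
apply: smnM; [exact: open_Rpos|exact: smn_cst open_Rpos|].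
by apply: smnM; [exact: open_Rpos|exact: csm_id open_Rpos n|exact: IH].
Qed.

Lemma csm_inv (D : R -> R) : (forall x, D x != 0) ->
  csm setT (fun x => (D x)%:C) -> csm setT (fun x => ((D x)^-1)%:C).
Proof.
move=> D0 s n; elim: n => [//|n IH].
apply: (@smn_intro _ _ _ (fun x => - (((D x)^-1)%:C * ((D x)^-1)%:C *
   cderive (fun x => (D x)%:C) x))); first exact: openT.
  move=> x _; have [d1 d2] := csm_cder s (I : setT x).
  have e2 : Im (cderive (fun x => (D x)%:C) x) = 0.
    by case: d2 => _ <- /=; rewrite derive_cst.
  move: d1 d2 e2; move: (cderive _ x) => q d1 d2 e2.
  have dV := @is_deriveV _ D x _ 1 (D0 x) d1.
  apply: cder_eq (cder_real dV) _; apply: complexP; rewrite ?ReN ?ImN ?ReM ?ImM/=.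
    by rewrite /GRing.scale/= !mulr0 !mul0r !subr0 addr0 mul0r subr0; field.
  by rewrite e2; ring.
have h := smnM openT (smnM openT IH IH) (csm_cderive s n).
have := smnM openT (smn_cst n (-1) openT) h.
by apply: smn_ext => [|x _]; [exact: openT|rewrite mulN1r].
Qed.

(** ** A smooth step *)

(** [x^(- k) exp (- 1 / x)] for [x > 0]: the class is closed under differentiation. *)
Definition flat (k : nat) x : R :=
  if 0 < x then pw (- k%:R) x * expR (- x^-1) else 0.

Lemma flat_ge0 k x : 0 <= flat k x.
Proof. by rewrite /flat; case: ifP => // _; exact: mulr_ge0 (pw_ge0 _ _) (expR_ge0 _). Qed.

Lemma flat_le k x : flat k x <= cexpw (k%:R + 2) 1 * x ^+ 2.
Proof.
rewrite /flat; case: ifPn => [x0|_]; last by rewrite mulr_ge0 ?sqr_ge0// ltW// cexpw_gt0.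
have k0 : (0 : R) < k%:R + 2 by rewrite ltr_wpDl.
have xV : 0 < x^-1 by rewrite invr_gt0.
have := exp_le_pw k0 (@ltr01 R) xV; rewrite mul1r pwV// opprK => h.
apply: le_trans (ler_wpM2l (pw_ge0 _ _) h) _.
rewrite mulrCA ler_wpM2l ?(ltW (cexpw_gt0 _ _))// -pwD -pw2//.
by rewrite addKr.
Qed.

Lemma is_derive_flat k x : is_derive x 1 (flat k) (- k%:R * flat k.+1 x + flat k.+2 x).
Proof.
have [x0|x0|->] := ltgtP x 0.
- have -> : - k%:R * flat k.+1 x + flat k.+2 x = 0.
    by rewrite /flat ltNge (ltW x0)/= mulr0 addr0.
  apply: near_eq_is_derive (is_derive_cst (0 : R) x 1).
  by near=> y; rewrite /flat ltNge ltW//=; near: y; exact: lt_nbhsl.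
- have nV := @is_deriveV _ id x 1 1 (lt0r_neq0 x0) (is_derive_id x 1).
  have dp := is_derive_pw (- k%:R) x0.
  apply: (near_eq_is_derive (f := pw (- k%:R) * (expR \o (fun y => - y^-1)))).
    apply: filterS (open_nbhs_nbhs (conj open_Rpos (_ : Rpos x))); last exact/RposP.
    by move=> y /Rpos_gt0 y0; rewrite /flat y0.
  have dN : is_derive x 1 (fun y : R => - y^-1) (x ^- 2).
    rewrite (_ : (fun _ => _) = - (fun y : R => y^-1))//.
    by apply: is_derive_eq; rewrite /GRing.scale/= mulr1 opprK.
  apply: is_derive_eq; rewrite /GRing.scale/= /flat x0.
  have -> : pw (- k.+1%:R) x = pw (- k%:R - 1) x by rewrite -natr1 opprD.
  have -> : pw (- k.+2%:R) x = pw (- k%:R) x * x ^- 2.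
    have -> : - k.+2%:R = - k%:R + - 2 :> R by rewrite -2!natr1; ring.
    by rewrite pwD (pwN 2) pw2.
  ring.
- have -> : - k%:R * flat k.+1 0 + flat k.+2 0 = 0 by rewrite /flat ltxx mulr0 addr0.
  apply/is_derive1_caratheodory.
  exists (fun z => flat k z / z); split.
  + move=> z; rewrite subr0 /flat ltxx subr0.
    have [->|z0] := eqVneq z 0; first by rewrite ltxx mulr0.
    by rewrite divfK.
  + suff h : (fun z => flat k z / z) @ 0 --> (0 : R).
      by rewrite /prop_for /continuous_at invr0 mulr0.
    pose C := cexpw (k%:R + 2) 1 : R.
    have C0 : 0 < C by exact: cexpw_gt0.
    apply/cvgrPdist_le => d d0; near=> z.
    rewrite sub0r normrN normrM normfV ger0_norm ?flat_ge0//.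
    have [->|z0] := eqVneq z 0; first by rewrite normr0 invr0 mulr0 ltW.
    rewrite ler_pdivrMr ?normr_gt0//; apply: le_trans (flat_le k z) _.
    rewrite -/C -real_normK ?num_real// expr2 mulrA ler_wpM2r//.
    rewrite mulrC -ler_pdivlMr//.
    near: z; exists (d / C) => /=; first exact: divr_gt0.
    by move=> z /=; rewrite sub0r normrN => /ltW.
  + by rewrite invr0 mulr0.
Unshelve. all: by end_near. Qed.

Lemma csm_flat k : csm setT (fun x => (flat k x)%:C).
Proof.
move=> n; elim: n k => [//|n IH k].
apply: (@smn_intro _ _ _ (fun x => (- k%:R)%:C * (flat k.+1 x)%:C + (flat k.+2 x)%:C)).
- exact: openT.
- move=> x _; apply: cder_eq (cder_real (is_derive_flat k x)) _.
  by rewrite rmorphD rmorphM.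
- apply: smnD; [exact: openT| |exact: IH].
  by apply: smnM; [exact: openT|exact: smn_cst openT|exact: IH].
Qed.

(** A smooth step from [0] for [x <= 1] to [1] for [x >= 2]; the scaled steps
    [stp (c r)] produce all cutoffs below. *)
Definition stp x : R := flat 0 (x - 1) / (flat 0 (x - 1) + flat 0 (2 - x)).

Lemma flat_gt0 k x : 0 < x -> 0 < flat k x.
Proof. by move=> x0; rewrite /flat x0; exact: mulr_gt0 (pw_gt0 _ _) (expR_gt0 _). Qed.

Lemma stp_den_gt0 x : 0 < flat 0 (x - 1) + flat 0 (2 - x).
Proof.
have [h|h] := ltrP 1 x.
  by rewrite ltr_pwDl ?flat_ge0// flat_gt0// subr_gt0.
by rewrite ltr_wpDl ?flat_ge0// flat_gt0//; lra.
Qed.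

Lemma stp0 x : x <= 1 -> stp x = 0.
Proof. by move=> x1; rewrite /stp {1}/flat ltNge subr_le0 x1 mul0r. Qed.

Lemma stp1 x : 2 <= x -> stp x = 1.
Proof.
move=> x2; have h := stp_den_gt0 x; rewrite /stp.
have e : flat 0 (2 - x) = 0 by rewrite /flat ltNge subr_le0 x2.
by move: h; rewrite e addr0 => h; rewrite divff// gt_eqF.
Qed.

Lemma stp_ge0 x : 0 <= stp x.
Proof. by rewrite divr_ge0 ?flat_ge0// ltW// stp_den_gt0. Qed.

Lemma stp_le1 x : stp x <= 1.
Proof. by rewrite ler_pdivrMr ?stp_den_gt0// mul1r lerDl flat_ge0. Qed.

Lemma csm_stp : csm setT (fun x => (stp x)%:C).
Proof.
have s1 : csm setT (fun x => (flat 0 (x - 1))%:C).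
  have := csm_affine 1 (-1) (csm_flat 0).
  by apply: csm_ext => [|x _]; [exact: openT|rewrite mul1r].
have s2 : csm setT (fun x => (flat 0 (2 - x))%:C).
  have := csm_affine (-1) 2 (csm_flat 0).
  by apply: csm_ext => [|x _]; [exact: openT|rewrite mulN1r addrC].
have s3 : csm setT (fun x => (flat 0 (x - 1) + flat 0 (2 - x))%:C).
  by apply: csm_ext (csmD openT s1 s2) => [|x _]; [exact: openT|rewrite rmorphD].
have s4 := csm_inv (fun x => lt0r_neq0 (stp_den_gt0 x)) s3.
by apply: csm_ext (csmM openT s1 s4) => [|x _]; [exact: openT|rewrite -rmorphM].
Qed.

Lemma ccont_bounded f a b : 0 < a -> ccont f ->
  exists2 K, 0 <= K & forall x, a <= x <= b -> normc (f x) <= K.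
Proof.
move=> a0 cf; have [ba|ab] := ltrP b a.
  by exists 0 => // x /andP[/le_trans h /h]; rewrite leNgt ba.
pose h x := Re (f x) * Re (f x) + Im (f x) * Im (f x).
have cc : {within `[a, b], continuous h}.
  apply: continuous_in_subspaceT => x; rewrite inE/= in_itv/= => /andP[ax _].
  have [c1 c2] := cf x (lt_le_trans a0 ax).
  apply: (@continuousD _ _ _ (fun x => Re (f x) * Re (f x)) (fun x => Im (f x) * Im (f x)));
    exact: continuousM.
have [c _ hc] := EVT_max ab cc.
exists (1 + (Re (f c) ^+ 2 + Im (f c) ^+ 2)); first by rewrite !addr_ge0 ?sqr_ge0.
move=> x xab; have := hc x; rewrite in_itv/= => /(_ xab).
rewrite /h -!expr2 -!sqr_normc_ReIm; have := normc_ge0 (f x); nra.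
Qed.

Lemma csmT_bounded f a b : csm setT f ->
  exists2 K, 0 <= K & forall x, a <= x <= b -> normc (f x) <= K.
Proof.
move=> s; have s' := csm_affine 1 (a - 1) s.
have [K K0 h] := @ccont_bounded (fun x => f (1 * x + (a - 1))) 1 (b - (a - 1)) ltr01
  (csm_ccont (csm_sub (@subsetT _ _) s')).
exists K => // x /andP[ax xb].
have := h (x - (a - 1)); rewrite mul1r subrK; apply.
by apply/andP; split; lra.
Qed.

Lemma cderive_cst_near U f (c : R[i]) x : open U -> U x ->
  (forall y, U y -> f y = c) -> cderive f x = 0.
Proof.
move=> oU Ux fc; apply: cder_cderive.
by apply: cder_near oU _ Ux (cder_cst c x) => y Uy; rewrite fc.
Qed.

Lemma stp_derivatives_bounded : exists2 C, 0 <= C & forall x,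
  normc (cderive (fun x => (stp x)%:C) x) <= C /\
  normc (cderive (cderive (fun x => (stp x)%:C)) x) <= C.
Proof.
have s := csm_stp.
have [K1 K10 h1] := csmT_bounded 1 2 (csm_cderive s).
have [K2 K20 h2] := csmT_bounded 1 2 (csm_cderive (csm_cderive s)).
have o1 : open [set x : R | x < 1] by exact: open_lt.
have o2 : open [set x : R | 2 < x] by exact: open_gt.
have z1 x : x < 1 -> cderive (fun x => (stp x)%:C) x = 0.
  by move=> x1; apply: (cderive_cst_near (c := 0) o1 x1) => y /= y1; rewrite stp0// ltW.
have z2 x : 2 < x -> cderive (fun x => (stp x)%:C) x = 0.
  by move=> x1; apply: (cderive_cst_near (c := 1) o2 x1) => y /= y1; rewrite stp1// ltW.
have n0 : normc (0 : R[i]) = 0 by apply/eqP; rewrite normc_eq0.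
exists (K1 + K2); first by rewrite addr_ge0.
move=> x; have [x1|x1] := ltrP x 1.
  rewrite z1// (cderive_cst_near (c := 0) o1 x1) => [|y]; last exact: z1.
  by rewrite n0 addr_ge0.
have [x2|x2] := ltrP 2 x.
  rewrite z2// (cderive_cst_near (c := 0) o2 x2) => [|y]; last exact: z2.
  by rewrite n0 addr_ge0.
have x12 : 1 <= x <= 2 by rewrite x1.
have := h1 x x12; have := h2 x x12; lra.
Qed.

(** ** Test functions on the half-line *)

Lemma Cc_Rpos_intro f a b : csm Rpos f -> 0 < a ->
  (forall x, x < a -> f x = 0) -> (forall x, b < x -> f x = 0) -> Cc_infty Rpos f.
Proof.
move=> s a0 fa fb.
have o : open [set x : R | x < a] by exact: open_lt.
have sT : csm setT f.
  have s0 : csm [set x : R | x < a] f.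
    by apply: csm_ext (csm_cst 0 o) => // x /fa.
  apply: csm_sub (csm_union s s0) => x _.
  by have [x0|x0] := ltrP 0 x; [left; exact/RposP|right; exact: le_lt_trans a0].
have sub : closure [set x | f x != 0] `<=` `[a, b].
  have e : `[a, b]%classic = closure `[a, b]%classic :> set R.
    by apply/closure_id; exact: interval_closed.
  rewrite e.
  apply: closureS => x /= fx; rewrite in_itv/=; apply/andP; split; rewrite leNgt.
    by apply: contra_neqN fx => /fa.
  by apply: contra_neqN fx => /fb.
split.
- exact/smooth_csm.
- by apply: subclosed_compact sub; [exact: closed_closure|exact: segment_compact].
- by move=> x /sub /=; rewrite in_itv/= => /andP[ax _]; apply/RposP; exact: lt_le_trans ax.
Qed.

Lemma Cc_Rpos_elim f : Cc_infty Rpos f ->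
  csm setT f /\ exists a b, [/\ 0 < a, a < b, forall x, x < a -> f x = 0 &
    forall x, b < x -> f x = 0].
Proof.
move=> [s c sub]; split; first exact/smooth_csm.
set S := [set x | f x != 0] in c sub *.
have bnd : exists M, forall x, S x -> `|x| <= M.
  have [M [_ h]] := compact_bounded c.
  by exists (M + 1) => x Sx; apply: h; [rewrite ltrDl|exact: subset_closure].
have bV : exists M, forall x, S x -> `|x^-1| <= M.
  have ci : compact ((fun x : R => x^-1) @` closure S).
    apply: continuous_compact => //; apply: continuous_in_subspaceT => x.
    rewrite inE => /sub /Rpos_gt0 x0.
    by apply: (@continuousV _ _ id); [rewrite gt_eqF|exact: id].
  have [M [_ h]] := compact_bounded ci.
  exists (M + 1) => x Sx; apply: (h (M + 1)); first by rewrite ltrDl.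
  by exists x => //; exact: subset_closure.
have [M1 h1] := bnd; have [M2 h2] := bV.
pose a := (1 + `|M2|)^-1; pose b := 1 + a + `|M1|.
have a0 : 0 < a by rewrite invr_gt0 ltr_pwDl.
exists a, b; split => //.
- by rewrite /b; have := normr_ge0 M1; lra.
- move=> x xa; apply/eqP; rewrite -[_ == _]negbK; apply/negP => Sx.
  have x0 : 0 < x by apply/Rpos_gt0/sub/subset_closure.
  have := h2 x Sx; rewrite ger0_norm ?invr_ge0 ?(ltW x0)//; apply/negP; rewrite -ltNge.
  apply: (@lt_trans _ _ (1 + `|M2|)); first by have := ler_norm M2; lra.
  by rewrite -[ltLHS]invrK ltf_pV2 ?posrE.
- move=> x bx; apply/eqP; rewrite -[_ == _]negbK; apply/negP => Sx.
  have := h1 x Sx; have := ler_norm x; have := ler_norm M1; move: bx; rewrite /b.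
  lra.
Qed.

End Smoothness.

(** * The operators: Green's identity and a criterion for the minimal domain *)

Section Operators.
Context {R : realType}.
Implicit Types (f g h u : R -> R[i]) (a b x r e K : R) (al lam : R[i]).
Local Notation mu := (@lebesgue_measure R).

Lemma normc0 : normc (0 : R[i]) = 0.
Proof. by apply/eqP; rewrite normc_eq0. Qed.

(** The differential expression [L_al] applied pointwise. *)
Definition Lp al h r : R[i] :=
  - cderive (cderive h) r + (al - 4^-1) * ((r ^+ 2)^-1)%:C * h r.

Lemma sqnormL2E f : Rint (fun r => normc (f r) ^+ 2) ->
  sqnormL2 f = (rI (fun r => normc (f r) ^+ 2))%:E.
Proof. by move=> i; rewrite (EFin_rI i). Qed.

Lemma L2P f : L2 f <-> cmeas f /\ Rint (fun r => normc (f r) ^+ 2).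
Proof.
split.
  move=> [m1 m2 fin]; split => //; apply/integrableP; split.
    apply/measurable_EFinP/measurable_funX; exact: cmeas_normc.
  apply: le_lt_trans fin; rewrite /sqnormL2 le_eqVlt; apply/orP; left; apply/eqP.
  by apply: eq_integral => r _; rewrite /= ger0_norm ?sqr_ge0.
move=> [[m1 m2] i]; split => //.
by rewrite (sqnormL2E i) ltry.
Qed.

Lemma L2_cmeas f : L2 f -> cmeas f. Proof. by move=> /L2P[]. Qed.

Lemma L2_Rint f : L2 f -> Rint (fun r => normc (f r) ^+ 2).
Proof. by move=> /L2P[]. Qed.

Lemma L2_intro f (q : R -> R) : cmeas f ->
  (forall r, 0 < r -> normc (f r) ^+ 2 <= q r) -> Rint q -> L2 f.
Proof.
move=> m fq iq; apply/L2P; split => //; apply: (Rint_le _ _ iq).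
  by apply: measurable_funX; exact: cmeas_normc.
by move=> r r0; rewrite ger0_norm ?sqr_ge0// fq.
Qed.

Lemma Cint_L2M f g : L2 f -> L2 g -> Cint (fun r => f r * g r).
Proof.
move=> /L2P[mf i] /L2P[mg j].
apply: (Cint_le (g := fun r => normc (f r) ^+ 2 + normc (g r) ^+ 2)).
- exact: cmeasM.
- move=> r _; rewrite normcM.
  have := normc_ge0 (f r); have := normc_ge0 (g r); nra.
- exact: RintD.
Qed.

Lemma L2Z c f : L2 f -> L2 (fun r => c * f r).
Proof.
move=> /L2P[mf i]; apply/L2P; split; first by apply: cmeasM => //; exact: cmeas_cst.
have := RintZ (normc c ^+ 2) i; apply: Rint_eq => r _.
by rewrite normcM exprMn.
Qed.

Lemma Rint_near0 (f : R -> R) e K b : 0 < e -> 0 < b -> 0 <= K ->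
  measurable_fun Rpos f ->
  (forall r, 0 < r -> r <= b -> `|f r| <= K * pw (e - 1) r) ->
  (forall r, b < r -> f r = 0) -> Rint f.
Proof.
move=> e0 b0 K0 mf h fb.
have P0 := pw_ge0 (2 * e) b.
apply: (@Rint_pw R f e (K * (1 + pw (2 * e) b)) e0 mf) => r r0;
  (have [rb|br] := lerP r b; last by rewrite fb// normr0 !mulr_ge0 ?pw_ge0 ?addr_ge0).
  apply: le_trans (h r r0 rb) _; rewrite ler_wpM2r ?pw_ge0// ler_peMr//.
  by rewrite lerDl.
apply: le_trans (h r r0 rb) _; rewrite -mulrA ler_wpM2l//.
have -> : e - 1 = 2 * e + (- e - 1) by ring.
rewrite (pwD (2 * e)) ler_wpM2r ?pw_ge0//.
apply: (@le_trans _ _ (pw (2 * e) b)); last by rewrite lerDr.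
by apply: ler_pw => //; rewrite mulr_ge0// ltW.
Qed.

Lemma L2_near0 f e K b : 0 < e -> 0 < b -> 0 <= K -> cmeas f ->
  (forall r, 0 < r -> r <= b -> normc (f r) <= K * pw (e - 2^-1) r) ->
  (forall r, b < r -> f r = 0) -> L2 f.
Proof.
move=> e0 b0 K0 mf h fb; apply/L2P; split => //.
apply: (@Rint_near0 _ (2 * e) (K ^+ 2) b); rewrite ?mulr_gt0 ?sqr_ge0//.
- by apply: measurable_funX; exact: cmeas_normc.
- move=> r r0 rb; rewrite ger0_norm ?sqr_ge0//.
  have -> : 2 * e - 1 = (e - 2^-1) + (e - 2^-1) by field.
  rewrite pwD -expr2 -exprMn; apply: lerXn2r; rewrite ?nnegrE ?normc_ge0//.
    by rewrite mulr_ge0 ?pw_ge0.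
  exact: h.
- move=> r br; by rewrite fb// normc0 expr0n.
Qed.

Lemma csm_Rpos_T f : csm setT f -> csm Rpos f.
Proof. exact: csm_sub (@subsetT _ _). Qed.

Lemma bounded_compact_L2 f a b : ccont f -> 0 < a -> a < b ->
  (forall x, x < a -> f x = 0) -> (forall x, b < x -> f x = 0) -> L2 f.
Proof.
move=> cf a0 ab fa fb.
have [K K0 h] := ccont_bounded b a0 cf.
apply: (@L2_near0 f 2^-1 K b); rewrite ?invr_gt0//.
- exact: lt_trans ab.
- exact: ccont_meas.
- move=> r r0 rb; rewrite subrr pw0 mulr1.
  have [ra|ar] := ltrP r a; last by apply: h; rewrite ar.
  by rewrite fa//; rewrite normc0.
Qed.

Lemma csm_V al : csm Rpos (fun r : R => (al - 4^-1) * ((r ^+ 2)^-1)%:C).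
Proof.
apply: csmZ; first exact: open_Rpos.
apply: csm_ext (csm_cpowR (- 2)) => [|x /Rpos_gt0 x0]; first exact: open_Rpos.
have -> : (- 2 : R[i]) = - 1 + - 1 by ring.
by rewrite cpowRD cpowRN1// -rmorphM -invfM expr2.
Qed.

Lemma csm_Lp al h : csm Rpos h -> csm Rpos (Lp al h).
Proof.
move=> s; apply: csmD; first exact: open_Rpos.
  have := csmZ (-1) open_Rpos (csm_cderive (csm_cderive s)).
  by apply: csm_ext => [|x _]; [exact: open_Rpos|rewrite mulN1r].
by apply: csmM; [exact: open_Rpos|exact: csm_V|].
Qed.

Lemma cderive_ext U f g x : open U -> U x -> (forall y, U y -> f y = g y) ->
  csm U f -> cderive f x = cderive g x.
Proof.
move=> oU Ux fg s; apply/esym/cder_cderive.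
exact: cder_near oU fg Ux (csm_cder s Ux).
Qed.

Lemma Lp_ext al U f g x : open U -> U x -> (forall y, U y -> f y = g y) ->
  csm U f -> Lp al f x = Lp al g x.
Proof.
move=> oU Ux fg s.
have E : cderive (cderive f) x = cderive (cderive g) x.
  apply: (cderive_ext oU Ux _ (csm_cderive s)) => y Uy.
  exact: (cderive_ext oU Uy fg s).
by rewrite /Lp E (fg x Ux).
Qed.

Lemma Lp_0 al U f x : open U -> U x -> (forall y, U y -> f y = 0) -> Lp al f x = 0.
Proof.
move=> oU Ux f0.
have d y : U y -> cderive f y = 0 by move=> Uy; exact: (cderive_cst_near oU Uy f0).
by rewrite /Lp (f0 x Ux) (cderive_cst_near oU Ux d) mulr0 addr0 oppr0.
Qed.

(** The Leibniz rule: cutting a function off costs the two commutator terms. *)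
Lemma Lp_mul al U f g x : open U -> U x -> csm U f -> csm U g ->
  Lp al (fun r => f r * g r) x =
  Lp al f x * g x - 2 * cderive f x * cderive g x - f x * cderive (cderive g) x.
Proof.
move=> oU Ux sf sg.
have d1 y : U y -> cder (fun r => f r * g r) y (cderive f y * g y + f y * cderive g y).
  by move=> Uy; apply: cderM; [exact: csm_cder Uy|exact: csm_cder Uy].
have sf' := csm_cderive sf; have sg' := csm_cderive sg.
have d2 := cderD (cderM (csm_cder sf' Ux) (csm_cder sg Ux))
  (cderM (csm_cder sf Ux) (csm_cder sg' Ux)).
have E : cderive (cderive (fun r => f r * g r)) x =
   cderive (cderive f) x * g x + cderive f x * cderive g x +
   (cderive f x * cderive g x + f x * cderive (cderive g) x).
  rewrite -(cder_cderive d2); apply/esym/(cderive_ext oU Ux).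
    by move=> y Uy; rewrite (cder_cderive (d1 y Uy)).
  by apply: (csmD oU); apply: (csmM oU).
rewrite /Lp E; move: (cderive (cderive f) x) (cderive f x) (f x)
  (cderive (cderive g) x) (cderive g x) (g x) (((x ^+ 2)^-1)%:C) => *; ring.
Qed.

Lemma cint_FTC_compact (F f : R -> R[i]) a b : 0 < a ->
  (forall x, 0 < x -> cder F x (f x)) -> ccont f -> Cint f ->
  (forall x, x < a -> F x = 0) -> (forall x, b < x -> F x = 0) -> cint f = 0.
Proof.
move=> a0 dF cf i Fa Fb; rewrite (@cint_FTC R F f 0 0)// ?subr0//.
  apply: (ccvg_norm0 (v := fun=> 0)); last exact: cvg_cst.
  near=> n; rewrite Fa ?subr0; first by rewrite normc0.
  rewrite invf_plt ?posrE//.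
  have : a^-1 <= n%:R by near: n; exact: nbhs_infty_ger.
  by move=> /le_lt_trans; apply; rewrite ltr_nat.
apply: (ccvg_norm0 (v := fun=> 0)); last exact: cvg_cst.
near=> n; rewrite Fb ?subr0; first by rewrite normc0.
have : b <= n%:R by near: n; exact: nbhs_infty_ger.
by move=> /le_lt_trans; apply; rewrite ltr_nat.
Unshelve. all: by end_near. Qed.

Section TestFunction.
Variables (phi : R -> R[i]) (a b : R).
Hypotheses (sphi : csm Rpos phi) (a0 : 0 < a) (ab : a < b).
Hypotheses (pa : forall x, x < a -> phi x = 0) (pb : forall x, b < x -> phi x = 0).

Lemma test_L2 : L2 phi.
Proof. exact: bounded_compact_L2 (csm_ccont sphi) a0 ab pa pb. Qed.

Let oa : open [set x : R | x < a]. Proof. exact: open_lt. Qed.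
Let ob : open [set x : R | b < x]. Proof. exact: open_gt. Qed.

Lemma test_cderive : (forall x, x < a -> cderive phi x = 0) /\
  (forall x, b < x -> cderive phi x = 0).
Proof.
split => x xa; [exact: (cderive_cst_near (c := 0) oa)|exact: (cderive_cst_near (c := 0) ob)].
Qed.

Lemma test_Lp al : (forall x, x < a -> Lp al phi x = 0) /\
  (forall x, b < x -> Lp al phi x = 0).
Proof. by split => x xa; [exact: Lp_0 oa _ _|exact: Lp_0 ob _ _]. Qed.

Lemma test_Lp_L2 al : L2 (Lp al phi).
Proof.
have [la lb] := test_Lp al.
exact: bounded_compact_L2 (csm_ccont (csm_Lp al sphi)) a0 ab la lb.
Qed.

(** The Wronskian [u phi' - u' phi] has compact support in the open half-line,
    so that no boundary term appears. *)
Lemma Green al u : csm Rpos u ->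
  cint (fun r => u r * Lp al phi r) = cint (fun r => Lp al u r * phi r).
Proof.
move=> su.
have [da db] := test_cderive; have [la lb] := test_Lp al.
have L2c h : ccont h -> (forall x, x < a -> h x = 0) -> (forall x, b < x -> h x = 0) -> Cint h.
  move=> ch ha hb.
  have i : L2 h by exact: bounded_compact_L2 ch a0 ab ha hb.
  have i1 : L2 (fun r => if (a <= r <= b) then (1 : R[i]) else 0).
    have m : cmeas (fun r => if (a <= r <= b) then (1 : R[i]) else 0).
      have mi : measurable_fun (@Rpos R) (\1_(`[a, b]%classic) : R -> R).
        by apply: measurable_indic; exact: measurable_itv.
      have E : (fun r => if (a <= r <= b) then (1 : R[i]) else 0) =
          (fun r => (\1_(`[a, b]%classic) r)%:C).
        apply/funext => r; rewrite indicE; case: ifPn => rab.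
          by rewrite mem_set//= in_itv.
        by rewrite memNset//= in_itv/=; exact/negP.
      by rewrite E; split => //=; exact: measurable_cst.
    apply: (@L2_near0 _ 2^-1 1 b); rewrite ?invr_gt0//.
    - exact: lt_trans ab.
    - move=> r r0 rb; rewrite subrr pw0 mulr1; case: ifP => _.
        by rewrite -[1]/(1%:C) normcR normr1.
      by rewrite normc0.
    - by move=> r br; rewrite leNgt [r <= b]leNgt br andbF.
  apply: Cint_eq (Cint_L2M i i1) => r r0.
  case: ifPn => [_|]; first by rewrite mulr1.
  by rewrite negb_and -!ltNge => /orP[ra|br]; [rewrite ha// mul0r|rewrite hb// mul0r].
have cu := csm_ccont su; have cp := csm_ccont sphi.
have clu := csm_ccont (csm_Lp al su); have clp := csm_ccont (csm_Lp al sphi).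
have i1 : Cint (fun r => u r * Lp al phi r).
  apply: L2c; first exact: ccontM.
    by move=> x xa; rewrite la// mulr0.
  by move=> x xa; rewrite lb// mulr0.
have i2 : Cint (fun r => Lp al u r * phi r).
  apply: L2c; first exact: ccontM.
    by move=> x xa; rewrite pa// mulr0.
  by move=> x xa; rewrite pb// mulr0.
apply/eqP; rewrite -subr_eq0 -cintB//; apply/eqP.
apply: (@cint_FTC_compact (fun r => cderive u r * phi r - u r * cderive phi r) _ a b a0).
- move=> x /RposP x0.
  have d := cderB (cderM (csm_cder (csm_cderive su) x0) (csm_cder sphi x0))
    (cderM (csm_cder su x0) (csm_cder (csm_cderive sphi) x0)).
  apply: cder_eq d _; rewrite /Lp.
  move: (cderive (cderive u) x) (cderive u x) (u x)
    (cderive (cderive phi) x) (cderive phi x) (phi x) (((x ^+ 2)^-1)%:C) => *; ring.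
- have := ccontD (ccontM cu clp) (ccontM (ccont_cst (-1)) (ccontM clu cp)).
  rewrite (_ : (fun _ => _) = (fun x => u x * Lp al phi x - Lp al u x * phi x))//.
  by apply/funext => x; rewrite mulN1r.
- exact: CintB.
- by move=> x xa; rewrite pa// da// !mulr0 subrr.
- by move=> x xa; rewrite pb// db// !mulr0 subrr.
Qed.

End TestFunction.

(** The distributional equation is tested against smooth functions by the
    pointwise expression [Lp]. *)
Lemma LopE al f phi : L2 f -> Cc_infty Rpos phi ->
  Lop al (distr_of_fun f) phi = cint (fun r => f r * Lp al phi r).
Proof.
move=> Lf /Cc_Rpos_elim[sT [a [b [a0 ab pa pb]]]].
have s := csm_Rpos_T sT.
have [da db] := test_cderive pa pb.
have [dda ddb] := test_cderive da db.
have i1 : L2 (cderive (cderive phi)).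
  exact: bounded_compact_L2 (csm_ccont (csm_cderive (csm_cderive s))) a0 ab dda ddb.
have i2 : L2 (fun r => (al - 4^-1) * ((r ^+ 2)^-1)%:C * phi r).
  apply: bounded_compact_L2 (csm_ccont _) a0 ab _ _.
  - by apply: csmM; [exact: open_Rpos|exact: csm_V|].
  - by move=> x xa; rewrite pa// mulr0.
  - by move=> x xa; rewrite pb// mulr0.
rewrite /Lop /distr_derive /distr_mul /distr_of_fun opprK -cintN; last exact: Cint_L2M.
rewrite -cintD; last exact: Cint_L2M.
  by apply: cint_eq => r _; rewrite /Lp mulrDr mulrN.
by have := CintZ (-1) (Cint_L2M Lf i1); apply: Cint_eq => r _; rewrite mulN1r.
Qed.

Lemma Lmax_smooth al u : csm Rpos u -> L2 u -> L2 (Lp al u) -> Lmax al u (Lp al u).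
Proof.
move=> su Lu Llu; split => // phi cc; rewrite LopE//.
have [sT [a [b [a0 ab pa pb]]]] := Cc_Rpos_elim cc.
by rewrite (Green (csm_Rpos_T sT) a0 ab pa pb al su).
Qed.

Lemma sqnormL2_cvg0 (fn : nat -> R -> R[i]) (q : R -> R) e :
  (forall n, cmeas (fn n)) ->
  (forall r, 0 < r -> \forall n \near \oo, fn n r = 0) ->
  (forall n r, 0 < r -> normc (fn n r) ^+ 2 <= q r) -> Rint q -> 0 < e ->
  \forall n \near \oo, (sqnormL2 (fn n) < e%:E)%E.
Proof.
move=> mf f0 fq iq e0.
have n0 := normc0.
have [||||i] := @rI_dct R (fun n r => normc (fn n r) ^+ 2) (fun=> 0) q.
- by move=> n; apply: measurable_funX; exact: cmeas_normc.
- move=> r r0; apply: (@cvg_near_cst _ R^o).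
  by apply: filterS (f0 r r0) => n ->; rewrite n0 expr0n.
- exact: iq.
- by move=> n r r0; rewrite ger0_norm ?sqr_ge0// fq.
rewrite rI0 => /cvgrPdist_lt /(_ e e0); apply: filterS => n.
rewrite sub0r normrN => h.
have in_ : Rint (fun r => normc (fn n r) ^+ 2).
  by apply: L2_Rint; exact: L2_intro (mf n) (fq n) iq.
by rewrite (sqnormL2E in_) lte_fin; apply: le_lt_trans h; exact: ler_norm.
Qed.

Lemma csm_scale (c : R) : csm setT (fun r => (stp (c * r))%:C).
Proof.
by have := csm_affine c 0 (@csm_stp R); apply: csm_ext => [|x _]; [exact: openT|rewrite addr0].
Qed.

Lemma cderive_affine f c x : csm setT f ->
  cderive (fun r => f (c * r)) x = c%:C * cderive f (c * x).
Proof.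
move=> s; apply: cder_cderive; rewrite mulrC; apply: cder_comp; last exact: csm_cder s I.
have dc : is_derive x 1 (c \*: (@id R)) c.
  by apply: is_derive_eq; rewrite /GRing.scale/= mulr1.
exact: dc.
Qed.

(** The derivatives of [stp (c r)] live on [1 <= c r <= 2], where [c] is
    comparable to [1 / r]. *)
Lemma stp_scale_bounds : exists2 C : R, 0 <= C & forall c x, 0 < c -> 0 < x ->
  normc (cderive (fun r => (stp (c * r))%:C) x) <= C / x /\
  normc (cderive (cderive (fun r => (stp (c * r))%:C)) x) <= C / x ^+ 2.
Proof.
have [C C0 h] := @stp_derivatives_bounded R.
exists (4 * C); first by rewrite mulr_ge0.
move=> c x c0 x0.
have n0 := normc0.
have s := @csm_stp R.
have cx0 : 0 < c * x by rewrite mulr_gt0.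
have E1 y : cderive (fun r => (stp (c * r))%:C) y = c%:C * cderive (fun r => (stp r)%:C) (c * y).
  exact: (cderive_affine c y s).
have E2 : cderive (cderive (fun r => (stp (c * r))%:C)) x =
    c%:C * (c%:C * cderive (cderive (fun r => (stp r)%:C)) (c * x)).
  rewrite -(cderive_affine c x (csm_cderive s)).
  have -> : cderive (fun r => (stp (c * r))%:C) =
     (fun y => c%:C * cderive (fun r => (stp r)%:C) (c * y)) by apply/funext.
  apply: cder_cderive; apply: cderZ.
  apply: csm_cder (I : setT x).
  have := csm_affine c 0 (csm_cderive s).
  by apply: csm_ext => [|y _]; [exact: openT|rewrite addr0].
rewrite E1 E2 !normcM normcR (gtr0_norm c0).
have [c2|c2] := ltrP 2 (c * x).
  have o2 : open [set y : R | 2 < y] by exact: open_gt.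
  have z y : 2 < y -> cderive (fun r => (stp r)%:C) y = 0 :> R[i].
    by move=> y2; apply: (cderive_cst_near (c := 1) o2 y2) => v /= v2; rewrite stp1// ltW.
  rewrite z// (cderive_cst_near (c := 0) o2 c2) => [|v]; last exact: z.
  by rewrite n0 !mulr0 !divr_ge0 ?mulr_ge0// ?sqr_ge0// ltW.
have [h1 h2] := h (c * x).
have cx : c <= 2 / x by rewrite ler_pdivlMr.
split.
  apply: le_trans (ler_pM (ltW c0) (normc_ge0 _) cx h1) _.
  by rewrite mulrAC ler_wpM2r ?invr_ge0 ?(ltW x0)//; lra.
rewrite mulrA.
have cc : c * c <= (2 / x) * (2 / x) by apply: ler_pM => //; exact: ltW.
apply: le_trans (ler_pM (mulr_ge0 (ltW c0) (ltW c0)) (normc_ge0 _) cc h2) _.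
by rewrite le_eqVlt; apply/orP; left; apply/eqP; field; rewrite gt_eqF.
Qed.

End Operators.

Section MinimalDomain.
Context {R : realType}.
Implicit Types (f g h u : R -> R[i]) (a b x r e K : R) (al lam : R[i]).
Local Notation mu := (@lebesgue_measure R).

(** A function of size [r^(3/2 + eta)] at [0], with matching derivatives, is a
    limit in graph norm of its truncations near [0]. *)
Lemma Lmin_intro al g eta K b : csm Rpos g -> 0 < eta -> 0 < b -> 0 <= K ->
  (forall r, b < r -> g r = 0) ->
  (forall r, 0 < r -> r <= b -> [/\ normc (g r) <= K * pw (3 / 2 + eta) r,
     normc (cderive g r) <= K * pw (2^-1 + eta) r &
     normc (Lp al g r) <= K * pw (eta - 2^-1) r]) ->
  Lmin al g (Lp al g).
Proof.
move=> sg eta0 b0 K0 gb bd.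
have n0 := @normc0 R.
have ob : open [set x : R | b < x] by exact: open_gt.
have [C C0 hC] := @stp_scale_bounds R.
have Lb r : b < r -> Lp al g r = 0 by move=> br; exact: Lp_0 ob br gb.
have Lg : L2 g.
  apply: (@L2_near0 R g (2 + eta) K b) => //; first by rewrite addr_gt0.
    exact: ccont_meas (csm_ccont sg).
  move=> r r0 rb; have [h _ _] := bd r r0 rb.
  by rewrite (_ : 2 + eta - 2^-1 = 3 / 2 + eta)//; field.
have LLg : L2 (Lp al g).
  apply: (@L2_near0 R _ eta K b) => //.
    exact: ccont_meas (csm_ccont (csm_Lp al sg)).
  by move=> r r0 rb; have [_ _ h] := bd r r0 rb.
split => // e e0.
pose chi (n : nat) r : R[i] := (stp (n.+1%:R * r))%:C.
pose phi n r := g r * chi n r.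
have schi n : csm Rpos (chi n) by apply: csm_Rpos_T; exact: csm_scale.
have sphi n : csm Rpos (phi n) by apply: csmM; [exact: open_Rpos| |].
have pa n r : r < n.+1%:R^-1 -> phi n r = 0.
  move=> ra; rewrite /phi /chi stp0 ?mulr0//.
  by rewrite mulrC -ler_pdivlMr// div1r ltW.
have pb n r : b < r -> phi n r = 0 by move=> br; rewrite /phi gb// mul0r.
have near1 r : 0 < r -> \forall n \near \oo, (2 < n.+1%:R * r).
  move=> r0; near=> n; rewrite mulrC -ltr_pdivrMl// mulrC.
  have : 2 / r <= n%:R by near: n; exact: nbhs_infty_ger.
  by move=> /le_lt_trans; apply; rewrite ltr_nat.
have E n r : 0 < r -> 2 < n.+1%:R * r -> phi n r = g r /\ Lp al (phi n) r = Lp al g r.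
  move=> r0 h; split; first by rewrite /phi /chi stp1 ?mulr1// ltW.
  have o : open (Rpos `&` [set x : R | 2 < n.+1%:R * x]).
    apply: openI; first exact: open_Rpos.
    rewrite (_ : [set x : R | _] = [set x | 2 / n.+1%:R < x]); first exact: open_gt.
    by apply/seteqP; split => x; rewrite /= ltr_pdivrMr ?ltr0n// mulrC.
  apply: (Lp_ext al o) => //; first by split => //; exact/RposP.
    by move=> y [_ /= hy]; rewrite /phi /chi stp1 ?mulr1// ltW.
  by apply: csm_sub (sphi n) => y [].
have chi1 n r : normc (1 - chi n r) <= 1.
  rewrite /chi -[1]/(1%:C) -rmorphB normcR ger0_norm ?subr_ge0 ?stp_le1//.
  by rewrite lerBlDr lerDl stp_ge0.
have c1 : \forall n \near \oo, (sqnormL2 (fun r => (g r - phi n r)%R) < e%:E)%E.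
  apply: (@sqnormL2_cvg0 R _ (fun r => normc (g r) ^+ 2) e) => //.
  - move=> n; apply: cmeasB; first exact: L2_cmeas.
    exact: ccont_meas (csm_ccont (sphi n)).
  - by move=> r r0; apply: filterS (near1 r r0) => n h; have [-> _] := E n r r0 h; rewrite subrr.
  - move=> n r r0; apply: lerXn2r; rewrite ?nnegrE ?normc_ge0//.
    by rewrite /phi -{1}[g r]mulr1 -mulrBr normcM ler_piMr ?normc_ge0.
  - exact: L2_Rint.
pose K' := K + 2 * K * C + K * C.
have K'0 : 0 <= K' by rewrite !addr_ge0 ?mulr_ge0.
pose q0 r := (K' * pw (eta - 2^-1) r) ^+ 2.
pose q := q0 \_ `]-oo, b]%classic.
have qle r : r <= b -> q r = q0 r.
  by move=> rb; rewrite /q patchE mem_set//= in_itv.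
have qgt r : b < r -> q r = 0.
  by move=> br; rewrite /q patchE memNset//= in_itv/= leNgt br.
have iq : Rint q.
  apply: (@Rint_near0 R q (2 * eta) (K' ^+ 2) b); rewrite ?mulr_gt0 ?sqr_ge0//.
  - have m1 : measurable_fun (@Rpos R) (fun r => (K' * pw (eta - 2^-1) r) ^+ 2).
      apply: measurable_funX; apply: measurable_funM => //.
      by apply: measurable_cont_Rpos => t; exact: pw_cont.
    apply/measurable_restrict => //; first exact: measurable_itv.
    by apply: (measurable_funS measurable_Rpos _ m1) => x [].
  - move=> r r0 rb; rewrite (qle _ rb) ger0_norm ?sqr_ge0//.
    rewrite /q0 exprMn ler_wpM2l ?sqr_ge0//.
    have -> : 2 * eta - 1 = (eta - 2^-1) + (eta - 2^-1) by field.
    by rewrite (pwD (eta - 2^-1)) expr2.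
have c2 : \forall n \near \oo, (sqnormL2 (fun r => (Lp al g r - Lp al (phi n) r)%R) < e%:E)%E.
  apply: (@sqnormL2_cvg0 R _ q e) => //.
  - move=> n; apply: cmeasB; first exact: L2_cmeas.
    exact: ccont_meas (csm_ccont (csm_Lp al (sphi n))).
  - by move=> r r0; apply: filterS (near1 r r0) => n h; have [_ ->] := E n r r0 h; rewrite subrr.
  - move=> n r r0; have [rb|br] := lerP r b; last first.
      rewrite (qgt _ br) Lb// (Lp_0 al ob br); last by move=> y; exact: pb.
      by rewrite subrr n0 expr0n.
    rewrite (qle _ rb) /q0; apply: lerXn2r; rewrite ?nnegrE ?normc_ge0 ?mulr_ge0 ?pw_ge0//.
    rewrite (Lp_mul al open_Rpos ((RposP r).2 r0) sg (schi n)).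
    have [b1 b2 b3] := bd r r0 rb.
    have [d1 d2] := hC n.+1%:R r (ltr0Sn _ _) r0.
    have -> : Lp al g r - (Lp al g r * chi n r - 2 * cderive g r * cderive (chi n) r -
        g r * cderive (cderive (chi n)) r) =
       Lp al g r * (1 - chi n r) + (2 * cderive g r * cderive (chi n) r +
        g r * cderive (cderive (chi n)) r) by ring.
    apply: le_trans (normcD _ _) _.
    have e1 : pw (2^-1 + eta) r / r = pw (eta - 2^-1) r.
      by rewrite -pwN1// -pwD (_ : 2^-1 + eta + -1 = eta - 2^-1)//; field.
    have e2 : pw (3 / 2 + eta) r / r ^+ 2 = pw (eta - 2^-1) r.
      by rewrite -pw2// -pwN -pwD (_ : 3 / 2 + eta + - 2 = eta - 2^-1)//; field.
    have t1 : normc (Lp al g r * (1 - chi n r)) <= K * pw (eta - 2^-1) r.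
      by rewrite normcM -[leRHS]mulr1; apply: ler_pM; rewrite ?normc_ge0.
    have t2 : normc (2 * cderive g r * cderive (chi n) r) <= 2 * K * C * pw (eta - 2^-1) r.
      rewrite !normcM (_ : (2 : R[i]) = 2%:C); last by rewrite rmorph_nat.
      rewrite normcR ger0_norm// -mulrA -e1.
      apply: le_trans (ler_wpM2l (ler0n R 2) (ler_pM (normc_ge0 _) (normc_ge0 _) b2 d1)) _.
      by rewrite le_eqVlt; apply/orP; left; apply/eqP; ring.
    have t3 : normc (g r * cderive (cderive (chi n)) r) <= K * C * pw (eta - 2^-1) r.
      rewrite normcM -e2.
      apply: le_trans (ler_pM (normc_ge0 _) (normc_ge0 _) b1 d2) _.
      by rewrite le_eqVlt; apply/orP; left; apply/eqP; ring.
    have := normcD (2 * cderive g r * cderive (chi n) r) (g r * cderive (cderive (chi n)) r).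
    have -> : K' * pw (eta - 2^-1) r = K * pw (eta - 2^-1) r +
      2 * K * C * pw (eta - 2^-1) r + K * C * pw (eta - 2^-1) r by rewrite /K'; ring.
    move=> t23; rewrite -addrA; apply: lerD t1 _.
    by apply: le_trans t23 _; exact: lerD.
have [n [h1 h2]] : exists n, (sqnormL2 (fun r => (g r - phi n r)%R) < e%:E)%E /\
    (sqnormL2 (fun r => (Lp al g r - Lp al (phi n) r)%R) < e%:E)%E.
  have [N _ hN] := filterI c1 c2.
  by exists N; apply: hN => /=.
have p0 : (0 : R) < n.+1%:R^-1 by rewrite invr_gt0.
pose b' := b + n.+1%:R^-1.
have pb' r : b' < r -> phi n r = 0.
  by move=> br; apply: pb; apply: lt_trans br; rewrite ltrDl.
have ab : n.+1%:R^-1 < b' by rewrite ltrDr.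
exists (phi n), (Lp al (phi n)); split; [|exact: h1|exact: h2]; split; last first.
  exact: Cc_Rpos_intro (sphi n) p0 (pa n) pb'.
apply: (Lmax_smooth (sphi n)).
  exact: test_L2 (sphi n) p0 ab (pa n) pb'.
exact: test_Lp_L2 (sphi n) p0 ab (pa n) pb' al.
Unshelve. all: by end_near. Qed.

Definition zeta0 r : R[i] := (1 - (stp r)%:C) * (1 - (stp (- 1 * r))%:C).

Lemma csm_zeta0 : csm setT zeta0.
Proof.
apply: csmM; first exact: openT.
  by apply: csmB; [exact: openT|exact: csm_cst openT|exact: csm_stp].
by apply: csmB; [exact: openT|exact: csm_cst openT|exact: csm_scale].
Qed.

Lemma zeta0_Cc : Cc_infty setT zeta0.
Proof.
split; [exact/smooth_csm/csm_zeta0| |by []].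
have e : `[(-2 : R), 2]%classic = closure `[(-2 : R), 2]%classic :> set R.
  by apply/closure_id; exact: interval_closed.
apply: (subclosed_compact (B := `[(-2 : R), 2]%classic)).
- exact: closed_closure.
- exact: segment_compact.
- rewrite e; apply: closureS => x /= fx; rewrite in_itv/=; apply/andP; split; rewrite leNgt.
    apply: contra_neqN fx => h; rewrite /zeta0 [stp (-1 * x)]stp1 ?subrr ?mulr0//.
    by rewrite mulN1r; lra.
  by apply: contra_neqN fx => h; rewrite /zeta0 [stp x]stp1 ?subrr ?mul0r// ltW.
Qed.

(** [Lmin_intro] applied to [g] times the cutoff [zeta0], which equals [1] near [0]. *)
Lemma around0_intro al g eta K : csm Rpos g -> 0 < eta -> 0 <= K ->
  (forall r, 0 < r -> r <= 2 -> [/\ normc (g r) <= K * pw (3 / 2 + eta) r,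
     normc (cderive g r) <= K * pw (2^-1 + eta) r &
     normc (Lp al g r) <= K * pw (eta - 2^-1) r]) ->
  around0 (dom (Lmin al)) g.
Proof.
move=> sg eta0 K0 bd; exists zeta0; split; first exact: zeta0_Cc.
  exists 1 => // r /andP[r0 r1].
  rewrite /zeta0 [stp r]stp0 ?[stp (-1 * r)]stp0 ?subr0 ?mulr1//; last exact: ltW.
  by rewrite mulN1r; lra.
have sz := csm_Rpos_T csm_zeta0.
exists (Lp al (fun r => g r * zeta0 r)).
have [Z Z0 hZ] := csmT_bounded 0 2 csm_zeta0.
have [Z1 Z10 hZ1] := csmT_bounded 0 2 (csm_cderive csm_zeta0).
have [Z2 Z20 hZ2] := csmT_bounded 0 2 (csm_cderive (csm_cderive csm_zeta0)).
pose K' := K * (Z + 4 * Z1 + 4 * Z2).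
apply: (@Lmin_intro _ _ eta K' 2) => //.
- by apply: csmM => //; exact: open_Rpos.
- by rewrite mulr_ge0// !addr_ge0 ?mulr_ge0.
- move=> r r2; rewrite /zeta0 [stp r]stp1 ?subrr ?mul0r ?mulr0//; exact: ltW.
- move=> r r0 r2; have [b1 b2 b3] := bd r r0 r2.
  have r02 : 0 <= r <= 2 by rewrite (ltW r0).
  have Ur := (RposP r).2 r0.
  have h0 := hZ r r02; have h1 := hZ1 r r02; have h2 := hZ2 r r02.
  have e1 : pw (2^-1 + eta) r = r * pw (eta - 2^-1) r.
    by rewrite -{2}(pw1 r0) -pwD (_ : 1 + (eta - 2^-1) = 2^-1 + eta)//; field.
  have e2 : pw (3 / 2 + eta) r = r * pw (2^-1 + eta) r.
    by rewrite -{2}(pw1 r0) -pwD (_ : 1 + (2^-1 + eta) = 3 / 2 + eta)//; field.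
  have P0 := pw_ge0 (eta - 2^-1) r.
  have P1 := pw_ge0 (2^-1 + eta) r.
  have P2 := pw_ge0 (3 / 2 + eta) r.
  have l1 : pw (2^-1 + eta) r <= 2 * pw (eta - 2^-1) r by rewrite e1 ler_wpM2r.
  have l2 : pw (3 / 2 + eta) r <= 2 * pw (2^-1 + eta) r by rewrite e2 ler_wpM2r.
  have N0 := normc_ge0 (g r); have N1 := normc_ge0 (cderive g r).
  have m00 := ler_pM (normc_ge0 _) (normc_ge0 _) b1 h0.
  have m01 := ler_pM (normc_ge0 _) (normc_ge0 _) b1 h1.
  have m02 := ler_pM (normc_ge0 _) (normc_ge0 _) b1 h2.
  have m10 := ler_pM (normc_ge0 _) (normc_ge0 _) b2 h0.
  have m11 := ler_pM (normc_ge0 _) (normc_ge0 _) b2 h1.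
  have m20 := ler_pM (normc_ge0 _) (normc_ge0 _) b3 h0.
  have q1 : K * Z1 * pw (3 / 2 + eta) r <= K * Z1 * (2 * pw (2^-1 + eta) r) by rewrite ler_wpM2l ?mulr_ge0.
  have q2 : K * Z2 * pw (3 / 2 + eta) r <= K * Z2 * (2 * (2 * pw (eta - 2^-1) r)).
    by rewrite ler_wpM2l ?mulr_ge0//; lra.
  have q3 : K * Z1 * pw (2^-1 + eta) r <= K * Z1 * (2 * pw (eta - 2^-1) r) by rewrite ler_wpM2l ?mulr_ge0.
  have z (A B P : R) : 0 <= A -> 0 <= B -> 0 <= P -> 0 <= A * B * P by move=> *; rewrite !mulr_ge0.
  have w1 := z _ _ _ K0 Z10 P0; have w2 := z _ _ _ K0 Z20 P0.
  have w3 := z _ _ _ K0 Z10 P1; have w4 := z _ _ _ K0 Z20 P1.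
  have w5 := z _ _ _ K0 Z10 P2; have w6 := z _ _ _ K0 Z20 P2.
  split.
  + rewrite (normcM (g r)) /K'; lra.
  + rewrite (cder_cderive (cderM (csm_cder sg Ur) (csm_cder sz Ur))).
    apply: le_trans (normcD _ _) _; rewrite (normcM (cderive g r)) (normcM (g r)) /K'; lra.
  + rewrite (Lp_mul al open_Rpos Ur sg sz).
    apply: le_trans (normcB _ _) _.
    have := normcB (Lp al g r * zeta0 r) (2 * cderive g r * cderive zeta0 r).
    rewrite (normcM (Lp al g r)) (normcM (2 * cderive g r)) (normcM 2) (normcM (g r)).
    rewrite (_ : (2 : R[i]) = 2%:C); last by rewrite rmorph_nat.
    rewrite normcR ger0_norm// /K'; lra.
Qed.

End MinimalDomain.

(** * The decaying solution [r^(1/2 - m) G_m(r)] *)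

Section ContinuousZero.
Context {R : realType}.
Local Notation mu := (@lebesgue_measure R).

(** A continuous function that is nonzero at a point is nonzero on an interval,
    which has positive measure. *)
Lemma ccont_zeroL2 (f : R -> R[i]) : ccont f -> zeroL2 f -> forall r, 0 < r -> f r = 0.
Proof.
move=> cf [N [mN N0 sub]] r r0.
have key (h : R -> R) : {for r, continuous h} ->
    (forall x, f x = 0 -> h x = 0) -> h r = 0.
  move=> ch fh; apply: contrapT => /eqP hr.
  have nh : \forall x \near r, h x != 0 /\ 0 < x.
    near=> x; split; last first.
      apply: Rpos_gt0; near: x.
      by apply: (@open_nbhs_nbhs R); split; [exact: open_Rpos|exact/RposP].
    by near: x; apply: cvgr_neq0 ch hr.
  have [d d0' hd] := nh; have d0 : 0 < d by exact: d0'.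
  have : (mu `](r - d)%R, (r + d)%R[%classic <= mu N)%E.
    apply: le_measure; rewrite ?inE//.
    move=> x; rewrite /= in_itv/= => /andP[x1 x2]; apply: sub => /=.
    have [|hx x0] := hd x.
      by rewrite /ball/= ltr_norml; apply/andP; split; lra.
    move=> /(_ ((RposP x).2 x0)) /fh /eqP; exact/negP.
  rewrite N0 lebesgue_measure_itv/= lte_fin ifT; last by lra.
  by rewrite -EFinD lee_fin; apply/negP; rewrite -ltNge; lra.
have [c1 c2] := cf r r0.
apply: complexP.
  by rewrite (key (fun x => Re (f x)))// => x ->.
by rewrite (key (fun x => Im (f x)))// => x ->.
Unshelve. all: by end_near. Qed.

End ContinuousZero.

Section Bessel.
Context {R : realType}.
Variables (s m : R[i]).
Hypothesis s_im : `|Im s| < pi / 2.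
Hypothesis m_re : `|Re m| < 1.
Implicit Types (r t K C : R).

Local Notation p := (cexp s).
Local Notation x := (Re m).

Let p0 : 0 < Re p. Proof. exact: Re_cexp_gt0. Qed.
Let x_lt : - 1 < x < 1. Proof. by move: m_re; rewrite ltr_norml. Qed.

(** Up to a factor, [r^(1/2) K_m(2 p r)]; it decays at infinity because
    [Re p > 0], and it solves [L_(m^2) u = - (2 p)^2 u]. *)
Definition bes r : R[i] := cpowR r (2^-1 - m) * G p r m.
Definition lamb : R[i] := - (4 * cexp (2 * s)).

Lemma lambE : lamb = - (4 * (p * p)).
Proof. by rewrite /lamb -cexpD; congr (- (4 * cexp _)); ring. Qed.

Lemma csm_bes : csm Rpos bes.
Proof. by apply: csmM; [exact: open_Rpos|exact: csm_cpowR|exact: csm_G]. Qed.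

Lemma cder_powG (a mu' : R[i]) r : 0 < r ->
  cder (fun r => cpowR r a * G p r mu') r
    (a * cpowR r (a - 1) * G p r mu' - 2 * p * (cpowR r (a + 1) * G p r (mu' - 1))).
Proof.
move=> r0; apply: cder_eq (cderM (cder_cpowR a r0) (cder_G mu' p0 r0)) _.
rewrite cpowR_gt0S//.
by move: (G p r mu') (G p r (mu' - 1)) (cpowR r a) (cpowR r (a - 1)) (r%:C) p => *; ring.
Qed.

(** Two differentiations produce [G_m], [G_(m-1)] and [G_(m-2)]; [G_rec] eliminates
    the last one. *)
Lemma Lp_bes r : 0 < r -> Lp (m ^+ 2) bes r = lamb * bes r.
Proof.
move=> r0; pose a := 2^-1 - m.
pose d r := a * (cpowR r (a - 1) * G p r m) + - 2 * p * (cpowR r (a + 1) * G p r (m - 1)).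
have d1 y : Rpos y -> cder bes y (d y).
  move=> /Rpos_gt0 y0; apply: cder_eq (cder_powG a m y0) _.
  by rewrite /d; move: (G p y m) (G p y (m - 1)) (cpowR y (a + 1)) (cpowR y (a - 1)) p => *; ring.
have d2 := cderD (cderZ a (cder_powG (a - 1) m r0))
  (cderZ (- 2 * p) (cder_powG (a + 1) (m - 1) r0)).
have E1 : cderive (cderive bes) r = cderive d r.
  apply: (cderive_ext open_Rpos ((RposP r).2 r0) _ (csm_cderive csm_bes)) => y Uy.
  exact: cder_cderive (d1 y Uy).
rewrite /Lp E1 (cder_cderive d2) lambE.
have rn : r%:C != 0 :> R[i] by rewrite eq_complex/= gt_eqF.
have rec := G_rec (m - 1) p0 r0; move: rec; rewrite subrK => rec.
have e2 : cpowR r (a + 1 + 1) = cpowR r a * r%:C * r%:C by rewrite !cpowR_gt0S.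
have e4 : cpowR r (a - 1 - 1) = cpowR r a / r%:C / r%:C.
  by rewrite !(cpowRD r _ (-1)) !cpowRN1// fmorphV.
rewrite !addrK !subrK e2 e4 /bes -/a.
have rE : (r ^+ 2)%:C = r%:C ^+ 2 by rewrite rmorphXn.
have pn := cexp_neq0 s.
have rV : ((r ^+ 2)^-1)%:C = (r%:C ^+ 2)^-1 by rewrite -rmorphXn -fmorphV.
rewrite rV; rewrite rE in rec.
have {rec} -> : G p r (m - 1 - 1) = (p * G p r m - (m - 1) * G p r (m - 1)) / (p * r%:C ^+ 2).
  by rewrite rec; field; rewrite pn rn.
rewrite /a; move: (G p r m) (G p r (m - 1)) (cpowR r (2^-1 - m)) pn rn => A B D.
move: p (r%:C) => P r' pn rn.
by field; rewrite pn rn.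
Qed.

Lemma Re_half_sub (z : R[i]) : Re (2^-1 - z) = 2^-1 - Re z.
Proof.
rewrite ReD ReN (_ : (2^-1 : R[i]) = (2^-1)%:C)//.
by rewrite fmorphV rmorph_nat.
Qed.

(** [G_bound] with the exponent [d] that makes the singularity at [0] equal to
    [r^(- |Re m| / 2)]: square integrable since [|Re m| < 1]. *)
Lemma bes_le : exists2 C, 0 <= C & forall r, 0 < r ->
  normc (bes r) <= C * pw (- (`|x| / 2)) r * expR (- (Re p * r)).
Proof.
pose d := (1 - 2 * x + `|x|) / 4.
have d0 : 0 < d.
  rewrite divr_gt0//; move: x_lt => /andP[x1 x2].
  by have := ler_norm x; lra.
have xd : 0 < x + d.
  rewrite /d; move: x_lt => /andP[x1 x2].
  by have := ler_norm (- x); rewrite normrN; lra.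
have [C C0 h] := G_bound p0 d0 xd.
exists C => // r r0; rewrite /bes normcM normc_cpowR_pw.
apply: le_trans (ler_wpM2l (pw_ge0 _ _) (h r r0)) _.
rewrite Re_half_sub (_ : - (`|x| / 2) = 2^-1 - x + - (2 * d)); last by rewrite /d; field.
rewrite (pwD (2^-1 - x)) le_eqVlt; apply/orP; left; apply/eqP; ring.
Qed.

Lemma bes_L2 : L2 bes.
Proof.
have [C C0 h] := bes_le.
apply: (L2_intro (q := fun r => C ^+ 2 * gam (1 - `|x|) (2 * Re p) r)).
- exact: ccont_meas (csm_ccont csm_bes).
- move=> r r0; rewrite /gam.
  have -> : C ^+ 2 * (expR (- (2 * Re p * r)) * pw (1 - `|x| - 1) r) =
      (C * pw (- (`|x| / 2)) r * expR (- (Re p * r))) ^+ 2.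
    have -> : 1 - `|x| - 1 = - (`|x| / 2) + - (`|x| / 2) by field.
    have -> : - (2 * Re p * r) = - (Re p * r) + - (Re p * r) by ring.
    by rewrite (pwD (- (`|x| / 2))) expRD; ring.
  have B0 := mulr_ge0 (mulr_ge0 C0 (pw_ge0 (- (`|x| / 2)) r)) (expR_ge0 (- (Re p * r))).
  by apply: lerXn2r (h r r0); rewrite nnegrE ?normc_ge0.
- by apply: RintZ; apply: Rint_gam; [rewrite subr_gt0|rewrite mulr_gt0].
Qed.

Lemma Lmax_bes : Lmax (m ^+ 2) bes (fun r => lamb * bes r).
Proof.
have E r : 0 < r -> lamb * bes r = Lp (m ^+ 2) bes r by move=> r0; rewrite Lp_bes.
have L := bes_L2; split => //; first exact: L2Z.
move=> phi cc; rewrite LopE//.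
have [sT [a [b [a0 ab pa pb]]]] := Cc_Rpos_elim cc.
rewrite (Green (csm_Rpos_T sT) a0 ab pa pb (m ^+ 2) csm_bes).
by apply: cint_eq => r r0; rewrite E.
Qed.

Lemma one_sub_re : 0 < Re (1 - m).
Proof. by move: x_lt => /andP[x1 x2]; rewrite ReD ReN/= subr_gt0. Qed.

Lemma one_add_re : 0 < Re (1 + m).
Proof. by move: x_lt => /andP[x1 x2]; rewrite ReD/=; lra. Qed.

Lemma G0_neq0 (z : R[i]) : 0 < Re z -> G p 0 z != 0.
Proof.
move=> z0; have := Gam_neq0 z0; rewrite -(G0_rotation s_im z0).
by apply: contra_neq => ->; rewrite mulr0.
Qed.

(** If [bes] vanished, so would [G_m] and its derivative, hence [G_(1-m)] by
    inversion, whose value at [0] is not [0]. *)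
Lemma bes_neq0 : ~ zeroL2 bes.
Proof.
move=> z; have {}z := ccont_zeroL2 (csm_ccont csm_bes) z.
have G0 r : 0 < r -> G p r m = 0.
  by move=> r0; have /eqP := z r r0; rewrite mulf_eq0 (negPf (cpowR_neq0 _ _)) => /eqP.
have G1 r : 0 < r -> G p r (m - 1) = 0.
  move=> r0; have d := cder_G m p0 r0.
  have d' : cder (fun r => G p r m) r 0.
    apply: (cder_near open_Rpos _ ((RposP r).2 r0) (cder_cst 0 r)) => y /Rpos_gt0 y0.
    by rewrite G0.
  have /eqP := cder_uniq d d'.
  have nz : 2 * r%:C * p != 0.
    rewrite mulf_neq0 ?cexp_neq0// mulf_neq0 ?pnatr_eq0//.
    by rewrite eq_complex/= gt_eqF.
  by rewrite oppr_eq0 mulf_eq0 (negPf nz) => /eqP.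
have G2 r : 0 < r -> G p r (1 - m) = 0.
  move=> r0; have := G_inversion (m - 1) p0 r0; rewrite G1// opprB => /esym/eqP.
  by rewrite mulf_eq0 (negPf (cpowR_neq0 _ _)) => /eqP.
have m1 := one_sub_re; have := G0_neq0 m1; apply/negP; rewrite negbK.
pose th := Num.min 1 (Re (1 - m)) / 2.
have th1 : 0 < th <= 1.
  apply/andP; split; first by rewrite divr_gt0// lt_min ltr01.
  have : Num.min 1 (Re (1 - m)) <= 1 by rewrite ge_min lexx.
  by rewrite /th; lra.
have th2 : th < Re (1 - m).
  have : Num.min 1 (Re (1 - m)) <= Re (1 - m) by rewrite ge_min lexx orbT.
  by rewrite /th; lra.
have [C C0 h] := G_cvg0 p0 th1 th2.
rewrite -normc_eq0 -normr_le0; apply/ler_addgt0Pr => e e0; rewrite add0r.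
have th20 : 0 < 2 * th by case/andP: th1 => ? _; rewrite mulr_gt0.
have := pw_cvg0 C th20 => /cvgrPdist_le /(_ e e0)[N _ hN].
have hN' : `|0 - C * pw (- (2 * th)) N.+1%:R| <= e := hN N (leqnn N).
move: hN'; rewrite sub0r normrN => hN'.
have n0 : (0 : R) < N.+1%:R^-1 by rewrite invr_gt0.
have := h _ n0; rewrite G2// sub0r normcN pwV// => h1.
rewrite (ger0_norm (normc_ge0 (G p 0 (1 - m)))).
by apply: le_trans hN'; apply: le_trans h1 _; exact: ler_norm.
Qed.

End Bessel.

(** * Behaviour of the decaying solution at the origin *)

Section OriginOrder.
Context {R : realType}.
Implicit Types (f g : R -> R[i]) (e r : R).

(** [f = O(r^e)] on the part [A] of the half-line: near [0] for [ord0], near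
    infinity for [tail a]. *)
Definition ord (A : set R) e f : Prop := exists2 K : R, 0 <= K &
  forall r, 0 < r -> A r -> normc (f r) <= K * pw e r.

Local Notation ord0 := (ord [set r | r <= 2]).
Local Notation tail a := (ord [set r | a <= r]).

Lemma ord_ext A e f g : (forall r, 0 < r -> f r = g r) -> ord A e f -> ord A e g.
Proof. by move=> fg [K K0 h]; exists K => // r r0 r2; rewrite -fg// h. Qed.

Lemma ord_all A e f : (exists2 K : R, 0 <= K & forall r, 0 < r ->
  normc (f r) <= K * pw e r) -> ord A e f.
Proof. by move=> [K K0 h]; exists K => // r r0 _; apply: h. Qed.

Lemma ordD A e f g : ord A e f -> ord A e g -> ord A e (fun r => f r + g r).
Proof.
move=> [K K0 hf] [L L0 hg]; exists (K + L); first exact: addr_ge0.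
move=> r r0 r2; apply: le_trans (normcD _ _) _.
by rewrite mulrDl lerD ?hf ?hg.
Qed.

Lemma ordM A a b f g : ord A a f -> ord A b g -> ord A (a + b) (fun r => f r * g r).
Proof.
move=> [K K0 hf] [L L0 hg].
exists (K * L); first exact: mulr_ge0.
move=> r r0 r2; rewrite (normcM (f r)) (pwD a).
have -> : K * L * (pw a r * pw b r) = (K * pw a r) * (L * pw b r) by ring.
by rewrite ler_pM ?normc_ge0 ?hf ?hg.
Qed.

Lemma ord_cst A (c : R[i]) : ord A 0 (fun=> c).
Proof. by exists (normc c) => [|r r0 _]; rewrite ?normc_ge0// pw0 mulr1. Qed.

Lemma ordZ A e (c : R[i]) f : ord A e f -> ord A e (fun r => c * f r).
Proof. by move=> h; have := ordM (ord_cst A c) h; rewrite add0r. Qed.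

Lemma ordN A e f : ord A e f -> ord A e (fun r => - f r).
Proof. by move=> [K K0 h]; exists K => // r r0 r2; rewrite normcN h. Qed.

Lemma ordB A e f g : ord A e f -> ord A e g -> ord A e (fun r => f r - g r).
Proof. by move=> hf hg; apply: ordD hf (ordN hg). Qed.

Lemma ord_cpowR A (z : R[i]) : ord A (Re z) (fun r => cpowR r z).
Proof. by exists 1 => // r r0 _; rewrite normc_cpowR_pw mul1r. Qed.

Lemma ord_id A : ord A 1 (fun r => r%:C).
Proof. by exists 1 => // r r0 _; rewrite normcR pw1// mul1r ger0_norm// ltW. Qed.

Lemma ord0_le a b f : a <= b -> ord0 b f -> ord0 a f.
Proof.
move=> ab [K K0 h]; exists (K * pw (b - a) 2); first by rewrite mulr_ge0 ?pw_ge0.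
move=> r r0 r2; apply: le_trans (h r r0 r2) _.
rewrite -mulrA ler_wpM2l// -[in leLHS](subrK a b) (pwD (b - a)).
by rewrite ler_wpM2r ?pw_ge0// ler_pw// subr_ge0.
Qed.

Lemma tail_le c a b f : 0 < c -> a <= b -> tail c a f -> tail c b f.
Proof.
move=> c0 ab [K K0 h]; exists (K * pw (a - b) c); first by rewrite mulr_ge0 ?pw_ge0.
move=> r r0 cr; apply: le_trans (h r r0 cr) _.
rewrite -mulrA ler_wpM2l// -[in leLHS](subrK b a) (pwD (a - b)).
rewrite ler_wpM2r ?pw_ge0// -(opprB b) !pwN lef_pV2 ?posrE ?pw_gt0//.
by rewrite ler_pw// subr_ge0.
Qed.

Lemma ord0M a b c f g : ord0 a f -> ord0 b g -> c <= a + b -> ord0 c (fun r => f r * g r).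
Proof. by move=> hf hg cab; apply: (ord0_le cab); exact: ordM. Qed.

Lemma ord0_ln e : 0 < e -> ord0 (- e) (fun r => (ln r)%:C).
Proof.
move=> e0; exists (e^-1 * (pw (2 * e) 2 + 1)).
  by rewrite mulr_ge0 ?invr_ge0 ?addr_ge0 ?pw_ge0// ltW.
move=> r r0 r2; rewrite normcR; apply: le_trans (abs_ln_le e0 r0) _.
rewrite -mulrA ler_wpM2l ?invr_ge0 ?(ltW e0)// mulrDl mul1r lerD2r.
have {1}-> : e = 2 * e + - e by ring.
by rewrite (pwD (2 * e)) ler_wpM2r ?pw_ge0// ler_pw// mulr_ge0// ltW.
Qed.

Lemma tail_ln c e : 0 < c -> 0 < e -> tail c e (fun r => (ln r)%:C).
Proof.
move=> c0 e0; have [||K K0 h] := @tail_le c (- e) e (fun r => (pw (- e) r)%:C) c0.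
- by rewrite ge0_cp// ltW.
- by exists 1 => // r r0 _; rewrite normcR mul1r ger0_norm ?pw_ge0.
exists (e^-1 * (1 + K)); first by rewrite mulr_ge0 ?addr_ge0 ?invr_ge0// ltW.
move=> r r0 cr; rewrite normcR; apply: le_trans (abs_ln_le e0 r0) _.
rewrite -mulrA ler_wpM2l ?invr_ge0 ?(ltW e0)// mulrDl mul1r lerD2l.
by have := h r r0 cr; rewrite normcR ger0_norm ?pw_ge0.
Qed.

Lemma ord0_bd a e f g : (forall r, 0 < r -> cder f r (g r)) -> ord0 a g -> e <= a ->
  ord0 e (cderive f).
Proof.
move=> d h ea; apply: (ord0_le ea); apply: ord_ext h => r r0.
by rewrite (cder_cderive (d r r0)).
Qed.

Lemma around0_ord al g eta : csm Rpos g -> 0 < eta ->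
  ord0 (3 / 2 + eta) g -> ord0 (2^-1 + eta) (cderive g) -> ord0 (eta - 2^-1) (Lp al g) ->
  around0 (dom (Lmin al)) g.
Proof.
move=> sg e0 [K K0 h] [K1 K10 h1] [K2 K20 h2].
apply: (around0_intro (eta := eta) (K := K + K1 + K2)) => //.
  by rewrite !addr_ge0.
move=> r r0 r2; split.
- by apply: le_trans (h r r0 r2) _; rewrite ler_wpM2r ?pw_ge0//; lra.
- by apply: le_trans (h1 r r0 r2) _; rewrite ler_wpM2r ?pw_ge0//; lra.
- by apply: le_trans (h2 r r0 r2) _; rewrite ler_wpM2r ?pw_ge0//; lra.
Qed.

Lemma Lp_cder al f d r (dd : R[i]) : 0 < r -> csm Rpos f ->
  (forall y, 0 < y -> cder f y (d y)) -> cder d r dd ->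
  Lp al f r = - dd + (al - 4^-1) * ((r ^+ 2)^-1)%:C * f r.
Proof.
move=> r0 sf d1 d2; have Ur : Rpos r by exact/RposP.
have E : cderive (cderive f) r = cderive d r.
  apply: (cderive_ext open_Rpos Ur _ (csm_cderive sf)) => y /Rpos_gt0 y0.
  exact: cder_cderive (d1 y y0).
by rewrite /Lp E (cder_cderive d2).
Qed.

Lemma LpB al f g c r : 0 < r -> csm Rpos f -> csm Rpos g ->
  Lp al (fun r => f r - c * g r) r = Lp al f r - c * Lp al g r.
Proof.
move=> r0 sf sg; have Ur : Rpos r by exact/RposP.
have sB : csm Rpos (fun r => f r - c * g r).
  by apply: csmB open_Rpos sf _; exact: csmZ open_Rpos sg.
rewrite (Lp_cder al r0 sB (fun y y0 => cderB (csm_cder sf ((RposP y).2 y0))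
    (cderZ c (csm_cder sg ((RposP y).2 y0))))
  (cderB (csm_cder (csm_cderive sf) Ur) (cderZ c (csm_cder (csm_cderive sg) Ur)))).
rewrite /Lp.
move: (cderive (cderive f) r) (cderive (cderive g) r) ((r ^+ 2)^-1)%:C (f r) (g r) => *.
ring.
Qed.

End OriginOrder.

Notation ord0 := (ord [set r | r <= 2]).
Notation tail a := (ord [set r | a <= r]).

Section BesselOrigin.
Context {R : realType}.
Variables (s m : R[i]).
Hypothesis s_im : `|Im s| < pi / 2.
Hypothesis m_re : `|Re m| < 1.
Implicit Types (r : R).

Local Notation p := (cexp s).
Local Notation x := (Re m).
Local Notation u := (bes s m).

Let p0 : 0 < Re p. Proof. exact: Re_cexp_gt0. Qed.
Let x_lt : - 1 < x < 1. Proof. by move: m_re; rewrite ltr_norml. Qed.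
Let eta : R := (1 - `|x|) / 2.
Let eta0 : 0 < eta. Proof. by rewrite divr_gt0// subr_gt0. Qed.

(** The remainders of the two terms of [G_split] once their leading powers
    [r^(3/2 - z)], with [z = 1 + m] and [z = 1 - m], are split off. *)
Definition vrem (z : R[i]) r : R[i] := cpowR r (3 / 2 - z) * (G p r z - G p 0 z).

Lemma Re_half : Re (2^-1 : R[i]) = 2^-1.
Proof. by rewrite (_ : (2^-1 : R[i]) = (2^-1)%:C)// fmorphV rmorph_nat. Qed.

Lemma Re_3half : Re (3 / 2 : R[i]) = 3 / 2.
Proof. by rewrite (_ : (3 / 2 : R[i]) = (3 / 2)%:C)// fmorph_div !rmorph_nat. Qed.

Lemma vrem_ord z : 1 - `|x| <= Re z -> Re z <= 1 + `|x| ->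
  ord0 (3 / 2 + eta) (vrem z) /\ ord0 (2^-1 + eta) (cderive (vrem z)).
Proof.
move=> z1 z2; have x0 := normr_ge0 x.
(* [2 th] exceeds [Re z] by [eta], which leaves [r^(3/2 + eta)] in [vrem z] *)
pose th := (Re z + eta) / 2.
have th1 : 0 < th <= 1 by rewrite /th /eta; apply/andP; split; move: m_re => ?; lra.
have thz : th < Re z by rewrite /th /eta; move: m_re => ?; lra.
have hG : ord0 (2 * th) (fun r => G p r z - G p 0 z) by apply/ord_all/G_cvg0.
have hG1 : ord0 (- (2 * (1 - th))) (fun r => G p r (z - 1)).
  have [||C C0 h] := @G_bound R p (z - 1) (1 - th) p0.
  - by rewrite /th /eta; move: m_re => ?; lra.
  - by rewrite ReD ReN/= /th /eta; move: m_re => ?; lra.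
  exists C => // r r0 _; apply: le_trans (h r r0) _.
  rewrite -[leRHS]mulr1 ler_wpM2l ?mulr_ge0 ?pw_ge0// -expR0 ler_expR oppr_le0.
  by rewrite mulr_ge0 ?ltW.
split.
  by apply: ord0M (ord_cpowR _ _) hG _; rewrite ReD ReN Re_3half /th; lra.
pose d r := ((3 / 2 - z) * cpowR r (3 / 2 - z - 1)) * (G p r z - G p 0 z) +
  cpowR r (3 / 2 - z) * ((- 2 * p) * (r%:C * G p r (z - 1))).
have dd r : 0 < r -> cder (vrem z) r (d r).
  move=> r0; apply: cder_eq (cderM (cder_cpowR (3 / 2 - z) r0)
    (cderB (cder_G z p0 r0) (cder_cst (G p 0 z) r))) _.
  rewrite /d; move: (G p r z) (G p r (z - 1)) (G p 0 z) (cpowR r (3 / 2 - z - 1))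
    (cpowR r (3 / 2 - z)) (r%:C) p => *; ring.
apply: (ord0_bd (a := 2^-1 + eta) dd) => //; apply: ordD.
  apply: ord0M (ordZ _ (ord_cpowR _ _)) hG _.
  by rewrite !ReD !ReN Re_3half /th/=; lra.
apply: ord0M (ord_cpowR _ _) (ordZ _ (ord0M (ord_id _) hG1 (lexx _))) _.
by rewrite ReD ReN Re_3half /th; lra.
Qed.

Lemma csm_vrem z : csm Rpos (vrem z).
Proof.
apply: (csmM open_Rpos); first exact: csm_cpowR.
by apply: (csmB open_Rpos); [exact: csm_G|exact: csm_cst open_Rpos].
Qed.

Lemma Lp_cpowR (z : R[i]) r : 0 < r -> z * (z - 1) = m ^+ 2 - 4^-1 ->
  Lp (m ^+ 2) (fun r => cpowR r z) r = 0.
Proof.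
move=> r0 e; rewrite (Lp_cder _ r0 (csm_cpowR z) (fun y y0 => cder_cpowR z y0)
  (cderZ z (cder_cpowR (z - 1) r0))) -e.
rewrite !(cpowRD r _ (-1)) !cpowRN1// (_ : ((r ^+ 2)^-1)%:C = (r^-1)%:C * (r^-1)%:C).
  by move: (cpowR r z) (r^-1)%:C => *; ring.
by rewrite -rmorphM expr2 invfM.
Qed.

(** The two Frobenius solutions of [L_(m^2) w = 0] carry all of [u] up to terms
    in the minimal domain; [G_split] displays them. *)
Lemma bes_boundary kappa : m != 0 ->
  kappa * G p 0 (1 - m) = - G p 0 (1 + m) ->
  H_mk m kappa u (fun r => lamb s * u r).
Proof.
move=> m0 ek; split; first exact: Lmax_bes.
pose c := - (p / m * G p 0 (1 - m)); exists c => /=.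
set g := fun _ => _.
pose w r := kappa * cpowR r (2^-1 - m) + cpowR r (2^-1 + m).
have sw : csm Rpos w.
  by apply: (csmD open_Rpos); [apply: (csmZ _ open_Rpos)|]; exact: csm_cpowR.
have su := csm_bes m s_im.
have sg : csm Rpos g by apply: (csmB open_Rpos su); exact: csmZ open_Rpos sw.
have a1 : 3 / 2 - (1 + m) = 2^-1 - m by field.
have a2 : 3 / 2 - (1 - m) = 2^-1 + m by field.
have gE r : 0 < r -> g r = p / m * (vrem (1 + m) r - vrem (1 - m) r).
  move=> r0; rewrite /g /bes /vrem a1 a2 (G_split p0 r0 m0) [m + 1]addrC /c.
  have -> : 2^-1 + m = 2^-1 - m + 2 * m by ring.
  rewrite (cpowRD r (2^-1 - m)).
  have -> : G p 0 (1 + m) = - (kappa * G p 0 (1 - m)) by rewrite ek opprK.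
  move: (G p r (1 + m)) (G p r (1 - m)) (G p 0 (1 - m)) (cpowR r (2^-1 - m)) (cpowR r (2 * m)).
  by move=> *; ring.
have n1 : x <= `|x| by exact: ler_norm.
have n2 : - `|x| <= x by have := ler_norm (- x); rewrite normrN; lra.
have [||o1 o1'] := @vrem_ord (1 + m).
  by rewrite ReD/=; lra.
  by rewrite ReD/=; lra.
have [||o2 o2'] := @vrem_ord (1 - m).
  by rewrite ReD ReN/=; lra.
  by rewrite ReD ReN/=; lra.
apply: (around0_ord (eta := eta)) => //.
- by apply: ord_ext (ordZ (p / m) (ordB o1 o2)) => r r0; rewrite gE.
- apply: ord_ext (ordZ (p / m) (ordB o1' o2')) => r r0.
  have Ur : Rpos r by exact/RposP.
  have d := cderZ (p / m) (cderB (csm_cder (csm_vrem (1 + m)) Ur) (csm_cder (csm_vrem (1 - m)) Ur)).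
  apply/esym/cder_cderive; apply: (cder_near open_Rpos _ Ur d) => y /Rpos_gt0 y0.
  by rewrite gE.
- have [C C0 h] := bes_le s_im m_re.
  exists (normc (lamb s) * C) => [|r r0 r2]; first by rewrite mulr_ge0// normc_ge0.
  have lw : Lp (m ^+ 2) w r = 0.
    have e : forall y, w y = cpowR y (2^-1 + m) - (- kappa) * cpowR y (2^-1 - m).
      by move=> y; rewrite /w mulNr opprK addrC.
    rewrite (Lp_ext _ open_Rpos ((RposP r).2 r0) (fun y _ => e y) sw).
    rewrite LpB ?Lp_cpowR//; try exact: csm_cpowR.
    - by rewrite mulr0 subr0.
    - by field.
    - by field.
  rewrite /g LpB// lw mulr0 subr0 Lp_bes// (normcM (lamb s)) -(mulrA _ C).
  rewrite ler_wpM2l ?normc_ge0//; apply: le_trans (h r r0) _.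
  have -> : - (`|x| / 2) = eta - 2^-1 by rewrite /eta; field.
  rewrite -[leRHS]mulr1 ler_wpM2l ?mulr_ge0 ?pw_ge0// -expR0 ler_expR oppr_le0.
  by rewrite mulr_ge0 ?ltW.
Qed.

End BesselOrigin.

Section BesselOriginLog.
Context {R : realType}.
Variable s : R[i].
Hypothesis s_im : `|Im s| < pi / 2.
Implicit Types (r : R) (nu : R[i]).

Local Notation p := (cexp s).
Local Notation u := (bes s 0).

Let p0 : 0 < Re p. Proof. exact: Re_cexp_gt0. Qed.

(** The boundary behaviour that defines [H_0 nu]. *)
Definition w0 nu r : R[i] := cpowR r 2^-1 * (ln r)%:C + nu * cpowR r 2^-1.

Definition w0' nu r : R[i] :=
  2^-1 * cpowR r (2^-1 - 1) * (ln r)%:C + (1 + 2^-1 * nu) * cpowR r (2^-1 - 1).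

Lemma cder_w0 nu r : 0 < r -> cder (w0 nu) r (w0' nu r).
Proof.
move=> r0; apply: cder_eq (cderD (cderM (cder_cpowR 2^-1 r0) (cder_ln r0))
  (cderZ nu (cder_cpowR 2^-1 r0))) _.
rewrite /w0' (cpowRD r 2^-1) cpowRN1//.
by move: (cpowR r 2^-1) (r^-1)%:C (ln r)%:C => *; ring.
Qed.

Lemma csm_w0 nu : csm Rpos (w0 nu).
Proof.
apply: (csmD open_Rpos); last by apply: (csmZ _ open_Rpos); exact: csm_cpowR.
by apply: (csmM open_Rpos); [exact: csm_cpowR|exact: csm_ln].
Qed.

Lemma Lp_w0 nu r : 0 < r -> Lp 0 (w0 nu) r = 0.
Proof.
move=> r0; rewrite (Lp_cder _ r0 (csm_w0 nu) (fun y y0 => cder_w0 nu y0)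
  (cderD (cderM (cderZ 2^-1 (cder_cpowR (2^-1 - 1) r0)) (cder_ln r0))
     (cderZ (1 + 2^-1 * nu) (cder_cpowR (2^-1 - 1) r0)))) /w0.
rewrite !(cpowRD r _ (-1)) !cpowRN1// (_ : ((r ^+ 2)^-1)%:C = (r^-1)%:C * (r^-1)%:C).
  by move: (cpowR r 2^-1) (r^-1)%:C (ln r)%:C => *; field.
by rewrite -rmorphM expr2 invfM.
Qed.

(** By [G_split0], [u + 2 w_nu] has no leading term at [0] exactly for
    [nu = s + gamma]: this uses the values of [G] and [H] at [0] given by
    [G0_rotation], [H0_rotation] and [H10]. *)
Definition bes0_rem r : R[i] := u r + 2 * w0 (s + euler_gamma%:C) r.

Lemma bes0_boundary_bounds : [/\ ord0 2 bes0_rem, ord0 1 (cderive bes0_rem) &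
  csm Rpos bes0_rem].
Proof.
have m0 : `|Re (0 : R[i])| < 1 by rewrite normr0.
have su := csm_bes 0 s_im; have sw := csm_w0 (s + euler_gamma%:C).
have sg : csm Rpos bes0_rem by apply: (csmD open_Rpos su); exact: csmZ open_Rpos sw.
have pG1 : p * G p 0 1 = 1.
  by have := @G0_rotation R s 1 s_im ltr01; rewrite mul1r Gam1.
have pH : p * H p 0 = - (s + euler_gamma%:C).
  by rewrite H0_rotation// H10 Gam1 mulr1 opprD addrC rmorphN.
pose D r : R[i] := G p r 0 + 2 * (ln r)%:C + 2 * (s + euler_gamma%:C).
have gE r : bes0_rem r = cpowR r 2^-1 * D r.
  rewrite /bes0_rem /bes /w0 /D subr0.
  by move: (cpowR r 2^-1) (G p r 0) => *; ring.
(* any exponent between [3/2] and [2] would do: it has to absorb a logarithm *)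
have oG : ord0 (7 / 4) (fun r => G p r 1 - G p 0 1).
  have [||C C0 h] := @G_cvg0 R p 1 (7 / 8) p0; try by rewrite /=; lra.
  exists C => // r r0 _; apply: le_trans (h r r0) _.
  by rewrite (_ : 2 * (7 / 8) = 7 / 4 :> R)//; field.
have oH : ord0 (7 / 4) (fun r => H p r - H p 0).
  have [|C C0 h] := @H_cvg0 R p (7 / 8) p0; first by rewrite /=; lra.
  exists C => // r r0 _; apply: le_trans (h r r0) _.
  by rewrite (_ : 2 * (7 / 8) = 7 / 4 :> R)//; field.
have DE r : 0 < r -> D r = 2 * p * (H p r - H p 0) - 2 * p * ((ln r)%:C * (G p r 1 - G p 0 1)).
  move=> r0; rewrite /D G_split0//.
  have -> : s + euler_gamma%:C = - (p * H p 0) by rewrite pH opprK.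
  have -> : 2 * p * ((ln r)%:C * (G p r 1 - G p 0 1)) =
      2 * p * (ln r)%:C * G p r 1 - 2 * (ln r)%:C * (p * G p 0 1).
    by move: (G p r 1) (G p 0 1) p => *; ring.
  by rewrite pG1; move: (H p r) (H p 0) (G p r 1) p => *; ring.
have oD : ord0 (3 / 2) D.
  have o : ord0 (3 / 2) (fun r => 2 * p * (H p r - H p 0) -
      2 * p * ((ln r)%:C * (G p r 1 - G p 0 1))).
    apply: ordB; apply: ordZ; first by apply: ord0_le oH; lra.
    by apply: ord0M (@ord0_ln R 4^-1 _) oG _; lra.
  by apply: ord_ext o => r r0; rewrite DE.
have dD r : 0 < r -> cder D r (- 2 * p * ((r^-1)%:C * (G p r 1 - G p 0 1))).
  move=> r0; apply: cder_eq (cderD (cderD (cder_G 0 p0 r0) (cderZ 2 (cder_ln r0)))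
    (cder_cst (2 * (s + euler_gamma%:C)) r)) _.
  have := G_rec 0 p0 r0; rewrite mul0r add0r => rec.
  have rn : r%:C != 0 :> R[i] by rewrite eq_complex/= gt_eqF.
  have {}rec : G p r 1 = r%:C * r%:C * G p r (0 - 1).
    apply: (mulfI (cexp_neq0 s)); rewrite !mulrA -(mulrA p).
    by apply/eqP; rewrite -subr_eq0 -rmorphM -expr2 -rec.
  rewrite mulrBr mulrBr rec.
  have -> : - 2 * p * ((r^-1)%:C * G p 0 1) = - 2 * (r^-1)%:C * (p * G p 0 1).
    by move: (G p 0 1) p => *; ring.
  have rV : (r^-1)%:C = (r%:C)^-1 :> R[i] by rewrite fmorphV.
  rewrite pG1 rV.

  move: (G p r (0 - 1)) p (r%:C) rn => A B C rn; by field.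
have oD' : ord0 (3 / 4) (fun r => - 2 * p * ((r^-1)%:C * (G p r 1 - G p 0 1))).
  apply: ordZ; apply: (ord0M (a := - 1) (b := 7 / 4)) oG _; last by lra.
  by exists 1 => [|y y0 _]; rewrite ?ler01// normcR pwN1// mul1r ger0_norm// invr_ge0 ltW.
have h := ord_cpowR [set r : R | r <= 2] (2^-1 : R[i]); have h' := ord_cpowR [set r : R | r <= 2] (2^-1 - 1 : R[i]).
split => //.
  apply: ord_ext (ord0M h oD _) => [r _|]; first by rewrite gE.
  by rewrite Re_half; lra.
have dg r : 0 < r -> cder bes0_rem r (2^-1 * cpowR r (2^-1 - 1) * D r +
    cpowR r 2^-1 * (- 2 * p * ((r^-1)%:C * (G p r 1 - G p 0 1)))).
  move=> r0; apply: (cder_near open_Rpos (fun y _ => esym (gE y)) ((RposP r).2 r0)).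
  exact: cderM (cder_cpowR 2^-1 r0) (dD r r0).
apply: (ord0_bd (a := 1) dg) => //; apply: ordD.
  by apply: ord0M (ordZ _ h') oD _; rewrite ReD ReN Re_half/=; lra.
by apply: ord0M h oD' _; rewrite Re_half; lra.
Qed.

Lemma bes0_boundary : H_0 (s + euler_gamma%:C) u (fun r => lamb s * u r).
Proof.
have m0 : `|Re (0 : R[i])| < 1 by rewrite normr0.
have [og og' sg] := bes0_boundary_bounds.
split; first by have := Lmax_bes s_im m0; rewrite expr2 mul0r.
exists (- 2) => /=.
set g := fun _ => _.
have gE r : g r = bes0_rem r by rewrite /g mulNr opprK.
have {}gE : g = bes0_rem by apply/funext.
rewrite gE; apply: (around0_ord (eta := 2^-1)) => //.
- by apply: ord0_le og; lra.
- by apply: ord0_le og'; lra.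
- have [C C0 h] := bes_le s_im m0; rewrite normr0 mul0r oppr0 in h.
  exists (normc (lamb s) * C) => [|r r0 r2]; first by rewrite mulr_ge0// normc_ge0.
  have -> : Lp 0 bes0_rem r = lamb s * u r.
    have e y : bes0_rem y = u y - (- 2) * w0 (s + euler_gamma%:C) y by rewrite mulNr opprK.
    rewrite (Lp_ext _ open_Rpos ((RposP r).2 r0) (fun y _ => e y) sg).
    rewrite LpB ?Lp_w0//; [|exact: csm_bes|exact: csm_w0].
    by rewrite mulr0 subr0 -Lp_bes// expr2 mul0r.
  rewrite subrr (normcM (lamb s)) -(mulrA _ C).
  rewrite ler_wpM2l ?normc_ge0//; apply: le_trans (h r r0) _.
  rewrite -[leRHS]mulr1 ler_wpM2l ?mulr_ge0 ?pw_ge0// -expR0 ler_expR oppr_le0.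
  by rewrite mulr_ge0 ?ltW.
Qed.

End BesselOriginLog.

(** * The fundamental lemma of the calculus of variations *)

Section Fundamental.
Context {R : realType}.
Implicit Types (f g h : R -> R[i]) (a b x r K : R).
Local Notation mu := (@lebesgue_measure R).

Lemma csm_cexp U (z : R[i]) : open U -> csm U (fun r => cexp (z * r%:C)).
Proof.
move=> oU n; elim: n => [//|n IH].
apply: (smn_intro oU (g := fun r => z * cexp (z * r%:C))) => [x Ux|].
  apply: cder_eq (cder_cexp (cderZ z (cder_real (is_derive_id x 1)))) _.
  by rewrite mulr1.
by apply: (smnM oU); first exact: smn_cst.
Qed.

(** Compactly supported bumps converging to the indicator function of [(0, x)]. *)
Lemma bump_dct f x : L2 f -> 0 < x ->
  (forall psi a b, csm Rpos psi -> 0 < a -> a < b -> (forall r, r < a -> psi r = 0) ->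
    (forall r, b < r -> psi r = 0) -> cint (fun r => f r * psi r) = 0) ->
  (forall P : R[i] -> R, P = @Re R \/ P = @Im R ->
   rI (fun r => P (f r) * expR (- r) * (r <= x)%R%:R) = 0).
Proof.
move=> Lf x0 h P PE.
have cf := L2_cmeas Lf.
pose e r : R[i] := (expR (- r))%:C.
have se : csm Rpos e.
  apply: (csm_ext open_Rpos _ (csm_cexp (- 1) open_Rpos)) => r _.
  by rewrite /e -cexpR rmorphN mulN1r.
have Le : L2 e.
  apply: (L2_intro (q := gam 1 2)) => [|r r0|].
  - exact: ccont_meas (csm_ccont se).
  - rewrite normcR ger0_norm ?expR_ge0// /gam subrr pw0 mulr1 expr2 -expRD.
    by rewrite (_ : - r + - r = - (2 * r))//; ring.
  - exact: Rint_gam.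
have Ife := Cint_L2M Lf Le.
pose c (n : nat) r : R[i] := (stp (n.+1%:R * r))%:C * (stp (- n.+1%:R * r + (n.+1%:R * x + 2)))%:C.
pose psi n r : R[i] := c n r * e r.
have sc n : csm Rpos (c n).
  apply: csm_Rpos_T; apply: (csmM openT); first exact: csm_scale.
  exact: (csm_affine (- n.+1%:R) (n.+1%:R * x + 2) (@csm_stp R)).
have spsi n : csm Rpos (psi n) by exact: csmM open_Rpos (sc n) se.
have n0 (n : nat) : (0 : R) < n.+1%:R by [].
have cge n r : 0 <= Re (c n r) <= 1 /\ c n r = (Re (c n r))%:C.
  rewrite /c -rmorphM/=; split => //.
  by rewrite mulr_ge0 ?stp_ge0//= mulr_ile1 ?stp_ge0 ?stp_le1.
have z n : cint (fun r => f r * psi n r) = 0.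
  apply: (h (psi n) n.+1%:R^-1 (x + n.+1%:R^-1)) => //; rewrite ?invr_gt0//.
  - by rewrite ltrDr.
  - move=> r ra; rewrite /psi /c stp0 ?mul0r//.
    by rewrite mulrC -ler_pdivlMr// div1r ltW.
  - move=> r br; rewrite /psi /c (stp0 (x := - _ * _ + _)) ?mulr0 ?mul0r//.
    have : n.+1%:R * (x + n.+1%:R^-1) <= n.+1%:R * r by rewrite ler_pM2l// ltW.
    by rewrite mulrDr divff ?gt_eqF//; lra.
have cl r : 0 < r -> (fun n => Re (c n r)) @ \oo --> ((r <= x)%R%:R : R).
  move=> r0; apply: cvg_near_cst; have [rx|xr] := leP r x.
    near=> n; rewrite /c -rmorphM/= !stp1 ?mulr1//.
      have : n.+1%:R * r <= n.+1%:R * x by rewrite ler_pM2l.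
      by rewrite mulNr; lra.
    rewrite mulrC -ler_pdivrMl// mulrC.
    have : 2 / r <= n%:R by near: n; exact: nbhs_infty_ger.
    by move=> /le_trans; apply; rewrite ler_nat.
  have d0 : 0 < r - x by rewrite subr_gt0.
  near=> n; rewrite /c -rmorphM/= (stp0 (x := - _ * _ + _)) ?mulr0//.
  have : 1 <= n.+1%:R * (r - x); last by lra.
  rewrite -ler_pdivrMr// div1r.
  have : (r - x)^-1 <= n%:R by near: n; exact: nbhs_infty_ger.
  by move=> /le_trans; apply; rewrite ler_nat.
have PM (w : R[i]) (t : R) : P (w * t%:C) = P w * t.
  by case: PE => ->; case: w => p q /=; rewrite mulr0 ?subr0 ?add0r// addrC mul0r add0r.
have Pn (w : R[i]) : `|P w| <= normc w.
  by case: PE => ->; [exact: normc_Re|exact: normc_Im].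
have PC n : rI (fun r => P (f r * psi n r)) = 0.
  have := z n; rewrite cintE => /eqP; rewrite eq_complex/= => /andP[/eqP z1 /eqP z2].
  by case: PE => ->.
have mP : measurable_fun Rpos (fun r => P (f r)) by case: PE => ->; case: cf.
have mce n : measurable_fun Rpos (fun r => expR (- r) * Re (c n r)).
  apply: measurable_funM; first by have [] := ccont_meas (csm_ccont se).
  by have [] := ccont_meas (csm_ccont (sc n)).
have EP n r : P (f r * psi n r) = P (f r) * (expR (- r) * Re (c n r)).
  by rewrite /psi [in LHS](cge n r).2 /e -rmorphM PM (mulrC (Re _)).
have [] := @rI_dct R (fun n r => P (f r * psi n r))
  (fun r => P (f r) * expR (- r) * (r <= x)%R%:R) (fun r => normc (f r * e r)).
- move=> n; apply: (eq_measurable_fun (fun r => P (f r) * (expR (- r) * Re (c n r)))).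
    by move=> r _; rewrite EP.
  exact: measurable_funM.
- move=> r r0.
  have -> : (fun n => P (f r * psi n r)) = (fun n => P (f r) * expR (- r) * Re (c n r)).
    by apply/funext => n; rewrite EP mulrA.
  exact: cvgMr (cl r r0).
- exact: Cint_normc.
- move=> n r r0; apply: le_trans (Pn _) _; rewrite /psi (normcM (f r)) (normcM (c n r)).
  rewrite (normcM (f r)) ler_wpM2l ?normc_ge0// -[leRHS]mul1r ler_wpM2r ?normc_ge0//.
  by rewrite (cge n r).2 normcR ger0_norm; case: (cge n r) => /andP[].
move=> _; have -> : (fun n => rI (fun r => P (f r * psi n r))) = (fun=> 0).
  by apply/funext => n; exact: PC.
by move=> /(cvg_unique (@Rhausdorff R) (cvg_cst (0 : R))) <-.
Unshelve. all: by end_near. Qed.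

(** The function weighted by [exp (- r)] is integrable on the half-line and its
    integral over each [(0, y)] vanishes, by [bump_dct]; it vanishes almost
    everywhere by Lebesgue's differentiation theorem. *)
Lemma zeroL2_test f : L2 f ->
  (forall psi a b, csm Rpos psi -> 0 < a -> a < b -> (forall r, r < a -> psi r = 0) ->
    (forall r, b < r -> psi r = 0) -> cint (fun r => f r * psi r) = 0) ->
  zeroL2 f.
Proof.
move=> Lf h.
have cf := L2_cmeas Lf.
have key (P : R[i] -> R) : P = @Re R \/ P = @Im R -> {ae mu, forall r, Rpos r -> P (f r) = 0}.
  move=> PE; pose g r := P (f r) * expR (- r).
  have ig : Rint g.
    apply: (Rint_le (g := fun r => normc (f r * (expR (- r))%:C))).
    - apply: measurable_funM; first by case: PE => ->; case: cf.
      by apply: measurable_cont_Rpos => x x0; apply: continuous_comp;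
        [exact: opp_continuous|exact: continuous_expR].
    - move=> x x0; rewrite (normcM (f x)) normcR normrM ler_wpM2r//.
      by case: PE => ->; [exact: normc_Re|exact: normc_Im].
    - apply: Cint_normc; apply: Cint_L2M => //.
      apply: (L2_intro (q := gam 1 2)) => [|r r0|].
      + apply: ccont_meas; apply: ccont_real => x x0; apply: continuous_comp;
          [exact: opp_continuous|exact: continuous_expR].
      + rewrite normcR ger0_norm ?expR_ge0// /gam subrr pw0 mulr1 expr2 -expRD.
        by rewrite (_ : - r + - r = - (2 * r))//; ring.
      + exact: Rint_gam.
  have mRp := @measurable_Rpos R.
  pose G := g \_ Rpos.
  have iG : mu.-integrable setT (EFin \o G).
    have -> : EFin \o G = (EFin \o g) \_ Rpos by rewrite restrict_EFin.
    by rewrite -integrable_mkcond.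
  have iGy y : mu.-integrable `]-oo, y] (EFin \o G) by exact: integrableS iG.
  have z y : \int[mu]_(t in [set` `]-oo, y]]) G t = 0.
    have -> : \int[mu]_(t in [set` `]-oo, y]]) G t =
        rI (fun r => P (f r) * expR (- r) * (r <= y)%R%:R).
      rewrite /rI [LHS]Rintegral_mkcond [RHS]Rintegral_mkcond.
      congr (fine _); apply: eq_integral => t _; congr EFin.
      rewrite /G !patchE; have [ty|ty] := leP t y.
        by rewrite mem_set/= ?in_itv// mulr1.
      rewrite memNset/= ?in_itv/=; last by move=> /(lt_le_trans ty); rewrite ltxx.
      by case: ifP => // _; rewrite mulr0.
    have [y0|y0] := leP y 0; last exact: bump_dct Lf y0 h _ PE.
    rewrite (rI_eq (g := fun=> 0)); first by rewrite /rI /Rintegral integral0.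
    by move=> r r0; rewrite leNgt (le_lt_trans y0 r0) mulr0.
  have F0 : (fun y => \int[mu]_(t in [set` `]-oo, y]]) G t) = cst 0 by exact/funext.
  have := FTC1Ny iGy (integrable_locally mRp ig); rewrite F0.
  apply: filterS; first exact: (ae_filter_ringOfSetsType mu).
  move=> r [_ d] Ur; move: d; rewrite derive1_cst /G patchE mem_set// /g => /esym/eqP.
  by rewrite mulf_eq0 (gt_eqF (expR_gt0 _)) orbF => /eqP.
have k1 := key _ (or_introl erefl); have k2 := key _ (or_intror erefl).
apply: filterS2 k1 k2; first exact: (ae_filter_ringOfSetsType mu).
move=> r r1 r2 Ur; apply: complexP; [exact: r1|exact: r2].
Qed.

End Fundamental.

(** * Primitives and integration by parts at infinity *)

Section Primitive.
Context {R : realType}.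
Implicit Types (f g h : R -> R[i]) (a b x r K : R).
Local Notation mu := (@lebesgue_measure R).

Lemma real_primitive (h : R -> R) a x : 0 < a -> a < x ->
  (forall y, 0 < y -> {for y, continuous h}) ->
  is_derive x 1 (fun y => \int[mu]_(t in `[a, y]) h t) (h x).
Proof.
move=> a0 ax ch.
have ih : mu.-integrable `[a, (x + 1)%R] (EFin \o h).
  apply: continuous_compact_integrable; first exact: segment_compact.
  apply: continuous_in_subspaceT => y /[!inE]/= /[!in_itv]/= /andP[ay _].
  by apply: ch; exact: lt_le_trans ay.
have xx1 : x < x + 1 by rewrite ltrDl.
have [d e] := @continuous_FTC1_closed R h a x (x + 1) xx1 ih ax (ch x (lt_trans a0 ax)).
by apply: (DeriveDef d); rewrite -derive1E; exact: e.
Qed.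

Lemma forward_primitive f a : 0 < a -> ccont f -> (forall r, r < a -> f r = 0) ->
  exists P, (forall r, 0 < r -> cder P r (f r)) /\ (forall r, r < a -> P r = 0).
Proof.
move=> a0 cf fa.
pose P y : R[i] := (\int[mu]_(t in `[a / 2, y]) Re (f t)) +i*
                   (\int[mu]_(t in `[a / 2, y]) Im (f t)).
have Pa r : r < a -> P r = 0.
  move=> ra.
  have z (h : R -> R) : (forall r, r < a -> h r = 0) -> \int[mu]_(t in `[a / 2, r]) h t = 0.
    move=> ha; rewrite (@eq_Rintegral _ _ _ mu _ (fun=> 0)); first by rewrite /Rintegral integral0.
    by move=> t; rewrite inE/= in_itv/= => /andP[_ tr]; rewrite ha//; exact: le_lt_trans ra.
  by rewrite /P !z// => t ta; rewrite fa.
exists P; split => // r r0; have [ra|ra] := ltP r a.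
  have oa : open [set y : R | y < a] by exact: open_lt.
  apply: (cder_near (f := fun=> 0) oa _ ra); first by move=> y ya; rewrite Pa.
  by rewrite fa//; exact: cder_cst.
have r2 : a / 2 < r by lra.
have a2 : 0 < a / 2 by rewrite divr_gt0.
by split; apply: real_primitive => // y /cf[].
Qed.

(** The inversion [r -> 1/r] turns primitives from infinity into primitives
    from [0]. *)
Lemma backward_primitive f b : 0 < b -> ccont f -> (forall r, b < r -> f r = 0) ->
  exists P, (forall r, 0 < r -> cder P r (f r)) /\ (forall r, b < r -> P r = 0).
Proof.
move=> b0 cf fb.
have [] := @forward_primitive (fun t => if 0 < t then f t^-1 * ((t ^+ 2)^-1)%:C else 0) b^-1.
- by rewrite invr_gt0.
- move=> x x0.
  have cV : {for x, continuous (fun t : R => t^-1)} by apply: inv_continuous; rewrite gt_eqF.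
  have c2 : {for x, continuous (fun t : R => (t ^+ 2)^-1)}.
    apply: (@continuous_comp _ _ _ (fun t : R => t ^+ 2) (fun t => t^-1)).
      exact: exprn_continuous.
    by apply: inv_continuous; rewrite expf_eq0 gt_eqF.
  have xV : 0 < x^-1 by rewrite invr_gt0.
  have cc (P : R[i] -> R) : P = @Re R \/ P = @Im R ->
      {for x, continuous (fun t : R => P (if 0 < t then f t^-1 * ((t ^+ 2)^-1)%:C else 0))}.
    move=> PE.
    have PM (w : R[i]) (t : R) : P (w * t%:C) = P w * t.
      by case: PE => ->; case: w => p q /=; rewrite mulr0 ?subr0 ?add0r// addrC mul0r add0r.
    have cP : {for x, continuous (fun t : R => P (f t^-1) * (t ^+ 2)^-1)}.
      apply: continuousM c2.
      apply: (@continuous_comp _ _ _ (fun t : R => t^-1) (fun t => P (f t))) cV _.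
      by case: PE => ->; have [] := cf _ xV.
    have e : \forall t \near x, P (f t^-1) * (t ^+ 2)^-1 =
        P (if 0 < t then f t^-1 * ((t ^+ 2)^-1)%:C else 0).
      near=> t; rewrite ifT ?PM//; apply: Rpos_gt0; near: t.
      by apply: (@open_nbhs_nbhs R); split; [exact: open_Rpos|exact/RposP].
    apply: cvg_trans (near_eq_cvg e) _; have /= <- := nbhs_singleton e.
    exact: cP.
  by split; apply: cc; [left|right].
- move=> r rb; case: ifPn => // r0; rewrite fb ?mul0r//.
  by rewrite -(invrK b) ltf_pV2 ?posrE ?invr_gt0.
move=> P [dP Pb]; exists (fun r => - P r^-1); split => [r r0|r br]; last first.
  have r0 := lt_trans b0 br.
  by rewrite Pb ?oppr0// ltf_pV2 ?posrE.
have rV : 0 < r^-1 by rewrite invr_gt0.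
have dV : is_derive r 1 (fun t : R => t^-1) (- (r ^+ 2)^-1).
  have r0' : r != 0 by rewrite gt_eqF.
  by have := @is_deriveV _ id r 1 1 r0' (is_derive_id r 1); rewrite -[_ *: 1]/(_ * 1) mulr1.
apply: cder_eq (cderN (cder_comp dV (dP _ rV))) _.
rewrite rV invrK exprVn invrK -mulrA -rmorphM mulrN mulfV ?rmorphN1 ?mulrN1 ?opprK//.
by rewrite expf_neq0// gt_eqF.
Unshelve. all: by end_near. Qed.

Lemma cincrement_le f (df : R -> R[i]) (q dq : R -> R) a b : a <= b ->
  (forall x, a <= x <= b -> cder f x (df x)) ->
  (forall x, a <= x <= b -> is_derive x 1 q (dq x)) ->
  (forall x, a <= x <= b -> normc (df x) <= dq x) -> normc (f b - f a) <= 2 * (q b - q a).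
Proof.
move=> ab dfd dqd h; apply: le_trans (normc_le _) _.
rewrite mulr_natl mulr2n ReD ReN ImD ImN; apply: lerD.
- apply: (increment_le ab (fun x xab => (dfd x xab).1) dqd) => x xab.
  exact: le_trans (normc_Re _) (h x xab).
- apply: (increment_le ab (fun x xab => (dfd x xab).2) dqd) => x xab.
  exact: le_trans (normc_Im _) (h x xab).
Qed.

End Primitive.

Section GreenInfinity.
Context {R : realType}.
Implicit Types (f g h : R -> R[i]) (a b x r K : R) (al lam : R[i]).

(** The exponent matters only in that [r^(-3/2)] is integrable at infinity. *)
Lemma L2_tail a N : 0 < a -> cmeas N -> (forall r, r < a -> N r = 0) ->
  tail a (- (3 / 4)) N -> L2 N.
Proof.
move=> a0 mN Na [K K0 h].
have h' r : 0 < r -> normc (N r) ^+ 2 <= K ^+ 2 * pw (- 2^-1 - 1) r.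
  move=> r0; have [ra|ar] := ltP r a.
    by rewrite Na// normc0 expr0n/= mulr_ge0 ?sqr_ge0 ?pw_ge0.
  have -> : K ^+ 2 * pw (- 2^-1 - 1) r = (K * pw (- (3 / 4)) r) ^+ 2.
    rewrite (_ : - 2^-1 - 1 = - (3 / 4) + - (3 / 4)); last by field.
    by rewrite (pwD (- (3 / 4))); ring.
  by rewrite lerXn2r ?nnegrE ?normc_ge0 ?mulr_ge0 ?pw_ge0 ?h.
apply/L2P; split => //; apply: (@Rint_pw _ _ 2^-1 (K ^+ 2 * (1 + pw (- 1) a))) => //.
- by apply: measurable_funX; exact: cmeas_normc.
- move=> r r0; rewrite ger0_norm ?sqr_ge0//.
  have [ra|ar] := ltP r a.
    by rewrite Na// normc0 expr0n/= !mulr_ge0 ?sqr_ge0 ?addr_ge0 ?pw_ge0.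
  apply: le_trans (h' r r0) _; rewrite -mulrA ler_wpM2l ?sqr_ge0//.
  rewrite (_ : - 2^-1 - 1 = - 1 + (2^-1 - 1)); last by field.
  rewrite (pwD (- 1)) ler_wpM2r ?pw_ge0//.
  rewrite !pwN !pw1//; have : r^-1 <= a^-1 by rewrite lef_pV2 ?posrE.
  by lra.
- move=> r r0; rewrite ger0_norm ?sqr_ge0//; apply: le_trans (h' r r0) _.
  by rewrite ler_wpM2r ?pw_ge0// ler_peMr ?sqr_ge0// lerDl pw_ge0.
Qed.

(** Green's formula against a test function that is cut off only at infinity;
    the cutoffs [1 - stp (r / n)] have derivatives of size [1 / r] and [1 / r^2],
    so the commutator terms vanish in the limit by dominated convergence. *)
Lemma green_infinity al lam f a Phi : 0 < a -> Lmax al f (fun r => lam * f r) ->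
  csm Rpos Phi -> (forall r, r < a -> Phi r = 0) ->
  tail a (5 / 4) Phi -> tail a 4^-1 (cderive Phi) ->
  tail a (- (3 / 4)) (fun r => Lp al Phi r - lam * Phi r) ->
  cint (fun r => f r * (Lp al Phi r - lam * Phi r)) = 0.
Proof.
move=> a0 [Lf _ hf] sP Pa [K K0 hP] [K1 K10 hP1] [K2 K20 hP2].
have oa : open [set y : R | y < a] by exact: open_lt.
pose N r := Lp al Phi r - lam * Phi r.
have cf := L2_cmeas Lf.
pose chi (n : nat) r : R[i] := 1 - (stp (n.+1%:R^-1 * r))%:C.
have schi n : csm Rpos (chi n).
  apply: csm_Rpos_T; apply: (csmB openT); [exact: csm_cst openT|exact: csm_scale].
pose phi n r := Phi r * chi n r.
have sphi n : csm Rpos (phi n) by exact: csmM open_Rpos sP (schi n).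
have n0 (n : nat) : (0 : R) < n.+1%:R by [].
have ccphi n : Cc_infty Rpos (phi n).
  apply: (Cc_Rpos_intro (a := a) (b := 2 * n.+1%:R)) => //.
    by move=> x xa; rewrite /phi Pa// mul0r.
  move=> x bx; rewrite /phi /chi stp1 ?subrr ?mulr0//.
  by rewrite ler_pdivlMl// mulrC ltW.
have z n : cint (fun r => f r * (Lp al (phi n) r - lam * phi n r)) = 0.
  have Lphi : L2 (phi n) /\ L2 (Lp al (phi n)).
    have [_ [a' [b' [a'0 ab' pa' pb']]]] := Cc_Rpos_elim (ccphi n).
    split; first exact: test_L2 (sphi n) a'0 ab' pa' pb'.
    exact: test_Lp_L2 (sphi n) a'0 ab' pa' pb' al.
  have := hf _ (ccphi n); rewrite LopE// /distr_of_fun => e.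
  have E : cint (fun r => f r * (Lp al (phi n) r - lam * phi n r)) =
      cint (fun r => f r * Lp al (phi n) r - lam * f r * phi n r).
    apply: cint_eq => r _; move: (f r) (Lp al (phi n) r) (phi n r) => *; ring.
  rewrite E cintB ?e ?subrr//; [exact: Cint_L2M Lf Lphi.2|].
  by apply: Cint_L2M Lphi.1; exact: L2Z.
have [C C0 hC] := @stp_scale_bounds R.
have dchi n r : 0 < r -> cderive (chi n) r = - cderive (fun r => (stp (n.+1%:R^-1 * r))%:C) r /\
    cderive (cderive (chi n)) r = - cderive (cderive (fun r => (stp (n.+1%:R^-1 * r))%:C)) r.
  move=> r0; have sS := csm_Rpos_T (@csm_scale R n.+1%:R^-1).
  have d1 y : 0 < y -> cder (chi n) y (0 - cderive (fun r => (stp (n.+1%:R^-1 * r))%:C) y).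
    by move=> y0; exact: cderB (cder_cst 1 y) (csm_cder sS ((RposP y).2 y0)).
  split; first by rewrite (cder_cderive (d1 r r0)) sub0r.
  have e y : Rpos y -> cderive (chi n) y = 0 - cderive (fun r => (stp (n.+1%:R^-1 * r))%:C) y.
    by move=> /Rpos_gt0 y0; rewrite (cder_cderive (d1 y y0)).
  have Ur : Rpos r by exact/RposP.
  rewrite (cderive_ext open_Rpos Ur e (csm_cderive (schi n))).
  rewrite (cder_cderive (cderB (cder_cst 0 r) (csm_cder (csm_cderive sS) Ur))).
  by rewrite sub0r.
have chi1 n r : normc (chi n r) <= 1.
  rewrite /chi (_ : 1 - (stp (n.+1%:R^-1 * r))%:C = (1 - stp (n.+1%:R^-1 * r))%:C); last first.
    by rewrite rmorphB.
  by rewrite normcR ger0_norm ?subr_ge0 ?stp_le1// gerBl stp_ge0.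
have LE n r : 0 < r -> Lp al (phi n) r - lam * phi n r =
    N r * chi n r - 2 * cderive Phi r * cderive (chi n) r
     - Phi r * cderive (cderive (chi n)) r.
  move=> r0; rewrite (Lp_mul al open_Rpos ((RposP r).2 r0) sP (schi n)) /N /phi.
  move: (Lp al Phi r) (Phi r) (chi n r) (cderive Phi r) (cderive (chi n) r)
    (cderive (cderive (chi n)) r) => *; ring.
pose Q r := (K2 + 2 * K1 * C + K * C) * pw (- (3 / 4)) r.
have bd n r : 0 < r -> a <= r -> normc (Lp al (phi n) r - lam * phi n r) <= Q r.
  move=> r0 ar; rewrite LE//.
  have in0 : (0 : R) < n.+1%:R^-1 by rewrite invr_gt0.
  have [c1 c2] := hC n.+1%:R^-1 r in0 r0; have [e1 e2] := dchi n r r0.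
  apply: le_trans (normcB _ _) _; apply: le_trans (lerD (normcB _ _) (lexx _)) _.
  rewrite (normcM (N r)) (normcM (Phi r)) (normcM (2 * _)) (normcM 2 (cderive Phi r)) e1 e2 !normcN.
  have n2 : normc (2 : R[i]) = 2 by rewrite (_ : 2 = 2%:C) ?normcR ?rmorph_nat// ger0_norm.
  rewrite n2.
  have b1 : normc (N r) * normc (chi n r) <= K2 * pw (- (3 / 4)) r.
    by rewrite -[leRHS]mulr1 ler_pM ?normc_ge0 ?chi1// hP2.
  have b2 : 2 * normc (cderive Phi r) * normc (cderive (fun r => (stp (n.+1%:R^-1 * r))%:C) r)
      <= 2 * K1 * C * pw (- (3 / 4)) r.
    rewrite (_ : - (3 / 4) = 4^-1 + - 1); last by field.
    rewrite (pwD 4^-1) pwN1//.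
    have -> : 2 * K1 * C * (pw 4^-1 r * r^-1) = 2 * (K1 * pw 4^-1 r) * (C / r) by ring.
    by rewrite ler_pM ?mulr_ge0 ?normc_ge0// ler_pM2l// hP1.
  have b3 : normc (Phi r) * normc (cderive (cderive (fun r => (stp (n.+1%:R^-1 * r))%:C)) r)
      <= K * C * pw (- (3 / 4)) r.
    rewrite (_ : - (3 / 4) = 5 / 4 + - 2); last by field.
    rewrite (pwD (5 / 4)) (pwN 2) pw2//.
    have -> : K * C * (pw (5 / 4) r * (r ^+ 2)^-1) = (K * pw (5 / 4) r) * (C / r ^+ 2) by ring.
    by rewrite ler_pM ?normc_ge0// hP.
  have -> : Q r = K2 * pw (- (3 / 4)) r + 2 * K1 * C * pw (- (3 / 4)) r +
    K * C * pw (- (3 / 4)) r by rewrite /Q; ring.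
  exact: lerD (lerD b1 b2) b3.
have a20 : 0 < a / 2 by rewrite divr_gt0.
pose D r : R[i] := (Q r * stp (2 / a * r))%:C.
have D1 r : a <= r -> D r = (Q r)%:C.
  move=> ar; rewrite /D stp1 ?mulr1// mulrAC ler_pdivlMr// ler_pM2l//.
have Q0 r : 0 <= Q r by rewrite /Q mulr_ge0 ?pw_ge0// !addr_ge0 ?mulr_ge0.
have mD : cmeas D.
  apply: ccont_meas; apply: ccont_real => r r0; apply: continuousM.
    apply: continuousM; first exact: cst_continuous.
    exact: pw_cont.
  by have [] := csm_ccont (csm_Rpos_T (@csm_scale R (2 / a))) r0.
have LD : L2 D.
  apply: (L2_tail a20 mD) => [r ra|].
    by rewrite /D stp0 ?mulr0// mulrAC ler_pdivrMr// mul1r; lra.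
  exists (K2 + 2 * K1 * C + K * C) => [|r r0 ar]; first by rewrite !addr_ge0 ?mulr_ge0.
  rewrite /D normcR ger0_norm; last exact: mulr_ge0 (Q0 r) (stp_ge0 _).
  by rewrite -[leRHS]mulr1 ler_wpM2l ?stp_le1.
have [||||_ c] := @cint_dct R (fun n r => f r * (Lp al (phi n) r - lam * phi n r))
  (fun r => f r * N r) (fun r => normc (f r * D r)).
- move=> n; apply: cmeasM => //; apply: ccont_meas; apply: csm_ccont.
  by apply: (csmB open_Rpos); [exact: csm_Lp|exact: csmZ open_Rpos (sphi n)].
- move=> r r0; apply: (ccvg_norm0 (v := fun=> 0)); last exact: cvg_cst.
  near=> n; rewrite (_ : Lp al (phi n) r - lam * phi n r = N r) ?subrr ?normc0//.
  have nr : n.+1%:R^-1 * r < 1.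
    rewrite mulrC ltr_pdivrMr// mul1r.
    have : r <= n%:R by near: n; exact: nbhs_infty_ger.
    by move=> /le_lt_trans; apply; rewrite ltr_nat.
  have on : open [set y : R | y < n.+1%:R] by exact: open_lt.
  have rn : r < n.+1%:R by move: nr; rewrite mulrC ltr_pdivrMr// mul1r.
  have e y : y < n.+1%:R -> phi n y = Phi y.
    by move=> yn; rewrite /phi /chi stp0 ?subr0 ?mulr1// mulrC ler_pdivrMr// mul1r ltW.
  have oU := openI on (@open_Rpos R).
  have Ur : ([set y : R | y < n.+1%:R] `&` Rpos) r by split => //; exact/RposP.
  rewrite (Lp_ext al oU Ur (fun y Uy => e y Uy.1)) ?e//.
  by apply: csm_sub (sphi n) => y [].
- exact: Cint_normc (Cint_L2M Lf LD).
- move=> n r r0; rewrite !(normcM (f r)) ler_wpM2l ?normc_ge0//.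
  have [ra|ar] := ltP r a.
    rewrite (Lp_0 al oa ra); last by move=> y ya; rewrite /phi Pa// mul0r.
    by rewrite /phi Pa// mul0r mulr0 subr0 normc0 normc_ge0.
  by rewrite D1// normcR (le_trans (bd n r r0 ar))// ler_norm.
by apply: (ccvg_uniq c); rewrite (_ : (fun n => _) = fun=> 0);
  [exact: ccvg_cst|apply/funext => n; exact: z].
Unshelve. all: by end_near. Qed.

End GreenInfinity.

(** * Absence of nonnegative eigenvalues *)

Section NoNonnegativeEigenvalue.
Context {R : realType}.
Implicit Types (f g h P psi : R -> R[i]) (a b x r K N : R) (al lam : R[i]).

(** The weight is proportional to the derivative of [expR (- (N / r))]: each
    integration against it gains a factor [1 / N]. *)
Definition wt N r : R := pw (- 2) r * expR (- (N / r)).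

Lemma wt_ge0 N r : 0 <= wt N r.
Proof. exact: mulr_ge0 (pw_ge0 _ _) (expR_ge0 _). Qed.

Lemma wt_tail N a e f K : 0 <= N -> 0 < a -> 0 <= K -> - 2 <= e ->
  (forall r, 0 < r -> normc (f r) <= K * wt N r) -> tail a e f.
Proof.
move=> N0 a0 K0 e2 h; apply: (tail_le a0 e2); exists K => // r r0 _.
apply: le_trans (h r r0) _; rewrite ler_wpM2l// ler_piMr ?pw_ge0//.
by rewrite -expR0 ler_expR oppr_le0 divr_ge0// ltW.
Qed.

Lemma is_derive_wt N K r : 0 < N -> 0 < r ->
  is_derive r 1 (fun r => K / N * expR (- (N / r))) (K * wt N r).
Proof.
move=> N0 r0; have r0' : r != 0 by rewrite gt_eqF.
have dV := @is_deriveV _ id r 1 1 r0' (is_derive_id r 1).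
have d := is_deriveZ (K / N) (is_derive1_comp (is_derive_expR _)
  (is_deriveN (is_deriveZ N dV))).
apply: is_derive_eq d _.
rewrite /wt pwN pw2// -[_ *: 1]/(_ * 1) -![_ *: _]/(_ * _).
by field; rewrite r0' gt_eqF.
Qed.

(** The bound on [g] is the derivative of the bound on [P]; the factor [2] comes
    from treating real and imaginary parts separately. *)
Lemma wt_primitive_le P g a K N : 0 < a -> 0 < N -> 0 <= K ->
  (forall r, 0 < r -> cder P r (g r)) -> (forall r, r < a -> P r = 0) ->
  (forall r, 0 < r -> normc (g r) <= K * wt N r) ->
  forall r, 0 < r -> normc (P r) <= 2 * (K / N * expR (- (N / r))).
Proof.
move=> a0 N0 K0 dP Pa h r r0.
have E0 x : 0 <= K / N * expR (- (N / x)) by rewrite mulr_ge0 ?expR_ge0 ?divr_ge0// ltW.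
have [ra|ar] := ltP r a; first by rewrite Pa// normc0 mulr_ge0.
have a2r : a / 2 <= r by lra.
have a20 : 0 < a / 2 by rewrite divr_gt0.
have p0 x : a / 2 <= x <= r -> 0 < x by move=> /andP[/(lt_le_trans a20)].
have := cincrement_le a2r (fun x xr => dP x (p0 x xr))
  (fun x xr => is_derive_wt K N0 (p0 x xr)) (fun x xr => h x (p0 x xr)).
rewrite (Pa (a / 2)) ?subr0; last by lra.
by move=> /le_trans; apply; rewrite ler_pM2l// gerBl.
Qed.

Lemma L2_dom f g K : cmeas f -> L2 g -> 0 <= K ->
  (forall r, 0 < r -> normc (f r) <= K * normc (g r)) -> L2 f.
Proof.
move=> mf Lg K0 h; apply: (L2_intro (q := fun r => K ^+ 2 * normc (g r) ^+ 2)) => // [r r0|].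
  by rewrite -exprMn lerXn2r ?nnegrE ?h// ?normc_ge0// mulr_ge0 ?normc_ge0.
by apply: RintZ; exact: L2_Rint.
Qed.

(** Iterating the replacement [n] times bounds the pairing by [2^(- n)] times the
    integral of [`|f| W]. *)
Lemma contraction_pairing0 f (C : set (R -> R[i])) (W : R -> R) :
  L2 f -> L2 (fun r => (W r)%:C) -> (forall r, 0 < r -> 0 <= W r) ->
  (forall psi, C psi -> cmeas psi) ->
  (forall psi K, C psi -> 0 <= K -> (forall r, 0 < r -> normc (psi r) <= K * W r) ->
    exists psi', [/\ C psi', (forall r, 0 < r -> normc (psi' r) <= K / 2 * W r) &
      cint (fun r => f r * psi r) = cint (fun r => f r * psi' r)]) ->
  forall psi K, C psi -> 0 <= K -> (forall r, 0 < r -> normc (psi r) <= K * W r) ->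
    cint (fun r => f r * psi r) = 0.
Proof.
move=> Lf LW W0 mC step psi K Cp K0 h.
pose M := 2 * rI (fun r => normc (f r * (W r)%:C)).
have IW := Cint_normc (Cint_L2M Lf LW).
have bound n : forall psi K, C psi -> 0 <= K ->
    (forall r, 0 < r -> normc (psi r) <= K * W r) ->
    normc (cint (fun r => f r * psi r)) <= K * (2^-1) ^+ n * M.
  elim: n => [|n IH] {psi K Cp K0 h} psi K Cp K0 h.
    have Lpsi : L2 psi.
      by apply: (L2_dom (mC _ Cp) LW K0) => r r0; rewrite normcR (ger0_norm (W0 r r0)) h.
    rewrite expr0 mulr1 /M mulrCA -rIZ//.
    apply: normc_cint; [exact: Cint_L2M Lf Lpsi|exact: RintZ|].
    move=> r r0; rewrite !(normcM (f r)) mulrCA ler_wpM2l ?normc_ge0//.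
    by rewrite normcR (ger0_norm (W0 r r0)) h.
  have [psi' [Cp' h' ->]] := step _ _ Cp K0 h.
  apply: le_trans (IH _ _ Cp' _ h') _; first exact: divr_ge0.
  by rewrite exprS !mulrA.
apply/eqP; rewrite -normc_eq0 -normr_le0 (ger0_norm (normc_ge0 _)).
apply/ler_addgt0Pr => e e0; rewrite add0r.
have : (fun n => K * M * (2^-1) ^+ n) @ \oo --> (K * M * 0 : R).
  apply: cvgMr; apply: cvg_expr; rewrite ger0_norm ?invr_ge0//; lra.
rewrite mulr0 => /cvgrPdist_le /(_ e e0)[n _ /(_ n (leqnn n))].
rewrite sub0r normrN => hn; apply: le_trans (bound n _ _ Cp K0 h) _.
by apply: le_trans hn; rewrite mulrAC ler_norm.
Qed.

Lemma compact_wt g a b N : 0 < a -> 0 <= N -> ccont g -> (forall r, r < a -> g r = 0) ->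
  (forall r, b < r -> g r = 0) ->
  exists2 K, 0 <= K & forall r, 0 < r -> normc (g r) <= K * wt N r.
Proof.
move=> a0 N0 cg ga gb; have [K K0 h] := ccont_bounded b a0 cg.
have C0 : 0 <= K * (pw 2 (a + `|b|) * expR (N / a)).
  exact: mulr_ge0 K0 (mulr_ge0 (pw_ge0 _ _) (expR_ge0 _)).
exists (K * (pw 2 (a + `|b|) * expR (N / a))) => // r r0.
have W0 := wt_ge0 N r; have CW := mulr_ge0 C0 W0.
have [ra|ar] := ltP r a; first by rewrite ga// normc0.
have [br|rb] := ltP b r; first by rewrite gb// normc0.
apply: le_trans (h r _) _; first by rewrite ar rb.
rewrite -mulrA ler_peMr// /wt.
have -> : pw 2 (a + `|b|) * expR (N / a) * (pw (- 2) r * expR (- (N / r))) =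
    (pw 2 (a + `|b|) / pw 2 r) * (expR (N / a) * expR (- (N / r))) by rewrite pwN; ring.
rewrite -[leLHS]mul1r; apply: ler_pM => //.
  rewrite ler_pdivlMr ?pw_gt0// mul1r ler_pw//.
  by have := ler_norm b; lra.
by rewrite -expRD -expR0 ler_expR subr_ge0 ler_wpM2l// lef_pV2 ?posrE.
Qed.

Section Oscillating.
Variables (al : R[i]) (w : R) (f : R -> R[i]).
Hypotheses (w0 : 0 < w) (hf : Lmax al f (fun r => (w ^+ 2)%:C * f r)).

Local Notation q := (al - 4^-1).
(** Large enough for [osc_step] to halve the weight. *)
Let N : R := 4 * (normc q + 1) / w.

Let q1 : 0 < normc q + 1. Proof. by rewrite ltr_wpDl ?normc_ge0. Qed.
Let N0 : 0 < N. Proof. by rewrite divr_gt0// mulr_gt0. Qed.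

Let iw : R[i] := 0 +i* w.
Let iwE : iw * iw = - (w ^+ 2)%:C.
Proof. by apply/eqP; rewrite eq_complex/= !mul0r !mulr0 addr0 oppr0 sub0r expr2 !eqxx. Qed.
Let iwN0 : iw != 0. Proof. by rewrite eq_complex/= negb_and (gt_eqF w0) orbT. Qed.

Let ewv (z : R[i]) r : z = iw \/ z = - iw -> normc (cexp (z * r%:C)) = 1.
Proof.
move=> h; rewrite normc_cexp (_ : Re _ = 0) ?expR0//.
by case: h => -> /=; rewrite ?oppr0 !(mul0r, mulr0) subr0.
Qed.

(** [f] pairs identically with [psi] and with [(alpha - 1/4) r^-2 phi], where
    [phi] solves [phi'' + w^2 phi = psi] from [0]; the weight is halved. *)
Lemma osc_step psi a K : 0 < a -> 0 <= K -> csm Rpos psi -> (forall r, r < a -> psi r = 0) ->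
  (forall r, 0 < r -> normc (psi r) <= K * wt N r) ->
  exists psi', [/\ csm Rpos psi', (forall r, r < a -> psi' r = 0),
    (forall r, 0 < r -> normc (psi' r) <= K / 2 * wt N r) &
    cint (fun r => f r * psi r) = cint (fun r => f r * psi' r)].
Proof.
move=> a0 K0 sp pa h.
pose ep r := cexp (iw * r%:C); pose em r := cexp (- iw * r%:C).
have sep : csm Rpos ep by exact: csm_cexp open_Rpos.
have sem : csm Rpos em by exact: csm_cexp open_Rpos.
have epm r : ep r * em r = 1 by rewrite -cexpD mulNr subrr cexp0.
have sgm : csm Rpos (fun r => em r * psi r) by exact: csmM open_Rpos sem sp.
have sgp : csm Rpos (fun r => ep r * psi r) by exact: csmM open_Rpos sep sp.
have ga (e : R -> R[i]) r : r < a -> e r * psi r = 0 by move=> ra; rewrite pa// mulr0.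
have [A [dA Aa]] := forward_primitive a0 (csm_ccont sgm) (ga em).
have [B [dB Ba]] := forward_primitive a0 (csm_ccont sgp) (ga ep).
have sA : csm Rpos A by apply: (csm_intro open_Rpos _ sgm) => r /Rpos_gt0; exact: dA.
have sB : csm Rpos B by apply: (csm_intro open_Rpos _ sgp) => r /Rpos_gt0; exact: dB.
have nep r : normc (ep r) = 1 by apply: ewv; left.
have nem r : normc (em r) = 1 by apply: ewv; right.
have hA r : 0 < r -> normc (A r) <= 2 * (K / N * expR (- (N / r))).
  by apply: (wt_primitive_le a0 N0 K0 dA Aa) => y y0; rewrite (normcM (em y)) nem mul1r h.
have hB r : 0 < r -> normc (B r) <= 2 * (K / N * expR (- (N / r))).
  by apply: (wt_primitive_le a0 N0 K0 dB Ba) => y y0; rewrite (normcM (ep y)) nep mul1r h.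
pose phi r := (2 * iw)^-1 * (ep r * A r - em r * B r).
pose phi1 r := 2^-1 * (ep r * A r + em r * B r).
have dep r : cder ep r (iw * ep r).
  apply: cder_eq (cder_cexp (cderZ iw (cder_real (is_derive_id r 1)))) _.
  by rewrite mulr1.
have dem r : cder em r (- iw * em r).
  apply: cder_eq (cder_cexp (cderZ (- iw) (cder_real (is_derive_id r 1)))) _.
  by rewrite mulr1.
have d1 r : 0 < r -> cder phi r (phi1 r).
  move=> r0; apply: cder_eq (cderZ (2 * iw)^-1 (cderB (cderM (dep r) (dA r r0))
    (cderM (dem r) (dB r r0)))) _.
  by rewrite /phi1; move: (ep r) (em r) (A r) (B r) (psi r) => *; field.
have d2 r : 0 < r -> cder phi1 r (psi r - (w ^+ 2)%:C * phi r).
  move=> r0; apply: cder_eq (cderZ 2^-1 (cderD (cderM (dep r) (dA r r0))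
    (cderM (dem r) (dB r r0)))) _.
  have -> : ep r * (em r * psi r) = psi r by rewrite mulrA epm mul1r.
  have -> : em r * (ep r * psi r) = psi r by rewrite mulrA (mulrC (em r)) epm mul1r.
  have -> : (w ^+ 2)%:C = - (iw * iw) by rewrite iwE opprK.
  by rewrite /phi; move: (ep r) (em r) (A r) (B r) (psi r) => *; field.
have sphi : csm Rpos phi.
  apply: (csmZ _ open_Rpos); apply: (csmB open_Rpos); apply: (csmM open_Rpos) => //.
have phia r : r < a -> phi r = 0 by move=> ra; rewrite /phi Aa// Ba// !mulr0 subrr mulr0.
have hphi r : 0 < r -> normc (phi r) <= 2 * K / (w * N) * expR (- (N / r)).
  move=> r0; rewrite (normcM (2 * iw)^-1).
  have -> : normc (2 * iw)^-1 = (2 * w)^-1.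
    have nz : 2 * iw != 0 by rewrite mulf_neq0// pnatr_eq0.
    have e1 : normc (2 * iw) = 2 * w.
      rewrite (normcM 2) (_ : normc (2 : R[i]) = 2); last first.
        by rewrite (_ : 2 = 2%:C) ?normcR ?rmorph_nat// ger0_norm.
      by rewrite /iw/= expr0n add0r sqrtr_sqr gtr0_norm.
    have e2 : normc (2 * iw) * normc (2 * iw)^-1 = 1 by rewrite -normcM mulfV// normcR normr1.
    by rewrite -e1 -[RHS]mulr1 -e2 mulKf// normc_eq0.
  have -> : 2 * K / (w * N) * expR (- (N / r)) = (2 * w)^-1 *
      (2 * (K / N * expR (- (N / r))) + 2 * (K / N * expR (- (N / r)))).
    by field; rewrite !gt_eqF.
  rewrite ler_wpM2l ?invr_ge0 ?mulr_ge0 ?(ltW w0)//; apply: le_trans (normcB _ _) _.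
  by rewrite (normcM (ep r)) (normcM (em r)) nep nem !mul1r lerD ?hA ?hB.
have hphi1 r : 0 < r -> normc (phi1 r) <= 2 * (K / N) * expR (- (N / r)).
  move=> r0; rewrite (normcM 2^-1).
  have -> : normc (2^-1 : R[i]) = 2^-1.
    by rewrite (_ : (2^-1 : R[i]) = (2^-1)%:C) ?normcR ?ger0_norm ?invr_ge0// fmorphV rmorph_nat.
  have -> : 2 * (K / N) * expR (- (N / r)) = 2^-1 *
      (2 * (K / N * expR (- (N / r))) + 2 * (K / N * expR (- (N / r)))) by field; rewrite gt_eqF.
  rewrite ler_wpM2l ?invr_ge0//; apply: le_trans (normcD _ _) _.
  by rewrite (normcM (ep r)) (normcM (em r)) nep nem !mul1r lerD ?hA ?hB.
pose psi' r := q * ((r ^+ 2)^-1)%:C * phi r.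
have hpsi' r : 0 < r -> normc (psi' r) <= K / 2 * wt N r.
  move=> r0; rewrite (normcM (_ * _)) (normcM q) normcR ger0_norm ?invr_ge0 ?sqr_ge0//.
  apply: le_trans (ler_wpM2l _ (hphi r r0)) _; first by rewrite mulr_ge0 ?normc_ge0 ?invr_ge0 ?sqr_ge0.
  have -> : normc q / r ^+ 2 * (2 * K / (w * N) * expR (- (N / r))) =
      normc q * 2 * K / (w * N) * wt N r by rewrite /wt (pwN 2) pw2//; ring.
  rewrite ler_wpM2r ?wt_ge0// (_ : w * N = 4 * (normc q + 1)); last by rewrite /N; field; rewrite gt_eqF.
  rewrite ler_pdivrMr ?mulr_gt0//.
  have := normc_ge0 q; move: (normc q) => y y0; rewrite (_ : K / 2 * _ = 2 * K * (y + 1)); last by field.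
  have := mulr_ge0 K0 y0; lra.
have spsi' : csm Rpos psi' by apply: (csmM open_Rpos) => //; exact: csm_V.
exists psi'; split => //; first by move=> r ra; rewrite /psi' phia// mulr0.
have LE r : 0 < r -> Lp al phi r - (w ^+ 2)%:C * phi r = psi' r - psi r.
  move=> r0; rewrite (Lp_cder _ r0 sphi d1 (d2 r r0)) /psi'.
  by move: (phi r) (psi r) ((r ^+ 2)^-1)%:C ((w ^+ 2)%:C) => *; ring.
have cphi r : 0 < r -> cderive phi r = phi1 r by move=> r0; exact: cder_cderive (d1 r r0).
have Lpsi : L2 psi.
  apply: (L2_tail a0) => //; first exact: ccont_meas (csm_ccont sp).
  by apply: (wt_tail (ltW N0) a0 K0) h; lra.
have Lpsi' : L2 psi'.
  apply: (L2_tail a0); first exact: ccont_meas (csm_ccont spsi').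
    by move=> r ra; rewrite /psi' phia// mulr0.
  by apply: (wt_tail (ltW N0) a0 _) hpsi'; [exact: divr_ge0|lra].
have tl0 (g : R -> R[i]) C : 0 <= C ->
    (forall r, 0 < r -> normc (g r) <= C * expR (- (N / r))) -> tail a 0 g.
  move=> C0 hg; exists C => // r r0 _; apply: le_trans (hg r r0) _.
  rewrite ler_wpM2l// pw0 -expR0 ler_expR oppr_le0 divr_ge0// ltW//.
have wN : 0 < w * N by rewrite mulr_gt0.
have := green_infinity a0 hf sphi phia.
have -> : cint (fun r => f r * (Lp al phi r - (w ^+ 2)%:C * phi r)) =
    cint (fun r => f r * psi' r) - cint (fun r => f r * psi r).
  have [Lf _ _] := hf.
  rewrite -cintB; [|exact: Cint_L2M Lf Lpsi'|exact: Cint_L2M Lf Lpsi].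
  by apply: cint_eq => r r0; rewrite LE// mulrBr.
move=> /(_ _ _ _)/eqP; rewrite subr_eq0 => H; apply/esym/eqP/H.
- apply: (tail_le a0 _ (tl0 _ _ _ hphi)); first by lra.
  by apply: divr_ge0 (ltW wN); exact: mulr_ge0.
- have : tail a 4^-1 phi1.
    apply: (tail_le a0 _ (tl0 _ _ _ hphi1)); first by lra.
    by apply: mulr_ge0 => //; exact: divr_ge0 K0 (ltW N0).
  by apply: ord_ext => r r0; rewrite cphi.
- have : tail a (- (3 / 4)) (fun r => psi' r - psi r).
    apply: ordB; last by apply: (wt_tail (ltW N0) a0 K0) h; lra.
    by apply: (wt_tail (ltW N0) a0 _) hpsi'; [exact: divr_ge0|lra].
  by apply: ord_ext => r r0; rewrite LE.
Qed.

Lemma osc_pairing0 psi a K : 0 < a -> 0 <= K -> csm Rpos psi -> (forall r, r < a -> psi r = 0) ->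
  (forall r, 0 < r -> normc (psi r) <= K * wt N r) -> cint (fun r => f r * psi r) = 0.
Proof.
move=> a0 K0 sp pa h; have [Lf _ _] := hf.
(* the cutoff makes the weight square integrable near [0] *)
pose W r : R := wt N r * stp (2 / a * r).
have W0 r : 0 <= W r by exact: mulr_ge0 (wt_ge0 _ _) (stp_ge0 _).
have WE r : a <= r -> W r = wt N r.
  by move=> ar; rewrite /W stp1 ?mulr1// mulrAC ler_pdivlMr// ler_pM2l.
have Wle r : W r <= wt N r by rewrite /W ler_piMr ?wt_ge0 ?stp_le1.
have a20 : 0 < a / 2 by rewrite divr_gt0.
have LW : L2 (fun r => (W r)%:C).
  apply: (L2_tail a20) => [|r ra|].
  - apply: ccont_meas; apply: ccont_real => r r0; apply: continuousM.
      apply: continuousM; first exact: pw_cont.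
      apply: continuous_comp; last exact: continuous_expR.
      apply: continuousN; apply: continuousM; first exact: cst_continuous.
      by apply: inv_continuous; rewrite gt_eqF.
    by have [] := csm_ccont (csm_Rpos_T (@csm_scale R (2 / a))) r0.
  - by rewrite /W stp0 ?mulr0// mulrAC ler_pdivrMr// mul1r; lra.
  - apply: (wt_tail (ltW N0) a20 ler01); first by lra.
    by move=> r r0; rewrite normcR ger0_norm// mul1r.
apply: (contraction_pairing0 (C := [set g | csm Rpos g /\ forall r, r < a -> g r = 0])
    (W := W) Lf LW (fun r _ => W0 r) _ _ _ K0) => //.
- by move=> g [sg _]; exact: ccont_meas (csm_ccont sg).
- move=> g L [sg ga] L0 hg.
  have hg' r : 0 < r -> normc (g r) <= L * wt N r.
    by move=> r0; apply: le_trans (hg r r0) _; rewrite ler_wpM2l.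
  have [g' [sg' ga' h' E]] := osc_step a0 L0 sg ga hg'.
  exists g'; split => // r r0; have [ra|ar] := ltP r a; last by rewrite WE ?h'.
  by rewrite ga'// normc0 mulr_ge0// divr_ge0.
- move=> r r0; have [ra|ar] := ltP r a; last by rewrite WE ?h.
  by rewrite pa// normc0 mulr_ge0.
Qed.

(** No boundary condition enters: the functions produced by [osc_step] vanish
    near [0]. *)
Lemma no_positive_eigenvalue : zeroL2 f.
Proof.
have [Lf _ _] := hf; apply: zeroL2_test => // psi a b sp a0 ab pa pb.
have [K K0 h] := compact_wt a0 (ltW N0) (csm_ccont sp) pa pb.
exact: osc_pairing0 a0 K0 sp pa h.
Qed.

End Oscillating.

(** Variation of constants for [L_0], with the solutions [r^(1/2)] and
    [r^(1/2) ln r]. *)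
Lemma log_kernel psi P Q : csm Rpos psi ->
  (forall r, 0 < r -> cder P r (cpowR r 2^-1 * psi r)) ->
  (forall r, 0 < r -> cder Q r (cpowR r 2^-1 * (ln r)%:C * psi r)) ->
  let phi r := cpowR r 2^-1 * (Q r - (ln r)%:C * P r) in
  [/\ csm Rpos phi, (forall r, 0 < r -> Lp 0 phi r = psi r) &
    (forall r, 0 < r -> cder phi r
       (cpowR r (2^-1 - 1) * (2^-1 * (Q r - (ln r)%:C * P r) - P r)))].
Proof.
move=> sp dP dQ phi.
have sh := csm_cpowR (2^-1 : R[i]); have sl := @csm_ln R.
have sP : csm Rpos P.
  by apply: (csm_intro open_Rpos (fun r Ur => dP r (Rpos_gt0 Ur))); exact: csmM open_Rpos sh sp.
have sQ : csm Rpos Q.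
  apply: (csm_intro open_Rpos (fun r Ur => dQ r (Rpos_gt0 Ur))).
  by apply: (csmM open_Rpos) => //; exact: csmM open_Rpos sh sl.
have sphi : csm Rpos phi.
  by apply: (csmM open_Rpos sh); apply: (csmB open_Rpos sQ); exact: csmM open_Rpos sl sP.
have half r : 0 < r -> cpowR r (2^-1 : R[i]) * cpowR r 2^-1 = r%:C.
  by move=> r0; rewrite -cpowRD (_ : 2^-1 + 2^-1 = 1 :> R[i]) ?cpowR1//; field.
have dE r : 0 < r -> cder (fun r => Q r - (ln r)%:C * P r) r (- ((r^-1)%:C * P r)).
  move=> r0; apply: cder_eq (cderB (dQ r r0) (cderM (cder_ln r0) (dP r r0))) _.
  by move: (P r) (psi r) (cpowR r _) => *; ring.
have d1 r : 0 < r -> cder phi r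
    (cpowR r (2^-1 - 1) * (2^-1 * (Q r - (ln r)%:C * P r) - P r)).
  move=> r0; apply: cder_eq (cderM (cder_cpowR 2^-1 r0) (dE r r0)) _.
  rewrite (cpowRD r _ (-1)) cpowRN1//.
  by move: (P r) (Q r) (cpowR r _) => *; ring.
split => // r r0.
rewrite (Lp_cder 0 r0 sphi d1 (cderM (cder_cpowR (2^-1 - 1) r0)
  (cderB (cderZ 2^-1 (dE r r0)) (dP r r0)))) /phi.
rewrite !(cpowRD r _ (-1)) !cpowRN1//.
have -> : ((r ^+ 2)^-1)%:C = (r^-1)%:C * (r^-1)%:C :> R[i] by rewrite -rmorphM expr2 invfM.
have h1 : cpowR r (2^-1 : R[i]) * cpowR r 2^-1 * (r^-1)%:C = 1.
  by rewrite half// -rmorphM mulfV ?gt_eqF.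
transitivity (cpowR r 2^-1 * cpowR r 2^-1 * (r^-1)%:C * psi r); last by rewrite h1 mul1r.
by move: (P r) (Q r) (psi r) (r^-1)%:C (cpowR r _) (ln r)%:C => *; field.
Qed.

(** The forward solution of [L_0 phi = psi] grows at most like [r^(1/2) ln r],
    which [green_infinity] admits, and [lambda = 0] leaves no remainder. *)
Lemma no_zero_eigenvalue f : Lmax 0 f (fun r => 0 * f r) -> zeroL2 f.
Proof.
move=> hf; have [Lf _ _] := hf; apply: zeroL2_test => // psi a b sp a0 ab pa pb.
have sh := csm_cpowR (2^-1 : R[i]); have sl := @csm_ln R.
pose g1 r := cpowR r 2^-1 * psi r; pose g2 r := cpowR r 2^-1 * (ln r)%:C * psi r.
have s1 : csm Rpos g1 by exact: csmM open_Rpos sh sp.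
have s2 : csm Rpos g2.
  by apply: (csmM open_Rpos) => //; exact: csmM open_Rpos sh sl.
have z1 r : r < a -> g1 r = 0 by move=> ra; rewrite /g1 pa// mulr0.
have z2 r : r < a -> g2 r = 0 by move=> ra; rewrite /g2 pa// mulr0.
have y1 r : b < r -> g1 r = 0 by move=> ra; rewrite /g1 pb// mulr0.
have y2 r : b < r -> g2 r = 0 by move=> ra; rewrite /g2 pb// mulr0.
have [P [dP Pa]] := forward_primitive a0 (csm_ccont s1) z1.
have [Q [dQ Qa]] := forward_primitive a0 (csm_ccont s2) z2.
have [K1 K10 h1] := compact_wt a0 ler01 (csm_ccont s1) z1 y1.
have [K2 K20 h2] := compact_wt a0 ler01 (csm_ccont s2) z2 y2.
have tP g K : 0 <= K -> (forall r, 0 < r -> normc (g r) <= 2 * (K / 1 * expR (- (1 / r)))) ->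
    tail a 0 g.
  move=> K0 h; exists (2 * K) => [|r r0 _]; first exact: mulr_ge0.
  apply: le_trans (h r r0) _; rewrite divr1 mulrA ler_wpM2l ?mulr_ge0//.
  by rewrite pw0 -expR0 ler_expR oppr_le0 divr_ge0// ltW.
have oP := tP _ _ K10 (wt_primitive_le a0 ltr01 K10 dP Pa h1).
have oQ := tP _ _ K20 (wt_primitive_le a0 ltr01 K20 dQ Qa h2).
have [sphi Lphi dphi] := log_kernel sp dP dQ.
set phi := fun _ => _ in sphi Lphi dphi.
have h4 : (0 : R) < 4^-1 by rewrite invr_gt0.
have oE : tail a 4^-1 (fun r => Q r - (ln r)%:C * P r).
  apply: ordB; first by apply: tail_le oQ; rewrite ?ltW.
  by rewrite -[4^-1]addr0; apply: ordM oP; exact: tail_ln.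
have E : cint (fun r => f r * psi r) = cint (fun r => f r * (Lp 0 phi r - 0 * phi r)).
  by apply: cint_eq => r r0; rewrite Lphi// mul0r subr0.
rewrite E; apply: (green_infinity a0 hf sphi).
- by move=> r ra; rewrite /phi Pa// Qa// mulr0 subr0 mulr0.
- have := ordM (ord_cpowR [set r | a <= r] (2^-1 : R[i])) oE; apply: tail_le a0 _.
  by rewrite Re_half; lra.
- have h : tail a 4^-1 (fun r => cpowR r (2^-1 - 1) *
      (2^-1 * (Q r - (ln r)%:C * P r) - P r)).
    have o : tail a 4^-1 (fun r => 2^-1 * (Q r - (ln r)%:C * P r) - P r).
      by apply: ordB; [exact: ordZ|apply: tail_le oP; rewrite ?ltW].
    have := ordM (ord_cpowR [set r | a <= r] (2^-1 - 1 : R[i])) o; apply: tail_le a0 _.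
    by rewrite ReD ReN Re_half/=; lra.
  by apply: ord_ext h => r r0; rewrite (cder_cderive (dphi r r0)).
- have [K K0 hK] := compact_wt a0 ler01 (csm_ccont sp) pa pb.
  have : tail a (- (3 / 4)) psi by apply: (wt_tail ler01 a0 K0) hK; lra.
  by apply: ord_ext => r r0; rewrite Lphi// mul0r subr0.
Qed.

End NoNonnegativeEigenvalue.

(** * Uniqueness of the eigenvalue for the logarithmic boundary condition *)

Section Pairing.
Context {R : realType}.
Implicit Types (f g h H Phi psi : R -> R[i]) (a b x r K : R) (al lam c : R[i]).
Local Notation mu := (@lebesgue_measure R).

Lemma L2B f g : L2 f -> L2 g -> L2 (fun r => f r - g r).
Proof.
move=> Lf Lg; apply: (L2_intro (q := fun r => 2 * normc (f r) ^+ 2 + 2 * normc (g r) ^+ 2)).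
- exact: cmeasB (L2_cmeas Lf) (L2_cmeas Lg).
- move=> r _; have n := normcB (f r) (g r).
  have := normc_ge0 (f r - g r); have := normc_ge0 (f r); have := normc_ge0 (g r).
  move: n; move: (normc (f r - g r)) (normc (f r)) (normc (g r)) => x y z h z0 y0 x0.
  apply: (@le_trans _ _ ((y + z) ^+ 2)); first by rewrite lerXn2r ?nnegrE// addr_ge0.
  by rewrite -subr_ge0 (_ : _ - _ = (y - z) ^+ 2) ?sqr_ge0//; ring.
- by apply: RintD; apply: RintZ; exact: L2_Rint.
Qed.

(** The Cauchy-Schwarz inequality, in the form [2 u v <= u^2 / d + d v^2]. *)
Lemma cint_L2_small f g (d : R) : 0 < d -> L2 f -> L2 g ->
  (sqnormL2 f < (d ^+ 2)%:E)%E ->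
  normc (cint (fun r => f r * g r)) <= d * (1 + rI (fun r => normc (g r) ^+ 2)).
Proof.
move=> d0 Lf Lg; have If := L2_Rint Lf; have Ig := L2_Rint Lg.
rewrite (sqnormL2E If) lte_fin => fd.
pose q r := (2 * d)^-1 * normc (f r) ^+ 2 + d / 2 * normc (g r) ^+ 2.
have Iq : Rint q by apply: RintD; exact: RintZ.
have dn : d != 0 by rewrite gt_eqF.
apply: le_trans (normc_cint (Cint_L2M Lf Lg) Iq _) _.
  move=> r r0; rewrite (normcM (f r)) /q; move: (normc (f r)) (normc (g r)) => u v.
  rewrite -subr_ge0 (_ : _ - _ = (2 * d)^-1 * (u - d * v) ^+ 2); last by field.
  by rewrite mulr_ge0 ?sqr_ge0// invr_ge0 mulr_ge0// ltW.
rewrite /q rID; [|exact: RintZ|exact: RintZ].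
rewrite (rIZ _ If) (rIZ _ Ig).
move: (rI (fun r => normc (f r) ^+ 2)) (rI (fun r => normc (g r) ^+ 2)) fd => u v ud.
have h : 2 * ((2 * d)^-1 * u + d / 2 * v) = d^-1 * u + d * v by field.
by rewrite h mulrDr mulr1 lerD2r mulrC ler_pdivrMr// -expr2 ltW.
Qed.

Lemma cint_zeroL2 f g : zeroL2 f -> cmeas f -> cmeas g -> cint (fun r => f r * g r) = 0.
Proof.
move=> zf cf cg; have [m1 m2] := cmeasM cf cg.
have z (P : R[i] -> R) : P 0 = 0 -> measurable_fun Rpos (fun r => P (f r * g r)) ->
    rI (fun r => P (f r * g r)) = 0.
  move=> P0 mP; rewrite /rI /Rintegral.
  rewrite (ae_eq_integral (cst 0%E)) ?integral0//; first exact: measurable_Rpos.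
  - exact/measurable_EFinP.
  - apply: filterS zf; first exact: (ae_filter_ringOfSetsType mu).
    by move=> r h Ur; rewrite h// mul0r P0.
by rewrite cintE (z (@Re R)) ?(z (@Im R)).
Qed.

Lemma Lmin_L2 al g g' : Lmin al g g' -> L2 g /\ L2 g'.
Proof. by case. Qed.

(** Green's formula extends by continuity from test functions to the minimal
    operator. *)
Lemma Lmin_green al g g' H : Lmin al g g' -> csm Rpos H -> L2 H -> L2 (Lp al H) ->
  cint (fun r => g' r * H r) = cint (fun r => g r * Lp al H r).
Proof.
move=> [Lg Lg' ap] sH LH LLH.
have testE phi psi : Lmax al phi psi -> Cc_infty Rpos phi ->
    cint (fun r => psi r * H r) = cint (fun r => phi r * Lp al H r).
  move=> [Lphi Lpsi e] cc.
  have [sT [a [b [a0 ab pa pb]]]] := Cc_Rpos_elim cc; have sphi := csm_Rpos_T sT.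
  have LLp := test_Lp_L2 sphi a0 ab pa pb al.
  have zz : zeroL2 (fun r => psi r - Lp al phi r).
    apply: zeroL2_test.
      exact: L2B.
    move=> chi a' b' schi a'0 ab' chia chib.
    have Lchi := test_L2 schi a'0 ab' chia chib.
    have ccc := Cc_Rpos_intro schi a'0 chia chib.
    have := e chi ccc; rewrite LopE// /distr_of_fun (Green schi a'0 ab' chia chib al sphi) => E.
    transitivity (cint (fun r => psi r * chi r - Lp al phi r * chi r)).
      by apply: cint_eq => r _; rewrite mulrBl.
    by rewrite cintB ?E ?subrr//; apply: Cint_L2M.
  have -> : cint (fun r => phi r * Lp al H r) = cint (fun r => Lp al phi r * H r).
    transitivity (cint (fun r => Lp al H r * phi r)).
      by apply: cint_eq => r _; rewrite mulrC.
    rewrite -(Green sphi a0 ab pa pb al sH).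
    by apply: cint_eq => r _; rewrite mulrC.
  apply/eqP; rewrite -subr_eq0 -cintB; [|exact: Cint_L2M Lpsi LH|exact: Cint_L2M LLp LH].
  rewrite -(cint_zeroL2 zz _ (L2_cmeas LH)); last exact: cmeasB (L2_cmeas Lpsi) (L2_cmeas LLp).
  by apply/eqP/cint_eq => r _; rewrite mulrBl.
apply/eqP; rewrite -subr_eq0 -normc_eq0 -normr_le0 (ger0_norm (normc_ge0 _)).
apply/ler_addgt0Pr => e e0; rewrite add0r.
pose M := 2 + rI (fun r => normc (H r) ^+ 2) + rI (fun r => normc (Lp al H r) ^+ 2).
have M0 : 0 < M by rewrite !ltr_wpDr ?rI_ge0// => x _; rewrite sqr_ge0.
have d0 : 0 < e / M by rewrite divr_gt0.
have [phi [psi [[hp cc] e1 e2]]] := ap _ (exprn_gt0 2 d0).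
have [Lphi Lpsi _] := hp.
have L1 : L2 (fun r => g r - phi r) by exact: L2B.
have L2' : L2 (fun r => g' r - psi r) by exact: L2B.
have -> : cint (fun r => g' r * H r) - cint (fun r => g r * Lp al H r) =
    cint (fun r => (g' r - psi r) * H r) - cint (fun r => (g r - phi r) * Lp al H r).
  have -> : cint (fun r => (g' r - psi r) * H r) =
      cint (fun r => g' r * H r) - cint (fun r => psi r * H r).
    rewrite -cintB; [|exact: Cint_L2M Lg' LH|exact: Cint_L2M Lpsi LH].
    by apply: cint_eq => r _; rewrite mulrBl.
  have -> : cint (fun r => (g r - phi r) * Lp al H r) =
      cint (fun r => g r * Lp al H r) - cint (fun r => phi r * Lp al H r).
    rewrite -cintB; [|exact: Cint_L2M Lg LLH|exact: Cint_L2M Lphi LLH].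
    by apply: cint_eq => r _; rewrite mulrBl.
  by rewrite (testE _ _ hp cc); ring.
apply: le_trans (normcB _ _) _.
apply: le_trans (lerD (cint_L2_small d0 L2' LH e2) (cint_L2_small d0 L1 LLH e1)) _.
by rewrite -mulrDr mulrAC ler_pdivrMr// ler_pM2l// /M; lra.
Qed.

End Pairing.

Section LogBoundary.
Context {R : realType}.
Implicit Types (h H Phi psi : R -> R[i]) (a b x r K : R).
Variables (nu lam c : R[i]) (d : R) (f zeta g' : R -> R[i]).
Hypotheses (d0 : 0 < d) (d1 : d <= 1) (hf : Lmax 0 f (fun r => lam * f r)).
Hypothesis zeta1 : forall r, 0 <= r < d -> zeta r = 1.

Local Notation g := (fun r => (f r - c * w0 nu r) * zeta r).
Hypothesis hg : Lmin 0 g g'.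

Let Lf : L2 f. Proof. by case: hf. Qed.
Let Lg : L2 g. Proof. by case: (Lmin_L2 hg). Qed.
Let Lg' : L2 g'. Proof. by case: (Lmin_L2 hg). Qed.

Let gE H b r : b < d -> (forall r, b < r -> H r = 0) -> 0 < r ->
  g r * Lp 0 H r = f r * Lp 0 H r - c * w0 nu r * Lp 0 H r.
Proof.
move=> bd hb r0; have [br|rb] := ltP b r; last first.
  by rewrite zeta1 ?mulr1 ?mulrBl// (ltW r0) (le_lt_trans rb bd).
have ob : open [set y : R | b < y] by exact: open_gt.
by rewrite (Lp_0 _ ob br hb) !mulr0 subr0.
Qed.

(** Since [L_0 w = 0], the minimal part [g] satisfies [g' = lambda f] wherever
    [zeta] equals [1]; this is its weak form. *)
Lemma local_test chi a b : 0 < a -> a < b -> b < d -> csm Rpos chi ->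
  (forall r, r < a -> chi r = 0) -> (forall r, b < r -> chi r = 0) ->
  cint (fun r => (g' r - lam * f r) * chi r) = 0.
Proof.
move=> a0 ab bd sc ca cb.
have Lc := test_L2 sc a0 ab ca cb; have LLc := test_Lp_L2 sc a0 ab ca cb 0.
transitivity (cint (fun r => g' r * chi r) - cint (fun r => lam * f r * chi r)).
  rewrite -cintB; [|exact: Cint_L2M Lg' Lc|exact: Cint_L2M (L2Z lam Lf) Lc].
  by apply: cint_eq => r _; rewrite mulrBl.
rewrite (Lmin_green hg sc Lc LLc).
have [_ _ e] := hf; have cc := Cc_Rpos_intro sc a0 ca cb.
have := e chi cc; rewrite LopE// /distr_of_fun => <-.
have IE : Cint (fun r => f r * Lp 0 chi r) by exact: Cint_L2M Lf LLc.
have Ig : Cint (fun r => g r * Lp 0 chi r) by exact: Cint_L2M Lg LLc.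
have Iw : Cint (fun r => c * w0 nu r * Lp 0 chi r).
  apply: (Cint_eq _ (CintB IE Ig)) => r r0.
  by rewrite (gE bd cb r0) opprB addrC subrK.
have -> : cint (fun r => g r * Lp 0 chi r) =
    cint (fun r => f r * Lp 0 chi r) - cint (fun r => c * w0 nu r * Lp 0 chi r).
  by rewrite -cintB//; apply: cint_eq => r r0; exact: gE bd cb r0.
rewrite addrAC subrr sub0r.
have -> : cint (fun r => c * w0 nu r * Lp 0 chi r) =
    cint (fun r => Lp 0 (fun r => c * w0 nu r) r * chi r).
  by rewrite (Green sc a0 ab ca cb 0 (csmZ c open_Rpos (csm_w0 nu))).
rewrite (cint_eq (g := fun=> 0)) ?cint0 ?oppr0// => r r0.
have e0 y : 0 < y -> Lp 0 (fun r => c * w0 nu r) y = 0.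
  move=> y0; have e1 z : c * w0 nu z = w0 nu z - (1 - c) * w0 nu z by ring.
  rewrite (Lp_ext 0 open_Rpos ((RposP y).2 y0) (fun z _ => e1 z) (csmZ c open_Rpos (csm_w0 nu))).
  by rewrite LpB ?Lp_w0// ?mulr0 ?subr0//; exact: csm_w0.
by rewrite e0// mul0r.
Qed.

(** Cutting [H] off near [0] reduces this to [local_test]; as [g' - lambda f] and
    [H] are both square integrable, the cutoff is removed by dominated
    convergence. *)
Lemma local_L2 H b : 0 < b -> b < d -> csm Rpos H -> L2 H ->
  (forall r, b < r -> H r = 0) -> cint (fun r => (g' r - lam * f r) * H r) = 0.
Proof.
move=> b0 bd sH LH hb.
have Lk : L2 (fun r => g' r - lam * f r) by apply: L2B => //; exact: L2Z.
pose chi (n : nat) r : R[i] := (stp (n.+1%:R * r))%:C.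
have schi n : csm Rpos (chi n) by apply: csm_Rpos_T; exact: csm_scale.
have n0 (n : nat) : (0 : R) < n.+1%:R by [].
have z n : cint (fun r => (g' r - lam * f r) * (H r * chi n r)) = 0.
  have [nb|bn] := ltP n.+1%:R^-1 b.
    apply: (local_test (a := n.+1%:R^-1) (b := b)) => //; rewrite ?invr_gt0//.
    - exact: csmM open_Rpos sH (schi n).
    - move=> r ra; rewrite /chi stp0 ?mulr0//.
      by rewrite mulrC -ler_pdivlMr// div1r ltW.
    - by move=> r br; rewrite hb// mul0r.
  rewrite (cint_eq (g := fun=> 0)) ?cint0// => r r0.
  have [br|rb] := ltP b r; first by rewrite hb// mul0r mulr0.
  rewrite /chi stp0 ?mulr0//.
  by rewrite mulrC -ler_pdivlMr// div1r (le_trans rb).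
have [||||_ cc] := @cint_dct R (fun n r => (g' r - lam * f r) * (H r * chi n r))
  (fun r => (g' r - lam * f r) * H r) (fun r => normc ((g' r - lam * f r) * H r)).
- move=> n; apply: cmeasM; first exact: L2_cmeas.
  exact: ccont_meas (csm_ccont (csmM open_Rpos sH (schi n))).
- move=> r r0; apply: (ccvg_norm0 (v := fun=> 0)); last exact: cvg_cst.
  near=> n; rewrite /chi stp1 ?mulr1 ?subrr ?normc0//.
  rewrite mulrC -ler_pdivrMl// mulrC.
  have : 2 / r <= n%:R by near: n; exact: nbhs_infty_ger.
  by move=> /le_trans; apply; rewrite ler_nat.
- exact: Cint_normc (Cint_L2M Lk LH).
- move=> n r r0; rewrite mulrA (normcM (_ * H r)) ler_piMr ?normc_ge0//.
  by rewrite normcR ger0_norm ?stp_ge0// stp_le1.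
by apply: (ccvg_uniq cc); rewrite (_ : (fun n => _) = fun=> 0);
  [exact: ccvg_cst|apply/funext => n; exact: z].
Unshelve. all: by end_near. Qed.

(** On the support of [H] the function [f] is [g + c w], and [g] is paired by
    [Lmin_green]. *)
Lemma local_formula H b : 0 < b -> b < d -> csm Rpos H -> L2 H -> L2 (Lp 0 H) ->
  (forall r, b < r -> H r = 0) ->
  Cint (fun r => c * w0 nu r * Lp 0 H r) /\
  cint (fun r => c * w0 nu r * Lp 0 H r) = cint (fun r => f r * (Lp 0 H r - lam * H r)).
Proof.
move=> b0 bd sH LH LLH hb.
have If : Cint (fun r => f r * Lp 0 H r) by exact: Cint_L2M Lf LLH.
have Ig : Cint (fun r => g r * Lp 0 H r) by exact: Cint_L2M Lg LLH.
have IfH : Cint (fun r => lam * f r * H r) by exact: Cint_L2M (L2Z lam Lf) LH.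
have IgH : Cint (fun r => g' r * H r) by exact: Cint_L2M Lg' LH.
have wE r : 0 < r -> f r * Lp 0 H r - g r * Lp 0 H r = c * w0 nu r * Lp 0 H r.
  by move=> r0; rewrite (gE bd hb r0) opprB addrC subrK.
split; first exact: Cint_eq wE (CintB If Ig).
rewrite -(cint_eq wE) (cintB If Ig) -(Lmin_green hg sH LH LLH).
have : cint (fun r => g' r * H r) - cint (fun r => lam * f r * H r) = 0.
  rewrite -cintB// -(local_L2 b0 bd sH LH hb).
  by apply: cint_eq => r _; rewrite mulrBl.
move=> /eqP; rewrite subr_eq0 => /eqP ->; rewrite -cintB//.
apply: cint_eq => r _; move: (Lp 0 H r) (f r) (H r) => *; ring.
Qed.

(** Green's formula on the whole half-line: only the boundary term at [0] is left. *)
Lemma green_boundary Phi : csm Rpos Phi -> ord0 0 Phi -> ord0 0 (Lp 0 Phi) ->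
  tail (d / 4) (5 / 4) Phi -> tail (d / 4) 4^-1 (cderive Phi) ->
  tail (d / 4) (- (3 / 4)) (fun r => Lp 0 Phi r - lam * Phi r) ->
  let H r := Phi r * (1 - (stp (4 / d * r))%:C) in
  Cint (fun r => c * w0 nu r * Lp 0 H r) /\
  cint (fun r => c * w0 nu r * Lp 0 H r) =
  cint (fun r => f r * (Lp 0 Phi r - lam * Phi r)).
Proof.
move=> sP oP oLP tP tP1 tN H.
have d4 : 0 < d / 4 by rewrite divr_gt0.
have d21 : d / 2 <= 1 by move: d0 d1 => ? ?; lra.
have d2d : d / 2 < d by move: d0 => ?; lra.
have le12 : (1 : R) <= 2 by lra.
have c0 : 0 < 4 / d by rewrite divr_gt0.
pose chi r : R[i] := (stp (4 / d * r))%:C.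
have schi : csm Rpos chi by apply: csm_Rpos_T; exact: csm_scale.
have [C C0 hC] := @stp_scale_bounds R.
pose Phi2 r := Phi r * chi r.
have s2 : csm Rpos Phi2 by exact: csmM open_Rpos sP schi.
have sH : csm Rpos H.
  by apply: (csmM open_Rpos sP); exact: csmB open_Rpos (csm_cst 1 open_Rpos) schi.
have chi0 r : r < d / 4 -> chi r = 0.
  move=> rd; rewrite /chi stp0// mulrAC ler_pdivrMr// mul1r.
  by move: rd; rewrite ltr_pdivlMr// mulrC => /ltW.
have z2 r : r < d / 4 -> Phi2 r = 0 by move=> rd; rewrite /Phi2 chi0 ?mulr0.
have zH r : d / 2 < r -> H r = 0.
  move=> rd; rewrite /H stp1 ?subrr ?mulr0//.
  by rewrite mulrAC ler_pdivlMr//; move: rd; rewrite ltr_pdivrMr//; lra.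
have HE r : H r = Phi r - 1 * Phi2 r by rewrite /H /Phi2 /chi; ring.
have LH r : 0 < r -> Lp 0 H r = Lp 0 Phi r - Lp 0 Phi2 r.
  move=> r0; rewrite (Lp_ext 0 open_Rpos ((RposP r).2 r0) (fun y _ => HE y) sH).
  by rewrite LpB// mul1r.
have t0 : tail (d / 4) 0 chi.
  by exists 1 => // r r0 _; rewrite pw0 mulr1 normcR ger0_norm ?stp_ge0// stp_le1.
have t1 : tail (d / 4) (- 1) (cderive chi).
  by exists C => // r r0 _; have [h _] := hC _ r c0 r0; rewrite pwN1.
have t2 : tail (d / 4) (- 2) (cderive (cderive chi)).
  by exists C => // r r0 _; have [_ h] := hC _ r c0 r0; rewrite pwN pw2.
have tP2 : tail (d / 4) (5 / 4) Phi2 by have := ordM tP t0; rewrite addr0.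
have tP2' : tail (d / 4) 4^-1 (cderive Phi2).
  have : tail (d / 4) 4^-1 (fun r => cderive Phi r * chi r + Phi r * cderive chi r).
    apply: ordD; first by have := ordM tP1 t0; rewrite addr0.
    by have := ordM tP t1; rewrite (_ : 5 / 4 + - 1 = 4^-1 :> R)//; field.
  apply: ord_ext => r r0; have Ur : Rpos r by exact/RposP.
  by rewrite (cder_cderive (cderM (csm_cder sP Ur) (csm_cder schi Ur))).
have tN2 : tail (d / 4) (- (3 / 4)) (fun r => Lp 0 Phi2 r - lam * Phi2 r).
  have : tail (d / 4) (- (3 / 4)) (fun r => (Lp 0 Phi r - lam * Phi r) * chi r -
      2 * (cderive Phi r * cderive chi r) - Phi r * cderive (cderive chi) r).
    apply: ordB; first apply: ordB.
    - by have := ordM tN t0; rewrite addr0.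
    - apply: ordZ; have := ordM tP1 t1.
      by rewrite (_ : 4^-1 + - 1 = - (3 / 4) :> R)//; field.
    - have := ordM tP t2.
      by rewrite (_ : 5 / 4 + - 2 = - (3 / 4) :> R)//; field.
  apply: ord_ext => r r0; have Ur : Rpos r by exact/RposP.
  rewrite (Lp_mul 0 open_Rpos Ur sP schi) /Phi2.
  move: (Lp 0 Phi r) (Phi r) (chi r) (cderive Phi r) (cderive chi r)
    (cderive (cderive chi) r) => *; ring.
have G2 := green_infinity d4 hf s2 z2 tP2 tP2' tN2.
have [K K0 hK] := oP; have [K1 K10 hK1] := oLP.
have [K2 K20 hK2] := ccont_bounded 1 d4 (csm_ccont (csm_Lp 0 s2)).
have d20 : 0 < d / 2 by rewrite divr_gt0.
have LH2 : L2 H.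
  apply: (@L2_near0 R H 2^-1 K (d / 2)) => //; rewrite ?invr_gt0//.
    exact: ccont_meas (csm_ccont sH).
  move=> r r0 rd; rewrite subrr /H (normcM (Phi r)).
  have r2 : r <= 2 := le_trans rd (le_trans d21 le12).
  apply: le_trans (hK r r0 r2).
  rewrite ler_piMr ?normc_ge0// (_ : 1 - _ = (1 - stp (4 / d * r))%:C); last by rewrite rmorphB.
  by rewrite normcR ger0_norm ?subr_ge0 ?stp_le1// gerBl stp_ge0.
have LLH2 : L2 (Lp 0 H).
  apply: (@L2_near0 R _ 2^-1 (K1 + K2) (d / 2)) => //; rewrite ?invr_gt0 ?addr_ge0//.
  - exact: ccont_meas (csm_ccont (csm_Lp 0 sH)).
  - move=> r r0 rd; rewrite subrr pw0 mulr1 LH//; apply: le_trans (normcB _ _) _.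
    have h1 := hK1 r r0; rewrite pw0 mulr1 /= in h1.
    apply: lerD; first exact: h1 (le_trans rd (le_trans d21 le12)).
    have [rd4|dr4] := ltP r (d / 4); last by apply: hK2; rewrite dr4/=; exact: le_trans rd d21.
    have oa : open [set y : R | y < d / 4] by exact: open_lt.
    by rewrite (Lp_0 0 oa rd4 z2) normc0.
  - move=> r rd; have ob : open [set y : R | d / 2 < y] by exact: open_gt.
    exact: Lp_0 ob rd zH.
have [I E] : Cint (fun r => c * w0 nu r * Lp 0 H r) /\
    cint (fun r => c * w0 nu r * Lp 0 H r) = cint (fun r => f r * (Lp 0 H r - lam * H r)).
  exact: (local_formula d20 d2d sH LH2 LLH2 zH).
split => //; rewrite E.
transitivity (cint (fun r => f r * (Lp 0 H r - lam * H r)) +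
  cint (fun r => f r * (Lp 0 Phi2 r - lam * Phi2 r))); first by rewrite G2 addr0.
rewrite -cintD.
- apply: cint_eq => r r0; rewrite LH// HE mul1r.
  by move: (Lp 0 Phi r) (Lp 0 Phi2 r) (Phi r) (Phi2 r) (f r) => *; ring.
- by apply: Cint_L2M Lf _; apply: L2B => //; exact: L2Z.
- apply: Cint_L2M Lf _; apply: (L2_tail d4) => //.
    apply: ccont_meas (csm_ccont _); apply: (csmB open_Rpos); first exact: csm_Lp.
    exact: csmZ open_Rpos s2.
  move=> r rd; have oa : open [set y : R | y < d / 4] by exact: open_lt.
  by rewrite (Lp_0 0 oa rd z2) z2// mulr0 subr0.
Qed.

End LogBoundary.

Section Uniqueness.
Context {R : realType}.
Implicit Types (f g h P psi : R -> R[i]) (a b x r K : R) (nu lam c : R[i]).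

Lemma compact_tail g a b e : 0 < a -> ccont g -> (forall r, b < r -> g r = 0) -> tail a e g.
Proof.
move=> a0 cg gb.
have cp : ccont (fun r => g r * (pw (- e) r)%:C).
  by apply: ccontM cg _; apply: ccont_real => r r0; exact: pw_cont.
have [K K0 h] := ccont_bounded b a0 cp; exists K => // r r0 ar.
have [br|rb] := ltP b r; first by rewrite gb// normc0 mulr_ge0 ?pw_ge0.
have := h r; rewrite ar rb => /(_ isT).
rewrite (normcM (g r)) normcR ger0_norm ?pw_ge0// pwN.
by rewrite ler_pdivrMr ?pw_gt0.
Qed.

(** With [c = 0] nothing enters from [0], and the Volterra operator integrating
    from infinity, bounded by a multiple of [B / N] for the weight [expR (- (N r))], annihilates
    [f]. *)
Lemma unique_minimal lam f zeta g' (d : R) : 0 < d -> d <= 1 ->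
  Lmax 0 f (fun r => lam * f r) -> (forall r, 0 <= r < d -> zeta r = 1) ->
  Lmin 0 (fun r => (f r - 0 * w0 0 r) * zeta r) g' -> zeroL2 f.
Proof.
move=> d0 d1 hf zeta1 hg; have [Lf _ _] := hf.
apply: zeroL2_test => // psi0 a b sp0 a0 ab pa0 pb0.
pose B := b + 1; have b0 := lt_trans a0 ab.
have B0 : 0 < B by rewrite addr_gt0.
(* the operator has norm at most [8 B / N] for the weight [W]; times [lam] this is
   at most [1 / 2] *)
pose N := 16 * B * (normc lam + 1).
have l0 := normc_ge0 lam.
have l1 : 0 < normc lam + 1 by rewrite ltr_wpDl.
have N0 : 0 < N by rewrite /N mulr_gt0// mulr_gt0.
pose W r : R := expR (- (N * r)).
have W0 r : 0 < r -> 0 <= W r by move=> _; exact: expR_ge0.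
have LW : L2 (fun r => (W r)%:C).
  apply: (L2_intro (q := gam 1 (2 * N))) => [|r r0|].
  - apply: ccont_meas; apply: ccont_real => r r0.
    apply: continuous_comp; last exact: continuous_expR.
    apply: continuousN; apply: continuousM; first exact: cst_continuous.
    exact: cvg_id.
  - rewrite normcR ger0_norm ?expR_ge0// /gam subrr pw0 mulr1 expr2 -expRD.
    by rewrite (_ : - (N * r) + - (N * r) = - (2 * N * r))//; ring.
  - by apply: Rint_gam => //; rewrite mulr_gt0.
have [K0 K00 hK0] := ccont_bounded b a0 (csm_ccont sp0).
apply: (contraction_pairing0 (C := [set g | csm Rpos g /\ forall r, b < r -> g r = 0])
    (W := W) Lf LW W0 _ _ _ (mulr_ge0 K00 (expR_ge0 (N * b)))) => //.
- by move=> g [sg _]; exact: ccont_meas (csm_ccont sg).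
- move=> psi K [sp pb] K1 h.
  have sh := csm_cpowR (2^-1 : R[i]); have sl := @csm_ln R.
  have s1 : csm Rpos (fun r => cpowR r 2^-1 * psi r) by exact: csmM open_Rpos sh sp.
  have s2 : csm Rpos (fun r => cpowR r 2^-1 * (ln r)%:C * psi r).
    by apply: (csmM open_Rpos) => //; exact: csmM open_Rpos sh sl.
  have [P [dP Pb]] := backward_primitive b0 (csm_ccont s1)
    (fun r br => etrans (f_equal (fun z => _ * z) (pb r br)) (mulr0 _)).
  have [Q [dQ Qb]] := backward_primitive b0 (csm_ccont s2)
    (fun r br => etrans (f_equal (fun z => _ * z) (pb r br)) (mulr0 _)).
  have [sphi Lphi dphi] := log_kernel sp dP dQ.
  set phi := fun _ => _ in sphi Lphi dphi.
  have phib r : b < r -> phi r = 0 by move=> br; rewrite /phi Pb// Qb// mulr0 subr0 mulr0.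
  have hphi r : 0 < r -> normc (phi r) <= 8 * B * K / N * W r.
    move=> r0; have C0 : 0 <= 8 * B * K / N * W r.
      by apply: mulr_ge0 (W0 r r0); apply: divr_ge0 (ltW N0); rewrite mulr_ge0 ?mulr_ge0// ltW.
    have [br|rb] := ltP b r; first by rewrite phib// normc0.
    have rB : r <= B by rewrite /B; lra.
    pose gr t := cpowR r 2^-1 * (Q t - (ln r)%:C * P t).
    have dgr t : r <= t <= B -> cder gr t
        (cpowR r 2^-1 * (cpowR t 2^-1 * (ln t - ln r)%:C * psi t)).
      move=> /andP[rt _]; have t0 := lt_le_trans r0 rt.
      apply: cder_eq (cderZ (cpowR r 2^-1) (cderB (dQ t t0) (cderZ (ln r)%:C (dP t t0)))) _.
      have -> : (ln t - ln r)%:C = (ln t)%:C - (ln r)%:C by rewrite rmorphB.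
      move: (psi t) (cpowR t _) (cpowR r _) (ln t)%:C (ln r)%:C => *; ring.
    pose qr t := - (4 * B * K / N) * expR (- (N * t)).
    have dqr t : r <= t <= B -> is_derive t 1 qr (4 * B * K * W t).
      have dt := is_deriveZ (- (4 * B * K / N)) (is_derive1_comp (is_derive_expR _)
        (is_deriveN (is_deriveZ N (is_derive_id t 1)))).
      move=> _; apply: is_derive_eq dt _; rewrite -[_ *: 1]/(_ * 1) -![_ *: _]/(_ * _) /W.
      by field; rewrite gt_eqF.
    have le t : r <= t <= B ->
        normc (cpowR r 2^-1 * (cpowR t 2^-1 * (ln t - ln r)%:C * psi t)) <= 4 * B * K * W t.
      move=> /andP[rt tB]; have t0 := lt_le_trans r0 rt.
      rewrite (normcM (cpowR r 2^-1)) (normcM (_ * _)) (normcM (cpowR t 2^-1)).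
      rewrite !normc_cpowR_pw Re_half normcR -ln_div ?posrE//.
      have h2 : (0 : R) < 2^-1 by rewrite invr_gt0.
      have tr : 1 <= t / r by rewrite ler_pdivlMr// mul1r.
      have tr0 := lt_le_trans ltr01 tr.
      have lnle : `|ln (t / r)| <= 4 * pw 2^-1 (t / r).
        apply: le_trans (abs_ln_le h2 tr0) _; rewrite invrK.
        have : pw (- 2^-1) (t / r) <= pw 2^-1 (t / r) by apply: ler_pw_exp => //; lra.
        by lra.
      have pr : pw 2^-1 r * (pw 2^-1 t * pw 2^-1 (t / r)) = t.
        rewrite pwM ?invr_gt0// pwV// pwN.
        transitivity (pw 2^-1 t * pw 2^-1 t); first by field; rewrite gt_eqF ?pw_gt0.
        by rewrite -pwD (_ : 2^-1 + 2^-1 = 1) ?pw1//; field.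
      apply: (@le_trans _ _ (4 * t * normc (psi t))).
        have -> : 4 * t * normc (psi t) =
            pw 2^-1 r * (pw 2^-1 t * (4 * pw 2^-1 (t / r)) * normc (psi t)).
          transitivity (4 * (pw 2^-1 r * (pw 2^-1 t * pw 2^-1 (t / r))) * normc (psi t)).
            by rewrite pr.
          by ring.
        rewrite ler_wpM2l ?pw_ge0// ler_wpM2r ?normc_ge0// ler_wpM2l ?pw_ge0//.
      have -> : 4 * B * K * W t = 4 * B * (K * W t) by ring.
      by rewrite ler_pM ?normc_ge0 ?h// ?ler_pM2l// mulr_ge0// ltW.
    have := cincrement_le rB dgr dqr le.
    have -> : gr B = 0 by rewrite /gr Pb ?Qb ?mulr0 ?subr0 ?mulr0// /B ltrDl.
    rewrite sub0r normcN => /le_trans; apply.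
    have -> : 8 * B * K / N * W r = 2 * (4 * B * K / N * W r) by ring.
    rewrite ler_pM2l// /qr !mulNr opprK addrC gerDl oppr_le0.
    apply: mulr_ge0 (expR_ge0 _); apply: divr_ge0 (ltW N0).
    by rewrite mulr_ge0 ?mulr_ge0// ltW.
  exists (fun r => lam * phi r); split.
  + split; first exact: csmZ open_Rpos sphi.
    by move=> r br; rewrite phib// mulr0.
  + move=> r r0; rewrite (normcM lam).
    apply: le_trans (ler_wpM2l l0 (hphi r r0)) _; rewrite mulrA ler_wpM2r ?W0//.
    rewrite mulrA ler_pdivrMr// /N; move: (normc lam) l0 => y y0.
    have := mulr_ge0 (mulr_ge0 (ltW B0) K1) y0; have := mulr_ge0 (ltW B0) K1.
    by rewrite (_ : K / 2 * _ = 8 * (B * K * y) + 8 * (B * K)); [lra|field].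
  + have n8 : 0 <= 8 * B * K / N.
      by apply: divr_ge0 (ltW N0); rewrite mulr_ge0 ?mulr_ge0// ltW.
    have W1 r : 0 < r -> W r <= 1.
      by move=> r0; rewrite /W -expR0 ler_expR oppr_le0 mulr_ge0// ltW.
    have d4 : 0 < d / 4 by rewrite divr_gt0.
    have ob : open [set y : R | b < y] by exact: open_gt.
    have [] := green_boundary d0 d1 hf zeta1 hg sphi.
    * exists (8 * B * K / N) => // r r0 _; rewrite pw0 mulr1.
      by apply: le_trans (hphi r r0) _; rewrite ler_piMr ?W1.
    * exists K => // r r0 _; rewrite pw0 mulr1 Lphi//.
      by apply: le_trans (h r r0) _; rewrite ler_piMr ?W1.
    * exact: compact_tail d4 (csm_ccont sphi) phib.
    * apply: (compact_tail (b := b)) d4 (csm_ccont (csm_cderive sphi)) _ => r br.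
      exact: cderive_cst_near ob br phib.
    * have sN : csm Rpos (fun r => Lp 0 phi r - lam * phi r).
        by apply: (csmB open_Rpos); [exact: csm_Lp|exact: csmZ open_Rpos sphi].
      apply: (compact_tail (b := b)) d4 (csm_ccont sN) _ => r br.
      by rewrite (Lp_0 0 ob br phib) phib// mulr0 subr0.
    move=> _; rewrite (cint_eq (g := fun=> 0)) ?cint0; last by move=> r _; rewrite !mul0r.
    have Lpsi : L2 psi.
      apply: (L2_dom (ccont_meas (csm_ccont sp)) LW K1) => r r0.
      by rewrite normcR (ger0_norm (W0 r r0)) h.
    have LlP : L2 (fun r => lam * phi r).
      apply: L2Z; apply: (L2_dom (ccont_meas (csm_ccont sphi)) LW n8) => r r0.
      by rewrite normcR (ger0_norm (W0 r r0)) hphi.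
    have -> : cint (fun r => f r * (Lp 0 phi r - lam * phi r)) =
        cint (fun r => f r * psi r) - cint (fun r => f r * (lam * phi r)).
      rewrite -cintB; [|exact: Cint_L2M|exact: Cint_L2M].
      by apply: cint_eq => r r0; rewrite Lphi// mulrBr.
    by move=> /esym/eqP; rewrite subr_eq0 => /eqP.
- move=> r r0; have [br|rb] := ltP b r.
    by rewrite pb0// normc0 mulr_ge0 ?W0// mulr_ge0 ?expR_ge0.
  have [ra|ar] := ltP r a.
    by rewrite pa0// normc0 mulr_ge0 ?W0// mulr_ge0 ?expR_ge0.
  apply: le_trans (hK0 r _) _; first by rewrite ar rb.
  rewrite -mulrA ler_peMr// /W -expRD -expR0 ler_expR subr_ge0.
  by rewrite ler_pM2l.
Qed.

Lemma G_tail (p m : R[i]) a e : 0 < Re p -> 0 < a -> tail a e (fun r => G p r m).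
Proof.
move=> p0 a0; pose d := 1 + `|Re m| + `|e|.
have d0 : 0 < d by rewrite /d -addrA ltr_pwDl// addr_ge0.
have md : 0 < Re m + d.
  have := ler_norm (- Re m); rewrite normrN /d; have := normr_ge0 e; lra.
have [C C0 h] := G_bound p0 d0 md.
apply: (tail_le (a := - (2 * d)) a0).
  have := ler_norm (- e); rewrite normrN /d; have := normr_ge0 (Re m).
  by have := normr_ge0 e; lra.
exists C => // r r0 _; apply: le_trans (h r r0) _.
rewrite -[leRHS]mulr1 ler_wpM2l ?mulr_ge0 ?pw_ge0// -expR0 ler_expR oppr_le0.
by rewrite mulr_ge0 ?ltW.
Qed.

(** The Wronskian of two solutions of [L_0 w = 0] is constant. *)
Lemma w0_wronskian nu nu' r : 0 < r ->
  w0 nu r * w0' nu' r - w0' nu r * w0 nu' r = nu - nu'.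
Proof.
move=> r0; rewrite /w0 /w0'.
have e : cpowR r (2^-1 : R[i]) * cpowR r (2^-1 - 1) = 1.
  by rewrite -cpowRD (_ : 2^-1 + (2^-1 - 1) = 0 :> R[i]) ?cpowR0//; field.
rewrite -[RHS]mulr1 -[X in _ = _ * X]e.
by move: (cpowR r 2^-1) (cpowR r (2^-1 - 1)) (ln r)%:C => *; field.
Qed.

(** Pairing with the decaying solution at the same [lambda] leaves only the
    Wronskian of the two boundary behaviours at [0]. *)
Lemma unique_boundary (s : R[i]) nu c f zeta g' (d : R) : `|Im s| < pi / 2 ->
  0 < d -> d <= 1 -> Lmax 0 f (fun r => lamb s * f r) ->
  (forall r, 0 <= r < d -> zeta r = 1) ->
  Lmin 0 (fun r => (f r - c * w0 nu r) * zeta r) g' ->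
  c * (nu - (s + euler_gamma%:C)) = 0.
Proof.
move=> s_im d0 d1 hf zeta1 hg; set nu' := s + _.
have m0 : `|Re (0 : R[i])| < 1 by rewrite normr0.
have p0 := Re_cexp_gt0 s_im.
have su := csm_bes 0 s_im; pose u := bes s 0.
have Lu r : 0 < r -> Lp 0 u r = lamb s * u r.
  by move=> r0; have := @Lp_bes R s 0 s_im r r0; rewrite expr2 mul0r.
have d4 : 0 < d / 4 by rewrite divr_gt0.
have ou : ord0 0 u.
  have [C C0 h] := bes_le s_im m0; rewrite normr0 mul0r oppr0 in h.
  exists C => // r r0 _; apply: le_trans (h r r0) _.
  rewrite -[leRHS]mulr1 ler_wpM2l ?mulr_ge0 ?pw_ge0// -expR0 ler_expR oppr_le0.
  by rewrite mulr_ge0 ?ltW.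
have tu e : tail (d / 4) e u.
  apply: (tail_le (a := Re (2^-1 - 0) + (e - 2^-1)) d4).
    by rewrite Re_half_sub/=; lra.
  exact: ordM (ord_cpowR _ _) (G_tail _ _ p0 d4).
have tu1 : tail (d / 4) 4^-1 (cderive u).
  have h : tail (d / 4) 4^-1 (fun r => (2^-1 - 0) * (cpowR r (2^-1 - 0 - 1) * G (cexp s) r 0) +
      (- 2 * cexp s) * (cpowR r (2^-1 - 0 + 1) * G (cexp s) r (0 - 1))).
    apply: ordD; apply: ordZ.
      apply: (tail_le (a := Re (2^-1 - 0 - 1) + 0) d4); last exact: ordM (ord_cpowR _ _) (G_tail _ _ p0 d4).
      by rewrite ReD ReN Re_half_sub/=; lra.
    apply: (tail_le (a := Re (2^-1 - 0 + 1) + - 2) d4); last exact: ordM (ord_cpowR _ _) (G_tail _ _ p0 d4).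
    by rewrite ReD Re_half_sub/=; lra.
  apply: ord_ext h => r r0; rewrite (cder_cderive (cder_powG s_im (2^-1 - 0) 0 r0)).
  move: (G (cexp s) r 0) (G (cexp s) r (0 - 1)) (cpowR r _) => *; ring.
pose H r := u r * (1 - (stp (4 / d * r))%:C).
have [] := green_boundary d0 d1 hf zeta1 hg su ou.
- by apply: ord_ext (ordZ (lamb s) ou) => r r0; rewrite Lu.
- exact: tu.
- exact: tu1.
- by exists 0 => // r r0 _; rewrite Lu// subrr normc0 mul0r.
rewrite -/H => IH.
rewrite [RHS](cint_eq (g := fun=> 0)); last by move=> r r0; rewrite Lu// subrr mulr0.
rewrite cint0 => E.
have sw := csm_w0 nu.
have sH : csm Rpos H.
  apply: (csmM open_Rpos su); apply: csm_Rpos_T.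
  by apply: (csmB openT); [exact: csm_cst openT|exact: csm_scale].
pose F r := c * (w0' nu r * H r - w0 nu r * cderive H r).
have dF r : 0 < r -> cder F r (c * w0 nu r * Lp 0 H r).
  move=> r0; have Ur : Rpos r by exact/RposP.
  have dw' : cder (w0' nu) r (cderive (cderive (w0 nu)) r).
    apply: (cder_near open_Rpos _ Ur (csm_cder (csm_cderive sw) Ur)) => y /Rpos_gt0 y0.
    exact: cder_cderive (cder_w0 nu y0).
  apply: cder_eq (cderZ c (cderB (cderM dw' (csm_cder sH Ur))
    (cderM (cder_w0 nu r0) (csm_cder (csm_cderive sH) Ur)))) _.
  have -> : cderive (cderive (w0 nu)) r = (0 - 4^-1) * ((r ^+ 2)^-1)%:C * w0 nu r.
    have := Lp_w0 nu r0; rewrite /Lp.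
    move: (cderive (cderive (w0 nu)) r) (_ * w0 nu r) => A B e.
    by rewrite -[LHS]addr0 -e addNKr.
  rewrite /Lp.
  by move: (H r) (cderive H r) (cderive (cderive H) r) (w0 nu r) (w0' nu r) ((r ^+ 2)^-1)%:C => *; ring.
have zF r : d / 2 < r -> F r = 0.
  move=> rd; have zH y : d / 2 < y -> H y = 0.
    move=> yd; rewrite /H stp1 ?subrr ?mulr0//.
    by rewrite mulrAC ler_pdivlMr//; move: yd; rewrite ltr_pdivrMr//; lra.
  have ob : open [set y : R | d / 2 < y] by exact: open_gt.
  by rewrite /F zH// (cderive_cst_near ob rd zH) !mulr0 subrr mulr0.
have [og og' sg] := bes0_boundary_bounds s_im; pose g := bes0_rem s.
have FE r : 0 < r -> r < d / 4 ->
    F r = 2 * (c * (nu - nu')) + c * (w0' nu r * g r - w0 nu r * cderive g r).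
  move=> r0 rd; have Ur : Rpos r by exact/RposP.
  have Hu y : y < d / 4 -> H y = g y - 2 * w0 nu' y.
    move=> yd; rewrite /g /bes0_rem addrK /H stp0 ?subr0 ?mulr1//.
    by rewrite mulrAC ler_pdivrMr// mul1r; move: yd; rewrite ltr_pdivlMr// mulrC => /ltW.
  have oa : open [set y : R | y < d / 4] by exact: open_lt.
  have dH : cder H r (cderive g r - 2 * w0' nu' r).
    apply: (cder_near oa (fun y yd => esym (Hu y yd)) rd).
    exact: cderB (csm_cder sg Ur) (cderZ 2 (cder_w0 nu' r0)).
  rewrite /F (cder_cderive dH) Hu// -(w0_wronskian nu nu' r0).
  by move: (w0 nu r) (w0' nu r) (w0 nu' r) (w0' nu' r) (g r) (cderive g r) => *; ring.
have ow : ord0 4^-1 (w0 nu).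
  apply: ordD.
    apply: ord0M (ord_cpowR _ _) (@ord0_ln R 4^-1 _) _; last by rewrite Re_half; lra.
    by rewrite invr_gt0.
  by apply: ord0_le (ordZ nu (ord_cpowR _ _)); rewrite Re_half; lra.
have ow' : ord0 (- (3 / 4)) (w0' nu).
  apply: ordD.
    apply: ord0M (ordZ _ (ord_cpowR _ _)) (@ord0_ln R 4^-1 _) _; first by rewrite invr_gt0.
    by rewrite ReD ReN Re_half/=; lra.
  by apply: ord0_le (ordZ _ (ord_cpowR _ _)); rewrite ReD ReN Re_half/=; lra.
have [K K0 hK] : ord0 1 (fun r => c * (w0' nu r * g r - w0 nu r * cderive g r)).
  apply: ordZ; apply: ordB; first by apply: ord0M ow' og _; lra.
  by apply: ord0M ow og' _; lra.
have cA : ccvg (fun n => F n.+1%:R^-1) (2 * (c * (nu - nu'))).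
  apply: (ccvg_norm0 (v := fun n => K * pw (- 1) n.+1%:R)); last exact: pw_cvg0.
  near=> n; have n0 : (0 : R) < n.+1%:R^-1 by rewrite invr_gt0.
  have nd : n.+1%:R^-1 < d / 4.
    rewrite -[d / 4]invrK ltf_pV2 ?posrE ?invr_gt0//.
    have : (d / 4)^-1 <= n%:R by near: n; exact: nbhs_infty_ger.
    by move=> /le_lt_trans; apply; rewrite ltr_nat.
  rewrite FE// addrC addKr -(pwV 1)//; apply: hK => //=.
  by apply: (le_trans (ltW nd)); move: d1 => ?; lra.
have cB : ccvg (fun n => F n.+1%:R) 0.
  apply: (ccvg_norm0 (v := fun=> 0)); last exact: cvg_cst.
  near=> n; rewrite zF ?subrr ?normc0//.
  have : d / 2 <= n%:R by near: n; exact: nbhs_infty_ger.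
  by move=> /le_lt_trans; apply; rewrite ltr_nat.
have cf : ccont (fun r => c * w0 nu r * Lp 0 H r).
  apply: csm_ccont; apply: (csmM open_Rpos); first exact: csmZ open_Rpos sw.
  exact: csm_Lp.
have := cint_FTC dF cf IH cA cB; rewrite E sub0r => /esym/eqP.
by rewrite oppr_eq0 mulf_eq0 pnatr_eq0/= => /eqP.
Unshelve. all: by end_near. Qed.

Lemma H_0_elim nu lam f : H_0 nu f (fun r => lam * f r) -> Lmax 0 f (fun r => lam * f r) /\
  exists c zeta g' (d : R), [/\ 0 < d <= 1, (forall r, 0 <= r < d -> zeta r = 1) &
    Lmin 0 (fun r => (f r - c * w0 nu r) * zeta r) g'].
Proof.
move=> [hf [c [zeta [_ [d d0 zeta1] [g' hg]]]]]; split => //.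
exists c, zeta, g', (Num.min d 1); split => //.
  by rewrite lt_min d0 ltr01 ge_min lexx orbT.
by move=> r /andP[r0]; rewrite lt_min => /andP[rd _]; apply: zeta1; rewrite r0.
Qed.

(** If [c] vanishes then [f] lies in the minimal domain near [0] and
    [unique_minimal] gives [f = 0]. *)
Lemma H_0_eigenvalue (s : R[i]) nu : `|Im s| < pi / 2 ->
  sigma_p (H_0 nu) (lamb s) -> nu = s + euler_gamma%:C.
Proof.
move=> s_im [f /H_0_elim[hf [c [zeta [g' [d [/andP[d0 d1] zeta1 hg]]]]]] nz].
have /eqP := unique_boundary s_im d0 d1 hf zeta1 hg.
rewrite mulf_eq0 => /orP[/eqP c0|]; last by rewrite subr_eq0 => /eqP.
case: nz; apply: (unique_minimal d0 d1 hf zeta1 (g' := g')).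
have -> : (fun r => (f r - 0 * w0 0 r) * zeta r) = (fun r => (f r - c * w0 nu r) * zeta r).
  by apply/funext => r; rewrite c0 !mul0r.
exact: hg.
Qed.

End Uniqueness.

(** * The eigenvalues in terms of the parameters *)

Section Logarithm.
Context {R : realType}.
Implicit Types (z s nu m kappa : R[i]) (u : nat -> R[i]).

Lemma cos_carg z : z != 0 ->
  normc z * cos (carg z) = Re z /\ normc z * sin (carg z) = Im z.
Proof.
move=> z0; have n0 : 0 < normc z by [rewrite normc_gt0|]; pose t := Re z / normc z.
have n1 : normc z != 0 by rewrite gt_eqF.
have ReE : Re z = normc z * t by rewrite /t; field.
have t1 : -1 <= t <= 1.
  rewrite -ler_norml /t normrM normfV (gtr0_norm n0) ler_pdivrMr// mul1r.
  exact: normc_Re.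
have [_ ct] := acos_def t1.
have st : normc z * sin (acos t) = `|Im z|.
  rewrite sin_acos// -{1}(gtr0_norm n0) -sqrtr_sqr -sqrtrM ?sqr_ge0// -sqrtr_sqr.
  congr Num.sqrt; rewrite mulrBr mulr1 -exprMn -ReE sqr_normc_ReIm; ring.
rewrite /carg -/t; case: ifPn => Iz.
  by rewrite ct -ReE st ger0_norm.
rewrite cosN sinN ct -ReE mulrN st ltr0_norm ?opprK//.
by rewrite ltNge.
Qed.

Lemma cexp_clog z : z != 0 -> cexp (clog z) = z.
Proof.
move=> z0; have n0 : 0 < normc z by [rewrite normc_gt0|]; have [c1 c2] := cos_carg z0.
rewrite /cexp /clog lnK ?posrE//; apply: complexP; rewrite /= ?mul0r ?subr0 ?addr0.
  by rewrite c1.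
by rewrite c2.
Qed.

(** The principal argument is [pi] in absolute value only on the negative axis. *)
Lemma abs_carg_lt z : z != 0 -> ~ (Im z = 0 /\ Re z <= 0) -> `|carg z| < pi.
Proof.
move=> z0 h; have n0 : 0 < normc z by [rewrite normc_gt0|]; pose t := Re z / normc z.
have := normc_Re z; rewrite ler_norml => /andP[r1 r2].
have t1 : -1 < t <= 1.
  rewrite /t ltr_pdivlMr// ler_pdivrMr// mulN1r mul1r r2 andbT lt_neqAle r1 andbT.
  apply/negP => /eqP e; apply: h; rewrite -e oppr_le0 (ltW n0); split => //.
  have := sqr_normc_ReIm z; rewrite -e sqrrN => /eqP.
  by rewrite -subr_eq0 opprD addrA subrr sub0r oppr_eq0 expf_eq0/= => /eqP.
have ac := acos_ltpi t1.
have ac0 : 0 <= acos t by apply: acos_ge0; case/andP: t1 => /ltW -> ->.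
by rewrite /carg -/t; case: ifP => _; rewrite ?normrN ger0_norm.
Qed.

Lemma Re_lamb s : Re (lamb s) = - (4 * (expR (2 * Re s) * cos (2 * Im s))).
Proof.
rewrite /lamb /cexp (_ : 2 * s = (2 * Re s) +i* (2 * Im s)).
  rewrite (_ : (4 : R[i]) = 4%:C) ?rmorph_nat//=; ring.
by apply: complexP; rewrite (_ : 2 * s = s + s) ?ReD ?ImD/=; ring.
Qed.

Lemma Im_lamb s : Im (lamb s) = - (4 * (expR (2 * Re s) * sin (2 * Im s))).
Proof.
rewrite /lamb /cexp (_ : 2 * s = (2 * Re s) +i* (2 * Im s)).
  rewrite (_ : (4 : R[i]) = 4%:C) ?rmorph_nat//=; ring.
by apply: complexP; rewrite (_ : 2 * s = s + s) ?ReD ?ImD/=; ring.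
Qed.

(** [s] is half the logarithm of [- lambda / 4], which avoids the negative axis. *)
Lemma lamb_surj (lam : R[i]) : ~ (Im lam = 0 /\ 0 <= Re lam) ->
  exists2 s : R[i], `|Im s| < pi / 2 & lam = lamb s.
Proof.
move=> h; pose z := - lam / 4.
have zE : z = (- (Re lam / 4)) +i* (- (Im lam / 4)).
  have e4 : (4 : R[i])^-1 = (4^-1)%:C by rewrite fmorphV rmorph_nat.
  by rewrite /z e4; apply: complexP; case: (lam) => p q /=; ring.
have z0 : z != 0.
  apply/eqP => z0; apply: h; move: z0; rewrite /z => /eqP.
  rewrite mulf_eq0 invr_eq0 pnatr_eq0 orbF oppr_eq0 => /eqP ->.
  by rewrite lexx.
have hz : ~ (Im z = 0 /\ Re z <= 0).
  rewrite zE/= => -[/eqP e1 e2]; apply: h; split; last by lra.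
  by move: e1; rewrite oppr_eq0 mulf_eq0 invr_eq0 pnatr_eq0 orbF => /eqP.
exists (2^-1 * clog z).
  rewrite (_ : Im _ = carg z / 2); last first.
    have e2 : (2 : R[i])^-1 = (2^-1)%:C by rewrite fmorphV rmorph_nat.
    by rewrite e2 -[carg z]/(Im (clog z)); case: (clog z) => p q /=; ring.
  by rewrite normrM (ger0_norm (_ : 0 <= 2^-1)) ?invr_ge0// ltr_pM2r ?invr_gt0// abs_carg_lt.
have -> : lamb (2^-1 * clog z) = - (4 * cexp (clog z)).
  by rewrite /lamb (_ : 2 * (2^-1 * clog z) = clog z)//; field.
by rewrite cexp_clog// /z; field.
Qed.

Lemma ccvg_cvg u (l : R[i]) : ccvg u l -> (u : nat -> R[i]^o) @ \oo --> (l : R[i]^o).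
Proof.
move=> [c1 c2]; apply/cvgrPdist_lt => e e0.
have [eR Re0] : e = (Re e)%:C /\ 0 < Re e.
  by move: e0; rewrite ltcE/= => /andP[/eqP i0 r0]; split=> //; apply: complexP => //=; rewrite i0.
have e20 : 0 < Re e / 2 by rewrite divr_gt0.
near=> n; rewrite eR.
have h1 : `|Re l - Re (u n)| < Re e / 2 by near: n; exact: cvgr_dist_lt c1 _ e20.
have h2 : `|Im l - Im (u n)| < Re e / 2 by near: n; exact: cvgr_dist_lt c2 _ e20.
have : normc (l - u n) < Re e.
  by apply: le_lt_trans (normc_le _) _; rewrite ReD ReN ImD ImN; lra.
by rewrite -ltcR.
Unshelve. all: by end_near. Qed.

Lemma lamb_cvg (a b : nat -> R) (a' b' : R) : a @ \oo --> a' -> b @ \oo --> b' ->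
  cos (2 * b') = -1 -> sin (2 * b') = 0 ->
  ((fun n => lamb (a n +i* b n)) : nat -> R[i]^o) @ \oo --> ((4 * expR (2 * a'))%:C : R[i]^o).
Proof.
move=> ca cb c1 s1; apply: ccvg_cvg.
have ca2 : (fun n => expR (2 * a n)) @ \oo --> expR (2 * a').
  have c2 : (fun n => 2 * a n) @ \oo --> 2 * a' by exact: cvgMr.
  by apply: cvg_comp c2 _; exact: continuous_expR.
have cb2 : (fun n => 2 * b n) @ \oo --> 2 * b' by exact: cvgMr.
split.
  rewrite (_ : (fun n => Re _) = (fun n => - (4 * (expR (2 * a n) * cos (2 * b n))))); last first.
    by apply/funext => n; rewrite Re_lamb.
  have -> : Re (4 * expR (2 * a'))%:C = - (4 * (expR (2 * a') * cos (2 * b'))).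
    by rewrite c1/=; ring.
  apply: cvgN; apply: cvgMr; apply: cvgM => //.
  by apply: cvg_comp cb2 _; exact: continuous_cos.
rewrite (_ : (fun n => Im _) = (fun n => - (4 * (expR (2 * a n) * sin (2 * b n))))); last first.
  by apply/funext => n; rewrite Im_lamb.
have -> : Im (4 * expR (2 * a'))%:C = - (4 * (expR (2 * a') * sin (2 * b'))).
  by rewrite s1/=; ring.
apply: cvgN; apply: cvgMr; apply: cvgM => //.
by apply: cvg_comp cb2 _; exact: continuous_sin.
Qed.

(** [Gamma_strip] turns [Gamma (- m) / Gamma m] into Gamma values in the right
    half-plane. *)
Lemma varsigmaE m kappa : m != 0 -> `|Re m| < 1 ->
  varsigma m kappa = - (kappa * Gam (1 - m) / Gam (1 + m)).
Proof.
move=> m0 m1; have mN : - m != 0 by rewrite oppr_eq0.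
have mN1 : `|Re (- m)| < 1 by rewrite ReN normrN.
rewrite /varsigma !Gamma_strip//.
have g0 : Gam (1 + m) != 0 by apply: Gam_neq0; exact: one_add_re.
by move: (Gam (1 + m)) (Gam (1 - m)) g0 => A B A0; field; rewrite A0 m0.
Qed.

(** The eigenvalue is read off from [varsigma = exp (- 2 m s)]. *)
Lemma H_mk_eigenvalue m kappa s : m != 0 -> `|Re m| < 1 -> kappa != 0 ->
  `|Im s| < pi / 2 -> m^-1 * clog (varsigma m kappa) = - 2 * s ->
  sigma_p (H_mk m kappa) (lamb s).
Proof.
move=> m0 m1 k0 s_im e; exists (bes s m); last exact: bes_neq0.
have g1 := Gam_neq0 (one_sub_re m1); have g2 := Gam_neq0 (one_add_re m1).
have v0 : varsigma m kappa != 0.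
  by rewrite varsigmaE// oppr_eq0 !mulf_neq0 ?invr_eq0.
have vE : varsigma m kappa = cexp (- 2 * (m * s)).
  rewrite -[LHS]cexp_clog//; congr cexp.
  by rewrite -[LHS](mulVKf m0) e; ring.
apply: (bes_boundary s_im m1 m0).
have G1 z : 0 < Re z -> G (cexp s) 0 z = cexp (- (z * s)) * Gam z.
  by move=> z0; rewrite -(G0_rotation s_im z0) mulrA -cexpD addNr cexp0 mul1r.
rewrite !G1 ?one_sub_re ?one_add_re//.
have kE : kappa * Gam (1 - m) = - (cexp (- 2 * (m * s)) * Gam (1 + m)).
  by rewrite -vE varsigmaE//; move: (Gam (1 + m)) (Gam (1 - m)) g2 => A B A0; field; rewrite A0.
rewrite mulrCA kE mulrN mulrA -cexpD; congr (- (cexp _ * _)); ring.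
Qed.

(** A real [lambda >= 0] is excluded by [no_zero_eigenvalue] and
    [no_positive_eigenvalue]; every other [lambda] is some [lamb s'], and
    [H_0_eigenvalue] determines [s'] from [nu]. *)
Lemma H_0_spectrum nu s : `|Im s| < pi / 2 -> nu = s + euler_gamma%:C ->
  sigma_p (H_0 nu) = [set lamb s].
Proof.
move=> s_im nuE; apply/seteqP; split => [lam|_ ->] /=; last first.
  exists (bes s 0); first by rewrite nuE; exact: bes0_boundary.
  by apply: bes_neq0 => //; rewrite normr0.
move=> sp; have [[I0 R0]|h] := pselect (Im lam = 0 /\ 0 <= Re lam).
  move: sp => [f [hf _] nz]; case: nz.
  have lE : lam = (Re lam)%:C by apply: complexP.
  move: R0; rewrite le_eqVlt => /orP[/eqP l0|l0].
    by apply: no_zero_eigenvalue; rewrite lE -l0 in hf.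
  apply: (no_positive_eigenvalue (al := 0) (w := Num.sqrt (Re lam))); first by rewrite sqrtr_gt0.
  rewrite sqr_sqrtr ?(ltW l0)//; by rewrite lE in hf.
have [s' s'_im lE] := lamb_surj h.
rewrite lE in sp *; have := H_0_eigenvalue s'_im sp.
by rewrite nuE => /addIr ->.
Qed.

Lemma no_real_eigenvalue al f (x : R) : Lmax al f (fun r => (4 * expR x)%:C * f r) -> zeroL2 f.
Proof.
move=> hf; apply: (no_positive_eigenvalue (w := 2 * expR (x / 2))).
  by rewrite mulr_gt0 ?expR_gt0.
rewrite (_ : (2 * expR (x / 2)) ^+ 2 = 4 * expR x); first exact: hf.
by rewrite [in RHS](_ : x = x / 2 + x / 2) ?expRD; [ring|field].
Qed.

End Logarithm.


(** In both families the eigenvalue is [lamb s] with [s] read off from the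
    parameters, and the sequences are chosen so that [s] approaches the boundary
    [|Im s| = pi / 2] of the strip, where [lamb s] becomes positive. *)
Theorem lemma3p3 (R : realType) :
  (* (i) *)
  (forall (m kappa : nat -> R[i]) (a_oo : R),
    (forall n, m n != 0 /\ `|Re (m n)| < 1) ->
    (forall n, kappa n != 0) ->
    let a := fun n => Re ((m n)^-1 * clog (varsigma (m n) (kappa n))) in
    let b := fun n => Im ((m n)^-1 * clog (varsigma (m n) (kappa n))) in
    a @ \oo --> a_oo ->
    [/\ increasing_seq b -> b @ \oo --> (pi : R) ->
          exists lambda : nat -> R[i]^o,
            (\forall n \near \oo,
               sigma_p (H_mk (m n) (kappa n)) (lambda n) /\ 0 < Im (lambda n)) /\
            lambda @ \oo --> ((4 * expR (- a_oo))%:C : R[i]^o),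
        decreasing_seq b -> b @ \oo --> (- pi : R) ->
          exists lambda : nat -> R[i]^o,
            (\forall n \near \oo,
               sigma_p (H_mk (m n) (kappa n)) (lambda n) /\ Im (lambda n) < 0) /\
            lambda @ \oo --> ((4 * expR (- a_oo))%:C : R[i]^o) &
        forall m' kappa' : R[i], m' != 0 -> `|Re m'| < 1 ->
          ~ sigma_p (H_mk m' kappa') (4 * expR (- a_oo))%:C])
  /\
  (* (ii) *)
  (forall (a : nat -> R) (a_oo : R),
    a @ \oo --> a_oo ->
    [/\ forall b : nat -> R, (forall n, 0 < b n < pi / 2) ->
          nondecreasing_seq b -> b @ \oo --> (pi / 2 : R) ->
          exists lambda : nat -> R[i]^o,
            (forall n, sigma_p (H_0 (a n +i* b n)) = [set lambda n] /\
                       Im (lambda n) < 0) /\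
            lambda @ \oo --> ((4 * expR (2 * (a_oo - euler_gamma)))%:C : R[i]^o),
        forall b : nat -> R, (forall n, - (pi / 2) < b n < 0) ->
          nonincreasing_seq b -> b @ \oo --> (- (pi / 2) : R) ->
          exists lambda : nat -> R[i]^o,
            (forall n, sigma_p (H_0 (a n +i* b n)) = [set lambda n] /\
                       0 < Im (lambda n)) /\
            lambda @ \oo --> ((4 * expR (2 * (a_oo - euler_gamma)))%:C : R[i]^o) &
        forall nu : R[i],
          ~ sigma_p (H_0 nu) (4 * expR (2 * (a_oo - euler_gamma)))%:C]).
Proof.
have p0 := @pi_gt0 R.
have sinN2 (y : R) : 0 < y -> y < pi / 2 -> 0 < sin (2 * y).
  by move=> y0 y1; apply: sin_gt0_pi; apply/andP; split; lra.
split=> [m kappa a_oo m01 k0 a b ca|a a_oo ca].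
  pose s n : R[i] := (- (a n / 2)) +i* (- (b n / 2)).
  have es n : (m n)^-1 * clog (varsigma (m n) (kappa n)) = - 2 * s n.
    rewrite (_ : - 2 * s n = - (s n + s n)); last by ring.
    by apply: complexP => /=; rewrite -/(a n) -/(b n); field.
  have eig n : `|b n| < pi -> sigma_p (H_mk (m n) (kappa n)) (lamb (s n)).
    move=> bn; have [m0 m1] := m01 n; apply: H_mk_eigenvalue (es n) => //.
    by rewrite /= normrN normrM (ger0_norm (_ : 0 <= 2^-1)) ?invr_ge0// ltr_pM2r ?invr_gt0.
  have ca2 : (fun n => - (a n / 2)) @ \oo --> - (a_oo / 2) by apply: cvgN; exact: cvgMl.
  have lim2 : 4 * expR (- a_oo) = 4 * expR (2 * - (a_oo / 2)) by congr (_ * expR _); field.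
  split.
  - move=> incb cb; exists (fun n => lamb (s n)); split.
      have bpi n : b n < pi.
        have lt : b n < b n.+1 by have /increasing_seqP := incb; apply.
        apply: lt_le_trans lt _; rewrite -(cvg_lim (@Rhausdorff R) cb).
        apply: nondecreasing_cvgn_le; last by apply/cvg_ex; exists pi.
        by move=> i j ij; rewrite incb.
      near=> n; have b0 : 0 < b n by near: n; exact: cvgr_gt cb _ p0.
      split; first by apply: eig; rewrite gtr0_norm.
      rewrite Im_lamb/= (_ : 2 * - (b n / 2) = - b n); last by field.
      by rewrite sinN mulrN mulrN opprK !mulr_gt0 ?expR_gt0// sin_gt0_pi// b0 bpi.
    rewrite lim2; apply: lamb_cvg ca2 (_ : _ @ \oo --> - (pi / 2)) _ _.
    + by apply: cvgN; exact: cvgMl.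
    + by rewrite (_ : 2 * - (pi / 2) = - pi) ?cosN ?cospi//; field.
    + by rewrite (_ : 2 * - (pi / 2) = - pi) ?sinN ?sinpi ?oppr0//; field.
  - move=> decb cb; exists (fun n => lamb (s n)); split.
      have bpi n : - pi < b n.
        have lt : b n.+1 < b n by have /decreasing_seqP := decb; apply.
        apply: le_lt_trans lt; rewrite -(cvg_lim (@Rhausdorff R) cb).
        apply: nonincreasing_cvgn_ge; last by apply/cvg_ex; exists (- pi).
        by move=> i j ij; rewrite decb.
      have np0 : - pi < 0 :> R by rewrite oppr_lt0.
      near=> n; have b0 : b n < 0 by near: n; exact: cvgr_lt cb _ np0.
      split; first by apply: eig; rewrite ltr0_norm// ltrNl.
      rewrite Im_lamb/= (_ : 2 * - (b n / 2) = - b n); last by field.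
      rewrite oppr_lt0 !mulr_gt0 ?expR_gt0// sin_gt0_pi// oppr_gt0 b0/=.
      by rewrite ltrNl.
    rewrite lim2; apply: lamb_cvg ca2 (_ : _ @ \oo --> - (- pi / 2)) _ _.
    + by apply: cvgN; exact: cvgMl.
    + by rewrite (_ : 2 * - (- pi / 2) = pi) ?cospi//; field.
    + by rewrite (_ : 2 * - (- pi / 2) = pi) ?sinpi//; field.
  - by move=> m' kappa' _ _ [f [hf _]]; apply; exact: no_real_eigenvalue hf.
pose s (b : nat -> R) n : R[i] := (a n - euler_gamma) +i* b n.
have sE b n : a n +i* b n = s b n + euler_gamma%:C.
  by apply: complexP => /=; ring.
have ca2 : (fun n => a n - euler_gamma) @ \oo --> a_oo - euler_gamma.
  by apply: cvgB => //; exact: cvg_cst.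
split.
- move=> b bP _ cb; exists (fun n => lamb (s b n)); split.
    move=> n; have /andP[b0 b1] := bP n; split.
      by apply: H_0_spectrum (sE b n); rewrite /= gtr0_norm.
    by rewrite Im_lamb/= oppr_lt0 !mulr_gt0 ?expR_gt0// sinN2.
  apply: lamb_cvg ca2 cb _ _.
    by rewrite (_ : 2 * (pi / 2) = pi) ?cospi//; field.
  by rewrite (_ : 2 * (pi / 2) = pi) ?sinpi//; field.
- move=> b bP _ cb; exists (fun n => lamb (s b n)); split.
    move=> n; have /andP[b1 b0] := bP n; split.
      by apply: H_0_spectrum (sE b n); rewrite /= ltr0_norm// ltrNl.
    have sb : 0 < sin (2 * - b n) by apply: sinN2; [rewrite oppr_gt0|rewrite ltrNl].
    rewrite Im_lamb/= (_ : sin (2 * b n) = - sin (2 * - b n)); last by rewrite mulrN sinN opprK.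
    by rewrite !(mulrN (expR _)) mulrN opprK !mulr_gt0 ?expR_gt0.
  apply: lamb_cvg ca2 cb _ _.
    by rewrite (_ : 2 * - (pi / 2) = - pi) ?cosN ?cospi//; field.
  by rewrite (_ : 2 * - (pi / 2) = - pi) ?sinN ?sinpi ?oppr0//; field.
- by move=> nu [f [hf _]]; apply; exact: no_real_eigenvalue hf.
Unshelve. all: by end_near. Qed.
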